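(* Suppose that a translation surface $S$ is algebraically periodic and that $S$ has a decomposition into squares such that the directions of the sides of the squares are algebraically periodic directions. Then the periodic direction field $K$ of $S$ is totally real.
   Context: A translation surface is a compact (connected, oriented) surface $S$ obtained by gluing finitely many polygons in $\mathbb{R}^2$ along parallel edges by translations. A decomposition into squares is a decomposition into finitely many Euclidean squares with disjoint interiors; the squares need not have equal side lengths and the decomposition need not be edge-to-edge. View $\mathbb{R}^2$ and $\mathbb{R}$ as $\mathbb{Q}$-vector spaces. Take an edge-to-edge decomposition of $S$ into Euclidean triangles $\Delta_j$ whose vertex set contains the singular points, and let $v_j,w_j\in\mathbb{R}^2$ be two successive sides of $\Delta_j$ in counterclockwise order. The $J$-invariant is $J(S)=\sum_j v_j\wedge w_j\in\mathbb{R}^2\wedge_{\mathbb{Q}}\mathbb{R}^2$ (independent of the triangulation). For $0\ne v\in\mathbb{R}^2$ let $\pi:\mathbb{R}^2\to\mathbb{R}$ be the orthogonal projection with kernel $\mathbb{R}v$, and let $\mathrm{SAF}_v(S)\in\mathbb{R}\wedge_{\mathbb{Q}}\mathbb{R}$ be the image of $J(S)$ under the map induced by $\pi$. The direction $v$ is algebraically periodic if $\mathrm{SAF}_v(S)=0$. $S$ is algebraically periodic if it has at least three algebraically periodic directions. In that case, after a linear change of coordinates so that the directions of slopes $0,1,\infty$ are algebraically periodic, the set of finite slopes of algebraically periodic directions is a number field contained in $\mathbb{R}$ (independent of the choices), called the periodic direction field of $S$. A number field is totally real if all its embeddings into $\mathbb{C}$ have image in $\mathbb{R}$. *)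

(* Defs.v *)
From HB Require Import structures.
From Stdlib Require Import Relation_Operators.
From mathcomp Require Import all_boot all_order all_algebra all_field.
From mathcomp Require Import generic_quotient ring_quotient.
From mathcomp.multinomials Require Import freeg.
From mathcomp.real_closed Require Import complex.
From mathcomp Require Import ring.
From mathcomp Require Import boolp classical_sets reals prodnormedzmodule topology normedtype.

Set Implicit Arguments.
Unset Strict Implicit.
Unset Printing Implicit Defensive.

Import Order.TTheory GRing.Theory Num.Theory.
Import numFieldNormedType.Exports.

Local Open Scope classical_set_scope.
Local Open Scope ring_scope.

(* The exterior square of a rational vector space: the free rational vector
   space on the symbols (u, v), modulo bilinearity and alternation. *)

Section ExteriorSquare.
Variable V : lmodType rat.

Inductive ext2_rel : {freeg (V * V) / rat} -> Prop :=
| Ext2Rel0 : ext2_rel 0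
| Ext2RelZD (a : rat) x y : ext2_rel x -> ext2_rel y -> ext2_rel (a *: x + y)
| Ext2RelDl u u' w : ext2_rel (<< (u + u', w) >> - << (u, w) >> - << (u', w) >>)
| Ext2RelZl a u w : ext2_rel (<< (a *: u, w) >> - a *: << (u, w) >>)
| Ext2RelDr u w w' : ext2_rel (<< (u, w + w') >> - << (u, w) >> - << (u, w') >>)
| Ext2RelZr a u w : ext2_rel (<< (u, a *: w) >> - a *: << (u, w) >>)
| Ext2RelAlt u : ext2_rel << (u, u) >>.

Definition ext2_pred : {pred {freeg (V * V) / rat}} :=
  fun x => `[< ext2_rel x >].

Lemma ext2_predP x : reflect (ext2_rel x) (x \in ext2_pred).
Proof. exact: asboolP. Qed.

Lemma ext2_pred_zmod_closed : zmod_closed ext2_pred.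
Proof.
split=> [|x y /ext2_predP rx /ext2_predP ry]; apply/ext2_predP.
  exact: Ext2Rel0.
by rewrite addrC -scaleN1r; exact: Ext2RelZD.
Qed.

HB.instance Definition _ :=
  GRing.isZmodClosed.Build {freeg (V * V) / rat} ext2_pred ext2_pred_zmod_closed.

Definition ext2 := Quotient.quot ext2_pred.
HB.instance Definition _ := GRing.Zmodule.on ext2.

Local Notation "\pi2 x" := (\pi_(Quotient.quot ext2_pred) x)%qT (at level 10).

Lemma ext2_piP x y : reflect (\pi2 x = \pi2 y) (x - y \in ext2_pred).
Proof. by rewrite Quotient.idealrBE; exact: eqP. Qed.

Definition ext2_scale (a : rat) (x : ext2) : ext2 := \pi2 (a *: repr x).

Lemma ext2_predZ a x : x \in ext2_pred -> a *: x \in ext2_pred.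
Proof.
move=> /ext2_predP rx; apply/ext2_predP; rewrite -[_ *: _]addr0.
exact: (Ext2RelZD _ rx Ext2Rel0).
Qed.

Lemma pi_ext2_scale a x : ext2_scale a (\pi2 x) = \pi2 (a *: x).
Proof.
apply/ext2_piP; rewrite -scalerBr; apply: ext2_predZ.
by apply/ext2_piP; rewrite reprK.
Qed.

Lemma pi2D x y : \pi2 (x + y) = (\pi2 x : ext2) + \pi2 y.
Proof. exact: Quotient.pi_add. Qed.

Fact ext2_scaleA a b x : ext2_scale a (ext2_scale b x) = ext2_scale (a * b) x.
Proof. by rewrite -[x]reprK !pi_ext2_scale scalerA reprK. Qed.

Fact ext2_scale1 : left_id 1 ext2_scale.
Proof. by move=> x; rewrite -[x]reprK pi_ext2_scale scale1r. Qed.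

Fact ext2_scaleDr : right_distributive ext2_scale +%R.
Proof.
move=> a x y; rewrite -[x]reprK -[y]reprK -pi2D !pi_ext2_scale scalerDr.
exact: pi2D.
Qed.

Fact ext2_scaleDl x : {morph ext2_scale^~ x : a b / a + b}.
Proof. by move=> a b; rewrite -[x]reprK !pi_ext2_scale scalerDl pi2D. Qed.

HB.instance Definition _ := GRing.Zmodule_isLmodule.Build rat ext2
  ext2_scaleA ext2_scale1 ext2_scaleDr ext2_scaleDl.

Definition wedge (u v : V) : ext2 := \pi2 << (u, v) >>.

Lemma wedgeDl u u' w : wedge (u + u') w = wedge u w + wedge u' w.
Proof.
rewrite /wedge -pi2D; apply/ext2_piP/ext2_predP.
by rewrite opprD addrA; exact: Ext2RelDl.
Qed.

Lemma wedgeDr u w w' : wedge u (w + w') = wedge u w + wedge u w'.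
Proof.
rewrite /wedge -pi2D; apply/ext2_piP/ext2_predP.
by rewrite opprD addrA; exact: Ext2RelDr.
Qed.

Lemma wedgeZl a u w : wedge (a *: u) w = a *: wedge u w.
Proof.
rewrite /wedge [RHS]pi_ext2_scale; apply/ext2_piP/ext2_predP.
exact: Ext2RelZl.
Qed.

Lemma wedgeZr a u w : wedge u (a *: w) = a *: wedge u w.
Proof.
rewrite /wedge [RHS]pi_ext2_scale; apply/ext2_piP/ext2_predP.
exact: Ext2RelZr.
Qed.

Lemma wedge_alt u : wedge u u = 0.
Proof.
have <- : \pi2 0 = 0 :> ext2 by apply: (addIr (\pi2 0)); rewrite -pi2D !add0r.
by apply/ext2_piP/ext2_predP; rewrite subr0; exact: Ext2RelAlt.
Qed.

End ExteriorSquare.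

Section ExteriorSquareMap.
Variables (V W : lmodType rat) (f : {linear V -> W}).

Definition ext2_lift : {freeg (V * V) / rat} -> ext2 W :=
  fglift (fun p : V * V => wedge (f p.1) (f p.2)).

(* u /\ v goes to f u /\ f v (see ext2_map_wedge); the representative does not
   matter (see ext2_map_pi). *)
Definition ext2_map (x : ext2 V) : ext2 W := ext2_lift (repr x).

Lemma ext2_lift_zmod : zmod_morphism ext2_lift.
Proof. exact: lift_is_additive. Qed.
HB.instance Definition _ := GRing.isZmodMorphism.Build
  {freeg (V * V) / rat} (ext2 W) ext2_lift ext2_lift_zmod.

Lemma ext2_liftU a u v : ext2_lift << a *g (u, v) >> = a *: wedge (f u) (f v).
Proof. exact: liftU. Qed.

Lemma ext2_liftZ : scalable ext2_lift.
Proof.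
move=> a x; rewrite -[x in RHS]freeg_sumE raddf_sum.
rewrite [X in _ = _ *: X]raddf_sum scaler_sumr.
by apply: eq_bigr => -[u v] _; rewrite /= !ext2_liftU scalerA.
Qed.

Lemma ext2_lift_rel x : ext2_rel x -> ext2_lift x = 0.
Proof.
elim=> {x} [|a x y _ hx _ hy|u u' w|a u w|u w w'|a u w|u];
  rewrite ?raddf0 ?raddfD ?raddfN /= ?ext2_liftZ ?ext2_liftU //= ?scale1r.
- by rewrite hx hy scaler0 addr0.
- by rewrite linearD wedgeDl addrAC addrK subrr.
- by rewrite linearZ wedgeZl subrr.
- by rewrite linearD wedgeDr addrAC addrK subrr.
- by rewrite linearZ wedgeZr subrr.
- exact: wedge_alt.
Qed.

Lemma ext2_map_pi x :
  ext2_map (\pi_(Quotient.quot (@ext2_pred V)) x)%qT = ext2_lift x.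
Proof.
apply/eqP; rewrite -subr_eq0 /ext2_map -raddfB; apply/eqP/ext2_lift_rel.
by apply/ext2_predP/ext2_piP; rewrite reprK.
Qed.

Lemma ext2_map_wedge u v : ext2_map (wedge u v) = wedge (f u) (f v).
Proof. by rewrite ext2_map_pi ext2_liftU scale1r. Qed.

Lemma ext2_map_linear : linear ext2_map.
Proof.
move=> a x y; rewrite -[x]reprK -[y]reprK.
rewrite [a *: _](pi_ext2_scale a (repr x)) -[_ + _]pi2D !ext2_map_pi.
by rewrite raddfD /= ext2_liftZ.
Qed.
HB.instance Definition _ :=
  GRing.isLinear.Build rat (ext2 V) (ext2 W) *:%R ext2_map ext2_map_linear.

End ExteriorSquareMap.

Section Plane.
Variable R : realType.

Definition cross (u v : R * R) : R := u.1 * v.2 - u.2 * v.1.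

(* The counterclockwise rotation by a right angle. *)
Definition rot90 (u : R * R) : R * R := (- u.2, u.1).

Definition seg (p q : R * R) : set (R * R) :=
  [set x | exists2 t : R, 0 <= t <= 1 & x = p + t *: (q - p)].

(* An alias of R whose scalars are the rationals. *)

Definition rat_module : Type := R.
HB.instance Definition _ := GRing.Zmodule.on rat_module.

Definition rat_scale (a : rat) (x : rat_module) : rat_module := ratr a * (x : R).

Fact rat_scaleA a b x : rat_scale a (rat_scale b x) = rat_scale (a * b) x.
Proof. by rewrite /rat_scale rmorphM mulrA. Qed.

Fact rat_scale1 : left_id 1 rat_scale.
Proof. by move=> x; rewrite /rat_scale rmorph1 mul1r. Qed.

Fact rat_scaleDr : right_distributive rat_scale +%R.
Proof. by move=> a x y; rewrite /rat_scale mulrDr. Qed.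

Fact rat_scaleDl x : {morph rat_scale^~ x : a b / a + b}.
Proof. by move=> a b; rewrite /rat_scale rmorphD mulrDl. Qed.

HB.instance Definition _ := GRing.Zmodule_isLmodule.Build rat rat_module
  rat_scaleA rat_scale1 rat_scaleDr rat_scaleDl.

Definition rat_plane : lmodType rat := (rat_module * rat_module)%type.

(* The orthogonal projection with kernel the line spanned by v, whose image
   (the line orthogonal to v) is identified with the reals by means of the unit
   vector rot90 v / |v|. *)
Definition proj (v : R * R) (x : rat_plane) : rat_module :=
  cross v x / Num.sqrt (v.1 ^+ 2 + v.2 ^+ 2).

Fact proj_linear v : linear (proj v).
Proof.
move=> a [x1 x2] [y1 y2]; rewrite /proj /cross /=.
set c := (Num.sqrt _)^-1; set r : R := ratr a.
suff : (v.1 * (r * x2 + y2) - v.2 * (r * x1 + y1)) * c =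
  r * ((v.1 * x2 - v.2 * x1) * c) + (v.1 * y2 - v.2 * y1) * c :> R by [].
ring.
Qed.
HB.instance Definition _ v := GRing.isLinear.Build rat
  rat_plane rat_module *:%R (proj v) (proj_linear v).

End Plane.

(* Plane pieces, each with a cyclic sequence of vertices, and an identification
   of their edges in pairs. *)

Record gluing (R : realType) := Gluing {
  cell : finType;
  nvtx : cell -> nat;
  vtx : forall i, 'I_(nvtx i) -> R * R;
  region : cell -> set (R * R);
  mate : {i : cell & 'I_(nvtx i)} -> {i : cell & 'I_(nvtx i)}
}.

Arguments vtx {R} g i _.
Arguments region {R} g _ _.
Arguments mate {R} g _.

Section Gluing.
Variables (R : realType) (G : gluing R).

Definition edge : finType := {i : cell G & 'I_(nvtx i)}.
Definition edge_src (e : edge) : R * R := vtx G (tag e) (tagged e).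
Definition edge_tgt (e : edge) : R * R := vtx G (tag e) (ordS (tagged e)).
Definition edge_vec (e : edge) : R * R := edge_tgt e - edge_src e.

(* All pieces lie to the left of their edges, so that two edges which a
   translation identifies are run through in opposite directions. *)
Definition glued_by_translations : Prop :=
  involutive (mate G) /\ forall e : edge, edge_vec (mate G e) = - edge_vec e.

Definition glued_connected : Prop :=
  forall i j : cell G,
    connect [rel a b | [exists e : edge, (tag e == a) && (tag (mate G e) == b)]] i j.

(* A point of the glued surface is represented by a cell and a point of its
   region, and two representatives are the same point when they are related by
   [same]. *)
Definition rep : Type := (cell G * (R * R))%type.

Definition is_point (x : rep) : Prop := region G x.1 x.2.

Definition glued (x y : rep) : Prop :=
  exists (e : edge) (t : R), [/\ 0 <= t <= 1,
    x = (tag e, edge_src e + t *: edge_vec e) &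
    y = (tag (mate G e), edge_tgt (mate G e) + t *: edge_vec e)].

Definition same : rep -> rep -> Prop := clos_refl_sym_trans rep glued.

(* [step x y v]: a straight segment with holonomy vector v leads from x to y
   inside one of the cells. When v is short, this means that some straight
   segment of the surface with holonomy vector v leads from x to y. *)
Definition step (x y : rep) (v : R * R) : Prop :=
  exists i p, [/\ same x (i, p), same y (i, p + v) &
    forall t : R, 0 <= t <= 1 -> region G i (p + t *: v)].

End Gluing.

(* A closed polygon P with the vertices p, in counterclockwise order: the
   compact set bounded by the simple closed curve through the vertices. *)
Record is_polygon (R : realType) (n : nat) (p : 'I_n -> R * R)
    (P : set (R * R)) : Prop := IsPolygon {
  polygon_size : (2 < n)%N;
  polygon_inj : injective p;
  polygon_simple : forall k l x, k != l ->
    seg (p k) (p (ordS k)) x -> seg (p l) (p (ordS l)) x ->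
    (l = ordS k /\ x = p l) \/ (k = ordS l /\ x = p k);
  polygon_compact : compact P;
  polygon_interior : P° !=set0;
  polygon_frontier : closure P `\` P° = \bigcup_k seg (p k) (p (ordS k));
  polygon_left : forall k, exists2 e : R, 0 < e & forall t, 0 < t < e ->
    P (2^-1 *: (p k + p (ordS k)) + t *: rot90 (p (ordS k) - p k))
}.

Record translation_surface (R : realType) := TranslationSurface {
  surface_gluing :> gluing R;
  surface_nonempty : (0 < #|cell surface_gluing|)%N;
  surface_polygon : forall i : cell surface_gluing,
    is_polygon (@vtx _ surface_gluing i) (region surface_gluing i);
  surface_translations : glued_by_translations surface_gluing;
  surface_connected : glued_connected surface_gluing
}.

(* Isomorphisms of translation surfaces, acting on representatives: bijections
   which preserve the short straight segments issued from a point, together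
   with their holonomy vectors. *)
Record is_translation_iso (R : realType) (G H : gluing R)
    (f : rep G -> rep H) : Prop := IsTranslationIso {
  iso_point : forall x, is_point x -> is_point (f x);
  iso_same : forall x y, is_point x -> is_point y ->
    (same (f x) (f y) <-> same x y);
  iso_surj : forall y, is_point y -> exists2 x, is_point x & same (f x) y;
  iso_local : forall x, is_point x -> exists2 e : R, 0 < e &
    forall (v : R * R) y, `|v| < e -> is_point y -> (step x y v <-> step (f x) (f y) v)
}.

(* An edge-to-edge decomposition of S into triangles is an isomorphism of S with
   a surface glued from triangles along full edges. The points of the latter
   which are not vertices of triangles have cone angle 2 pi. *)

Record triangulation (R : realType) (S : gluing R) := Triangulation {
  tri : finType;
  tri_vtx : tri -> 'I_3 -> R * R;
  tri_mate : {i : tri & 'I_3} -> {i : tri & 'I_3};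
  tri_ccw : forall i, 0 < cross (tri_vtx i 1 - tri_vtx i 0)
                                (tri_vtx i 2 - tri_vtx i 1);
  tri_gluing := @Gluing R tri (fun=> 3) tri_vtx
    (fun i => [set x | exists a : 'I_3 -> R, [/\ forall k, 0 <= a k,
       \sum_k a k = 1 & x = \sum_k a k *: tri_vtx i k]]) tri_mate;
  tri_translations : glued_by_translations tri_gluing;
  tri_map : rep tri_gluing -> rep S;
  tri_iso : is_translation_iso tri_map
}.

Section Squares.
Variable R : realType.

Definition closed_square (u : R * R) : set (R * R) :=
  [set x | exists s t : R, [/\ 0 <= s <= 1, 0 <= t <= 1 & x = s *: u + t *: rot90 u]].

Definition open_square (u : R * R) : set (R * R) :=
  [set x | exists s t : R, [/\ 0 < s < 1, 0 < t < 1 & x = s *: u + t *: rot90 u]].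

(* A Euclidean square in S is the image of a plane square with sides u and rot90 u
   under a map which is locally a translation, up to the boundary, and is
   injective on the interior. *)
Record square_decomposition (S : gluing R) := SquareDecomposition {
  square : finType;
  side : square -> R * R;
  square_map : square -> R * R -> rep S;
  side_neq0 : forall k, side k != 0;
  square_point : forall k x, closed_square (side k) x -> is_point (square_map k x);
  square_local : forall k x, closed_square (side k) x -> exists2 e : R, 0 < e &
    forall y, closed_square (side k) y -> `|y - x| < e ->
      step (square_map k x) (square_map k y) (y - x);
  square_disjoint : forall k l x y,
    open_square (side k) x -> open_square (side l) y ->
    same (square_map k x) (square_map l y) -> k = l /\ x = y;
  square_cover : forall z, is_point z -> exists k x,
    closed_square (side k) x /\ same (square_map k x) z
}.

End Squares.

Section PeriodicDirections.
Variables (R : realType) (S : gluing R) (T : triangulation S).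

Definition J_invariant : ext2 (rat_plane R) :=
  \sum_(i : tri T) wedge (tri_vtx i 1 - tri_vtx i 0 : rat_plane R)
                         (tri_vtx i 2 - tri_vtx i 1 : rat_plane R).

Definition SAF (v : R * R) : ext2 (rat_module R) := ext2_map (proj v) J_invariant.

Definition periodic_direction (v : R * R) : Prop := v != 0 /\ SAF v = 0.

Definition algebraically_periodic : Prop :=
  exists v1 v2 v3, [/\ periodic_direction v1, periodic_direction v2,
    periodic_direction v3 &
    [/\ cross v1 v2 != 0, cross v1 v3 != 0 & cross v2 v3 != 0]].

(* A linear change of coordinates is given by the basis (b1, b2) of vectors
   whose new coordinates are (1, 0) and (0, 1); the vectors with slopes 0, 1,
   infinity and s are then b1, b1 + b2, b2 and b1 + s *: b2. *)
Definition normalized (b1 b2 : R * R) : Prop :=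
  [/\ cross b1 b2 != 0, periodic_direction b1, periodic_direction (b1 + b2) &
      periodic_direction b2].

Definition periodic_slopes (b1 b2 : R * R) : set R :=
  [set s | periodic_direction (b1 + s *: b2)].

Definition is_periodic_direction_field (K : fieldExtType rat)
    (i : {rmorphism K -> R}) : Prop :=
  (exists b1 b2, normalized b1 b2) /\
  forall b1 b2, normalized b1 b2 -> range i = periodic_slopes b1 b2.

End PeriodicDirections.

Definition totally_real (R : realType) (K : fieldExtType rat) : Prop :=
  forall (s : {rmorphism K -> R[i]}) (x : K), exists y : R, s x = y%:C%C.

(* Main.v *)
(* For a biadditive form B with values in a Q-vector space, let <B> be the
   sum over the triangles of B(v, w) - B(w, v). In coordinates where the
   slopes 0, 1 and infinity are periodic, s is a periodic slope if and only
   if multiplication by s is self-adjoint for J, that is <B(s ., .)> = <B(.,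
   s .)> for all B. Such s form a field K. Contracting one side of J with a
   rational functional gives a nonzero real c, and c s is then a combination
   of finitely many fixed reals with rational coefficients, so that K has
   finite degree over Q.

   As S is connected, all the squares are parallel. Let x and y be the
   coordinates along their sides and l_k the side lengths of the squares.
   Then <B(x, y)> = 2 sum_k B(l_k, l_k) for all B: the tops and bottoms of
   the squares and the edges of the triangles that an almost arbitrary
   vertical line meets give an identity between step functions with values
   in R, which may be integrated against the increments of any additive
   function of the abscissa.

   For an embedding sigma of K in C choose a K-semilinear f from R to C with
   f(l_k) = 1 for one k, and let B(a, b) be the product of f(a) with the
   conjugate of f(b). Self-adjointness of s gives sigma(s) N =
   conj(sigma(s)) N, where N = sum_k |f(l_k)|^2 > 0, whence sigma(s) is
   real. *)

From HB Require Import structures.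
Require Import Defs.
From Stdlib Require Import Relation_Operators.
From mathcomp Require Import all_boot all_order all_algebra all_field.
From mathcomp Require Import generic_quotient ring_quotient.
From mathcomp.multinomials Require freeg.
From mathcomp.real_closed Require Import complex.
From mathcomp Require Import boolp classical_sets reals.
From mathcomp Require Import prodnormedzmodule topology normedtype.
From mathcomp Require Import ring lra.
Set Implicit Arguments.
Unset Strict Implicit.
Unset Printing Implicit Defensive.
Import Order.TTheory GRing.Theory Num.Theory.
Local Open Scope ring_scope.

(** * Step functions and biadditive forms *)

(** A form [B] is additive in each argument and nothing more, so it may be as wild as a
    discontinuous solution of Cauchy's equation: no approximation is possible and only finite sets
    may be neglected. Hence all identities along vertical lines are between finite combinations of
    interval indicators and hold outside finitely many abscissas, and it matters that squares and
    triangles overlap in only finitely many pieces. A combination of indicators that vanishes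
    outside a finite set has no jumps, which makes its integral zero whatever function it is
    integrated against.

    The identity has three sources. Inside a triangle the corners of successive squares differ by a
    side length. Across an edge they differ by the translation between the charts, plus a side
    length if a square ends there. Over almost every abscissa the top of a square is met exactly
    once. The trapezoid formula turns the sum over the triangles into one over the translations.

    At a point that is neither a corner nor a vertex each square fills at least a half disc, so two
    that are not parallel would overlap. The nonzero contraction exists because ordinary
    multiplication, as the form [B], gives twice a sum of squared side lengths. *)

Definition biadditive (U V W : zmodType) (B : U -> V -> W) : Prop :=
  (forall v, {morph B^~ v : u u' / u + u'}) /\
  (forall u, {morph B u : v v' / v + v'}).

Section Biadditive.
Variables (U V W : zmodType) (B : U -> V -> W).
Hypothesis BB : biadditive B.

Lemma biaddDl u u' v : B (u + u') v = B u v + B u' v.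
Proof. exact: BB.1. Qed.

Lemma biaddDr u v v' : B u (v + v') = B u v + B u v'.
Proof. exact: BB.2. Qed.

Lemma biadd0l v : B 0 v = 0.
Proof. by apply: (addrI (B 0 v)); rewrite -biaddDl !addr0. Qed.

Lemma biadd0r u : B u 0 = 0.
Proof. by apply: (addrI (B u 0)); rewrite -biaddDr !addr0. Qed.

Lemma biaddNl u v : B (- u) v = - B u v.
Proof. by apply: (addrI (B u v)); rewrite -biaddDl !subrr biadd0l. Qed.

Lemma biaddNr u v : B u (- v) = - B u v.
Proof. by apply: (addrI (B u v)); rewrite -biaddDr !subrr biadd0r. Qed.

Lemma biaddBl u u' v : B (u - u') v = B u v - B u' v.
Proof. by rewrite biaddDl biaddNl. Qed.

Lemma biaddBr u v v' : B u (v - v') = B u v - B u v'.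
Proof. by rewrite biaddDr biaddNr. Qed.

Lemma biadd_sumr (I : Type) (r : seq I) (P : pred I) (F : I -> V) u :
  B u (\sum_(i <- r | P i) F i) = \sum_(i <- r | P i) B u (F i).
Proof.
apply: (big_morph (B u) (id1 := 0) (op1 := +%R)) => [v v'|];
  [exact: biaddDr | exact: biadd0r].
Qed.

Lemma biaddMnr u v n : B u (v *+ n) = B u v *+ n.
Proof. by elim: n => [|n IH]; rewrite ?biadd0r // !mulrS biaddDr IH. Qed.

End Biadditive.

(** * Properties of all but finitely many reals *)

Section AlmostEverywhere.
Variable R : realFieldType.

Definition almost_all (P : R -> Prop) : Prop :=
  exists s : seq R, forall x, x \notin s -> P x.

Lemma almost_allW (P : R -> Prop) : (forall x, P x) -> almost_all P.
Proof. by move=> hP; exists [::]. Qed.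

Lemma almost_all_neq a : almost_all (fun x => x != a).
Proof. by exists [:: a] => x; rewrite inE. Qed.

Lemma almost_allS (P Q : R -> Prop) :
  (forall x, P x -> Q x) -> almost_all P -> almost_all Q.
Proof. by move=> PQ [s hs]; exists s => x /hs /PQ. Qed.

Lemma almost_allI (P Q : R -> Prop) :
  almost_all P -> almost_all Q -> almost_all (fun x => P x /\ Q x).
Proof.
move=> [s hs] [t ht]; exists (s ++ t) => x.
by rewrite mem_cat negb_or => /andP[/hs ? /ht ?].
Qed.

Lemma almost_allS2 (P Q S : R -> Prop) : (forall x, P x -> Q x -> S x) ->
  almost_all P -> almost_all Q -> almost_all S.
Proof.
move=> PQS hP hQ; apply: almost_allS (almost_allI hP hQ) => x [].
exact: PQS.
Qed.

Lemma almost_all_seq (I : eqType) (r : seq I) (P : I -> R -> Prop) :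
  (forall i, i \in r -> almost_all (P i)) ->
  almost_all (fun x => forall i, i \in r -> P i x).
Proof.
elim: r => [|i r IH] h; first exact: almost_allW.
apply: (almost_allS2 _ (h i (mem_head _ _)) (IH _)) => [x Pi Pr j|j jr].
  by rewrite inE => /predU1P[->|/Pr].
by apply: h; rewrite inE jr orbT.
Qed.

Lemma almost_all_fin (I : finType) (P : I -> R -> Prop) :
  (forall i, almost_all (P i)) -> almost_all (fun x => forall i, P i x).
Proof.
move=> h; apply: almost_allS (almost_all_seq (r := index_enum I) (fun i _ => h i)).
by move=> x hx i; apply: hx; rewrite mem_index_enum.
Qed.

Lemma almost_all_shift (P : R -> Prop) a :
  almost_all P -> almost_all (fun x => P (x + a)).
Proof.
move=> [s hs]; exists [seq y - a | y <- s] => x xs; apply: hs.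
apply: contra xs => xs; apply/mapP; exists (x + a) => //.
by rewrite addrK.
Qed.

Lemma left_gap (s : seq R) a : exists2 y, y < a & forall x, x \in s -> ~~ (y <= x < a).
Proof.
elim: s => [|b s [y ya hy]]; first by exists (a - 1) => //; lra.
have [ba|ab] := ltP b a; last first.
  exists y => // x; rewrite inE => /predU1P[->|/hy //].
  by rewrite ltNge ab andbF.
exists ((Num.max y b + a) / 2) => [|x].
  by case: (leP y b) => ?; lra.
rewrite inE => /predU1P[->|/hy hx]; apply/negP => /andP[h1 h2].
  by move: h1; case: (leP y b) => ? ?; lra.
by case/negP: hx; rewrite h2 andbT; move: h1; case: (leP y b) => ? ?; lra.
Qed.

Lemma right_gap (s : seq R) a : exists2 y, a < y & forall x, x \in s -> ~~ (a < x <= y).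
Proof.
have [y ya hy] := left_gap [seq - x | x <- s] (- a).
exists (- y) => [|x xs]; first by lra.
have := hy (- x) (map_f _ xs); apply: contra.
by move=> /andP[? ?]; apply/andP; split; lra.
Qed.

Lemma almost_all_ex (P : R -> Prop) a b :
  almost_all P -> a < b -> exists2 x, a < x < b & P x.
Proof.
move=> [s hs] ab; have [y ya hy] := right_gap s a.
exists (Num.min y ((a + b) / 2)).
  by rewrite lt_min gt_min ya !(midf_lt ab) orbT.
apply: hs; apply/negP => /hy; rewrite ge_min lexx andbT.
by rewrite lt_min ya /= (midf_lt ab).
Qed.

End AlmostEverywhere.

(* Integration of step functions against the differences of an arbitrary
   function F. *)
Section StepIntegral.
Variables (R : realFieldType) (U V W : zmodType).
Variables (B : U -> V -> W) (F : R -> U).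
Hypothesis BB : biadditive B.

(** A relation, since [w] is computed from one presentation of [h] by intervals; that it depends on
    [h] alone is [step_integral_uniq]. Nothing is asked of [F]. *)
Definition step_integral (h : R -> V) (w : W) : Prop :=
  exists s : seq (R * R * V),
  [/\ forall q, q \in s -> q.1.1 <= q.1.2,
      almost_all (fun x => h x = \sum_(q <- s) q.2 *+ (q.1.1 < x < q.1.2)%R) &
      w = \sum_(q <- s) B (F q.1.2 - F q.1.1) q.2].

Lemma step_integral_ext h h' w :
  almost_all (fun x => h x = h' x) -> step_integral h w -> step_integral h' w.
Proof.
move=> hh [s [s1 s2 s3]]; exists s; split=> //.
by apply: almost_allS2 hh s2 => x -> ->.
Qed.

Lemma step_integral_interval u v c : u <= v ->
  step_integral (fun x => c *+ (u < x < v)%R) (B (F v - F u) c).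
Proof.
move=> uv; exists [:: (u, v, c)]; split=> [q||].
- by rewrite inE => /eqP->.
- by apply: almost_allW => x; rewrite big_seq1.
- by rewrite big_seq1.
Qed.

Lemma step_integral0 : step_integral (fun=> 0) 0.
Proof.
by exists [::]; split=> //; [apply: almost_allW => x|]; rewrite big_nil.
Qed.

Lemma step_integralD h h' w w' : step_integral h w -> step_integral h' w' ->
  step_integral (fun x => h x + h' x) (w + w').
Proof.
move=> [s [s1 s2 s3]] [t [t1 t2 t3]]; exists (s ++ t); split=> [q||].
- by rewrite mem_cat => /orP[/s1|/t1].
- by apply: almost_allS2 s2 t2 => x -> ->; rewrite big_cat.
- by rewrite big_cat s3 t3.
Qed.

Lemma step_integralN h w :
  step_integral h w -> step_integral (fun x => - h x) (- w).
Proof.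
move=> [s [s1 s2 s3]]; exists [seq (q.1, - q.2) | q <- s]; split=> [q||].
- by move=> /mapP[q' /s1 ? ->].
- apply: almost_allS s2 => x ->; rewrite big_map -sumrN.
  by apply: eq_bigr => q _; rewrite mulNrn.
- by rewrite s3 big_map -sumrN; apply: eq_bigr => q _; rewrite (biaddNr BB).
Qed.

Lemma step_integralB h h' w w' : step_integral h w -> step_integral h' w' ->
  step_integral (fun x => h x - h' x) (w - w').
Proof. by move=> hw /step_integralN; apply: step_integralD. Qed.

Lemma step_integral_sum (I : eqType) (r : seq I) (P : pred I)
    (h : I -> R -> V) (w : I -> W) :
  (forall i, i \in r -> P i -> step_integral (h i) (w i)) ->
  step_integral (fun x => \sum_(i <- r | P i) h i x) (\sum_(i <- r | P i) w i).
Proof.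
elim: r => [|i r IH] H.
  rewrite big_nil; apply: (step_integral_ext _ step_integral0).
  by apply: almost_allW => x; rewrite big_nil.
have {}IH : step_integral (fun x => \sum_(j <- r | P j) h j x) (\sum_(j <- r | P j) w j).
  by apply: IH => j jr; apply: H; rewrite inE jr orbT.
rewrite big_cons; case: ifP => Pi.
  apply: step_integral_ext (step_integralD (H i (mem_head _ _) Pi) IH).
  by apply: almost_allW => x; rewrite big_cons Pi.
by apply: step_integral_ext IH; apply: almost_allW => x; rewrite big_cons Pi.
Qed.

(* Abel summation: collect the terms of the sum according to the end points;
   the coefficient of F x is the jump of the function at x. *)
Lemma step_integral_eq0 w : step_integral (fun=> 0) w -> w = 0.
Proof.
move=> [s [s1 [bad s2] ->]].
pose ends := [seq q.1.1 | q <- s] ++ [seq q.1.2 | q <- s].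
have e1 : {subset [seq q.1.1 | q <- s] <= ends} by move=> x; rewrite mem_cat => ->.
have e2 : {subset [seq q.1.2 | q <- s] <= ends}.
  by move=> x; rewrite mem_cat => ->; rewrite orbT.
have jump x : \sum_(q <- s | q.1.2 == x) q.2 = \sum_(q <- s | q.1.1 == x) q.2.
  (* [y] and [z] are so close to [x] that no other end point separates them from it. The values of
     the zero function at [y] and [z] then differ by the intervals ending at [x] minus those
     starting there. *)
  have [y yx hy] := left_gap (ends ++ bad) x.
  have [z xz hz] := right_gap (ends ++ bad) x.
  have := s2 y; have := s2 z.
  case: (boolP (y \in bad)) => [yb|_ /[swap] /(_ isT)].
    by have := hy y; rewrite mem_cat yb orbT lexx yx => /(_ isT).
  case: (boolP (z \in bad)) => [zb|_ + /(_ isT)].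
    by have := hz z; rewrite mem_cat zb orbT lexx xz => /(_ isT).
  move=> ez ey; apply/eqP; rewrite -subr_eq0; apply/eqP.
  have e : \sum_(q <- s) q.2 *+ (q.1.1 < y < q.1.2)%R -
           \sum_(q <- s) q.2 *+ (q.1.1 < z < q.1.2)%R = 0.
    by rewrite -ez -ey subrr.
  rewrite -[RHS]e [in LHS]big_mkcond [X in _ - X = _]big_mkcond /=.
  rewrite -!sumrB !big_seq; apply: eq_bigr => q qs.
  have q1 : q.1.1 \in ends ++ bad.
    by rewrite mem_cat e1 //; apply: (map_f (fun q => q.1.1)).
  have q2 : q.1.2 \in ends ++ bad.
    by rewrite mem_cat e2 //; apply: (map_f (fun q => q.1.2)).
  have := s1 q qs; have := hy _ q1; have := hy _ q2; have := hz _ q1; have := hz _ q2.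
  set u := q.1.1; set v := q.1.2.
  have -> : (if v == x then q.2 else 0) = q.2 *+ (v == x)%R by case: eqP.
  have -> : (if u == x then q.2 else 0) = q.2 *+ (u == x)%R by case: eqP.
  rewrite !negb_and -!ltNge -!leNgt => hzv hzu hyv hyu uv.
  clear e ez ey s1 s2.
  have -> : (u < y < v) = (u < x <= v).
    apply/idP/idP => /andP[h1 h2]; apply/andP; split.
    - by lra.
    - by case/orP: hyv => // ?; lra.
    - by case/orP: hyu => // ?; lra.
    - by lra.
  have -> : (u < z < v) = (u <= x < v).
    apply/idP/idP => /andP[h1 h2]; apply/andP; split.
    - by case/orP: hzu => // ?; lra.
    - by lra.
    - by lra.
    - by case/orP: hzv => // ?; lra.
  by case: (ltgtP u x) (ltgtP v x) => ux [] vx //=; rewrite ?subrr ?sub0r ?subr0 //; exfalso; lra.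
have coll (e : R * R * V -> R) : {subset map e s <= ends} ->
    \sum_(q <- s) B (F (e q)) q.2 =
    \sum_(x <- undup ends) B (F x) (\sum_(q <- s | e q == x) q.2).
  move=> es; under [RHS]eq_bigr do rewrite (biadd_sumr BB) big_mkcond.
  rewrite exchange_big !big_seq; apply: eq_bigr => q qs /=.
  rewrite (bigD1_seq (e q)) ?undup_uniq //= ?eqxx; last first.
    by rewrite mem_undup es // map_f.
  by rewrite big1 ?addr0 // => x; rewrite eq_sym => /negPf->.
under eq_bigr do rewrite (biaddBl BB).
rewrite sumrB (coll (fun q => q.1.2)) // (coll (fun q => q.1.1)) //.
by rewrite -sumrB big1 // => x _; rewrite jump subrr.
Qed.

Lemma step_integral_uniq h h' w w' : almost_all (fun x => h x = h' x) ->
  step_integral h w -> step_integral h' w' -> w = w'.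
Proof.
move=> hh hw hw'; apply/eqP; rewrite -subr_eq0; apply/eqP/step_integral_eq0.
apply: step_integral_ext (step_integralB hw hw').
by apply: almost_allS hh => x ->; rewrite subrr.
Qed.

End StepIntegral.

(** * Sets that are intervals up to finitely many points *)

Section IntervalLength.
Variable R : realFieldType.
Implicit Types (S : pred R) (a b d u v : R).

(** The position [u] is hidden, because integration against the identity only sees lengths. The
    empty set has length 0. *)
Definition interval_length S d : Prop :=
  exists u, 0 <= d /\ almost_all (fun x => S x = (u < x < u + d)).

Definition is_interval S : Prop := exists d, interval_length S d.

Lemma interval_length_ends u v S : u <= v ->
  almost_all (fun x => S x = (u < x < v)) -> interval_length S (v - u).
Proof.
move=> uv h; exists u; rewrite subr_ge0 uv; split=> //.
by rewrite addrC subrK.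
Qed.

Lemma interval_length_shift S d a :
  interval_length S d -> interval_length (fun x => S (x + a)) d.
Proof.
move=> [u [d0 h]]; exists (u - a); split=> //.
apply: almost_allS (almost_all_shift a h) => x ->.
by rewrite ltrBlDr -addrA [- a + d]addrC addrA ltrBrDr.
Qed.

Lemma step_integral_length (V W : zmodType) (B : R -> V -> W) S d c :
  interval_length S d -> step_integral B id (fun x => c *+ S x) (B d c).
Proof.
move=> [u [d0 h]].
have -> : d = id (u + d) - id u by rewrite /= addrAC subrr add0r.
apply: step_integral_ext (step_integral_interval B id c _); last by rewrite lerDl.
by apply: almost_allS h => x ->.
Qed.

Lemma is_interval_ext S S' :
  almost_all (fun x => S x = S' x) -> is_interval S -> is_interval S'.
Proof.
move=> SS' [d [u [d0 h]]]; exists d, u; split=> //.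
by apply: almost_allS2 SS' h => x -> ->.
Qed.

Lemma is_interval_itv u v : is_interval (fun x => u < x < v).
Proof.
have [uv|vu] := leP u v.
  by exists (v - u); apply: interval_length_ends => //; apply: almost_allW.
exists 0, u; split=> //; apply: almost_allW => x; rewrite addr0.
by apply/idP/idP => /andP[? ?]; exfalso; lra.
Qed.

Lemma is_interval_false : is_interval xpred0.
Proof.
apply: is_interval_ext (is_interval_itv 0 0); apply: almost_allW => x.
by apply/negP => /andP[? ?]; lra.
Qed.

Lemma is_interval_and S S' :
  is_interval S -> is_interval S' -> is_interval (fun x => S x && S' x).
Proof.
move=> [d [u [d0 h]]] [d' [u' [d0' h']]].
apply: is_interval_ext (is_interval_itv (Num.max u u') (Num.min (u + d) (u' + d'))).
apply: almost_allS2 h h' => x -> ->.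
by rewrite gt_max lt_min andbACA.
Qed.

Lemma is_interval_andb S (b : bool) :
  is_interval S -> is_interval (fun x => S x && b).
Proof.
case: b => hS; last first.
  by apply: is_interval_ext is_interval_false; apply: almost_allW => x; rewrite andbF.
by apply: is_interval_ext hS; apply: almost_allW => x; rewrite andbT.
Qed.

Lemma is_interval_and_lt S a b :
  is_interval S -> is_interval (fun x => S x && (a * x + b < 0)).
Proof.
move=> hS; have [a0|a0|a0] := ltgtP a 0.
- case: (hS) => d [u [d0 h]].
  (* A half line has no finite length, so it is first cut off at an end of [S]. *)
  have := is_interval_and hS (is_interval_itv (- b / a) (Num.max (u + d) (- b / a))).
  apply: is_interval_ext; apply: almost_allS h => x ->; apply/idP/idP.
    move=> /andP[-> /andP[+ _]] /=; rewrite ltr_ndivrMr //; lra.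
  move=> /andP[/andP[-> h2] h3] /=; rewrite h2 lt_max h2 /= ltr_ndivrMr //.
  by rewrite andbT; lra.
- case: (hS) => d [u [d0 h]].
  have := is_interval_and hS (is_interval_itv (Num.min u (- b / a)) (- b / a)).
  apply: is_interval_ext; apply: almost_allS h => x ->; apply/idP/idP.
    move=> /andP[-> /andP[_]] /=; rewrite ltr_pdivlMr //; lra.
  move=> /andP[/andP[h1 ->] h3] /=; rewrite h1 gt_min h1 /= ltr_pdivlMr //; lra.
- apply: is_interval_ext (is_interval_andb (b < 0) hS).
  by apply: almost_allW => x; rewrite a0 mul0r add0r.
Qed.

Lemma is_interval_and_eq S a b :
  is_interval S -> is_interval (fun x => S x && (a * x + b == 0)).
Proof.
move=> hS; have [->|a0] := eqVneq a 0.
  apply: is_interval_ext (is_interval_andb (b == 0) hS).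
  by apply: almost_allW => x; rewrite mul0r add0r.
apply: is_interval_ext is_interval_false.
apply: almost_allS (almost_all_neq (- b / a)) => x xab.
apply/esym/negbTE; rewrite negb_and; apply/orP; right.
apply: contra xab => /eqP xab; apply/eqP; apply: (mulfI a0).
by rewrite [RHS]mulrC divfK //; lra.
Qed.

Lemma is_interval_and_le S a b :
  is_interval S -> is_interval (fun x => S x && (a * x + b <= 0)).
Proof.
move=> hS; have [->|a0] := eqVneq a 0.
  apply: is_interval_ext (is_interval_andb (b <= 0) hS).
  by apply: almost_allW => x; rewrite mul0r add0r.
apply: is_interval_ext (is_interval_and_lt a b hS).
apply: almost_allS (almost_all_neq (- b / a)) => x xab.
congr (_ && _); rewrite lt_neqAle; case: eqP => // xab0.
by case/eqP: xab; apply: (mulfI a0); rewrite [RHS]mulrC divfK //; lra.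
Qed.

End IntervalLength.

Lemma sum_indicator1 (R : realFieldType) (I : finType) (P : pred I) :
  \sum_(i : I) (P i)%:R = 1 :> R -> exists2 i, P i & forall j, P j -> j = i.
Proof.
have -> : \sum_i (P i)%:R = #|[set i | P i]|%:R :> R.
  by rewrite -sum1dep_card natr_sum [RHS]big_mkcond; apply: eq_bigr => i; case: (P i).
move=> /eqP; rewrite pnatr_eq1.
move=> /cards1P[i Pi]; exists i => [|j].
  by have := set11 i; rewrite -Pi inE.
by move=> Pj; apply/set1P; rewrite -Pi inE.
Qed.

(** * Intervals tiled by finitely many intervals *)

Section TiledInterval.
Variables (R : realFieldType) (I : finType) (N : pred I) (p q : I -> R).
Variables bot top : R.
Hypothesis bt : bot < top.
Hypothesis pq : forall a, N a -> p a <= q a.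
Hypothesis tile : almost_all (fun y => bot < y < top ->
  \sum_(a | N a) (p a < y < q a)%R%:R = 1 :> R).

Let clip y := Num.max bot (Num.min top y).

(** Both sides integrate the indicator of the interval against [F]. As [F] is arbitrary it may
    itself be an indicator, which is how the tiles at the two ends are counted below. *)
Lemma tiled_interval_sum (F : R -> R) :
  \sum_(a | N a) (F (clip (q a)) - F (clip (p a))) = F top - F bot.
Proof.
have mulB : biadditive (fun x y : R => x * y).
  by split=> v x y; rewrite ?mulrDl ?mulrDr.
have -> : F top - F bot = (F top - F bot) * 1 by rewrite mulr1.
under eq_bigr do rewrite -[_ - _]mulr1.
have clipE a y : N a -> bot < y < top ->
    (clip (p a) < y < clip (q a)) = (p a < y < q a).
  move=> Na /andP[y1 y2]; rewrite /clip gt_max y1 /= gt_min lt_max lt_min.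
  by rewrite (lt_gtF y1) (lt_gtF y2) y2.
have clip_le a : N a -> clip (p a) <= clip (q a).
  move=> /pq paq; rewrite /clip ge_max le_max lexx /= le_max.
  by rewrite le_min !ge_min lexx /= paq !orbT.
have sum_int : step_integral (fun x y : R => x * y) F
    (fun x => \sum_(a | N a) 1 *+ (clip (p a) < x < clip (q a))%R)
    (\sum_(a | N a) (F (clip (q a)) - F (clip (p a))) * 1).
  apply: step_integral_sum => a _ Na.
  by apply: (step_integral_interval (fun x y : R => x * y)); apply: clip_le.
apply: (step_integral_uniq mulB _ sum_int (step_integral_interval _ F 1 (ltW bt))).
apply: almost_allS tile => y hy /=.
case: (boolP (bot < y < top)) => hbt.
  by rewrite -[RHS](hy hbt); apply: eq_bigr => a Na; rewrite (clipE _ _ Na hbt).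
rewrite big1 // => a Na; case: andP => // -[h1 h2]; case/negP: hbt.
apply/andP; split.
  by apply: le_lt_trans h1; rewrite /clip le_max lexx.
by apply: lt_le_trans h2 _; rewrite /clip ge_max ge_min lexx (ltW bt).
Qed.

Lemma clip_ge_top y : (top <= clip y) = (top <= y).
Proof. by rewrite /clip le_max le_min lexx /= leNgt bt. Qed.

Lemma clip_le_bot y : (clip y <= bot) = (y <= bot).
Proof. by rewrite /clip ge_max lexx /= ge_min leNgt bt. Qed.

Lemma clip_in y : (bot < clip y < top) = (bot < y < top).
Proof. by rewrite ltNge clip_le_bot [_ < top]ltNge clip_ge_top -!ltNge. Qed.

Lemma clip_id y : bot < y < top -> clip y = y.
Proof. by move=> /andP[h1 h2]; rewrite /clip min_r ?max_r ?ltW. Qed.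

(** With [F] the indicator of the reals that are at least [top], only a tile that reaches or crosses
    [top] from below has a nonzero increment. *)
Lemma tiled_interval_top : \sum_(a | N a) (p a < top <= q a)%R%:R = 1 :> R.
Proof.
have := tiled_interval_sum (fun y => (top <= y)%R%:R).
rewrite lexx leNgt bt /= subr0 => e; rewrite -[RHS]e; apply: eq_bigr => a /pq paq.
rewrite !clip_ge_top ltNge; case: (leP top (p a)) => h1 /=.
  by rewrite (le_trans h1 paq) subrr.
by rewrite subr0.
Qed.

Lemma tiled_interval_bot : \sum_(a | N a) (p a <= bot < q a)%R%:R = 1 :> R.
Proof.
have := tiled_interval_sum (fun y => - (y <= bot)%R%:R).
rewrite lexx leNgt bt /= opprK oppr0 add0r => e; rewrite -[RHS]e; apply: eq_bigr => a /pq paq.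
rewrite !clip_le_bot [_ < q a]ltNge opprK; case: (leP (q a) bot) => h1 /=.
  by rewrite (le_trans paq h1) addNr.
by rewrite oppr0 add0r andbT.
Qed.

(** With [F] the identity inside the interval and zero elsewhere, the total increment is zero. Read
    in a column of squares: the lower ends of the last and of the first tile differ by the lengths
    of all tiles that end in between. *)
Lemma tiled_interval_jumps :
  \sum_(a | N a) p a *+ (p a < top <= q a)%R -
  \sum_(a | N a) p a *+ (p a <= bot < q a)%R =
  \sum_(a | N a) (q a - p a) *+ (bot < q a < top)%R.
Proof.
have := tiled_interval_sum (fun y => y *+ (bot < y < top)%R).
rewrite !ltxx andbF subr0 => /eqP; rewrite sumrB subr_eq0 => /eqP e.
apply/eqP; rewrite -sumrB -subr_eq0 -sumrB.
rewrite -[X in _ == X](subrr (\sum_(a | N a) clip (q a) *+ (bot < clip (q a) < top)%R)).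
rewrite {1}e -sumrB; apply/eqP/eq_bigr => a /pq paq.
have cE y : clip y *+ (bot < clip y < top)%R = y *+ (bot < y < top)%R.
  by rewrite clip_in; case: (boolP (bot < y < top)) => // /clip_id ->.
rewrite !cE; move: paq.
case: (leP top (q a)) => h1; case: (leP top (p a)) => h2;
case: (leP (p a) bot) => h3; case: (leP (q a) bot) => h4 /=;
  rewrite ?mulr0n ?mulr1n ?andbF => paq; have := bt; lra.
Qed.

End TiledInterval.

(** * Triangles and vertical lines *)

Lemma ordS3_0 : ordS (0 : 'I_3) = 1. Proof. exact: val_inj. Qed.
Lemma ordS3_1 : ordS (1 : 'I_3) = 2. Proof. exact: val_inj. Qed.
Lemma ordS3_2 : ordS (2 : 'I_3) = 0. Proof. exact: val_inj. Qed.
Definition ordS3E := (ordS3_0, ordS3_1, ordS3_2).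

Lemma ord3_ind (Q : 'I_3 -> Prop) : Q 0 -> Q 1 -> Q 2 -> forall j, Q j.
Proof.
move=> q0 q1 q2 [[|[|[|//]]] lt3].
- by have -> : Ordinal lt3 = 0 by exact: val_inj.
- by have -> : Ordinal lt3 = 1 by exact: val_inj.
- by have -> : Ordinal lt3 = 2 by exact: val_inj.
Qed.

Lemma ordS3K (j : 'I_3) : ordS (ordS (ordS j)) = j.
Proof. by elim/ord3_ind: j; rewrite !ordS3E. Qed.

Lemma ord3_rot (j k : 'I_3) : [\/ k = j, k = ordS j | k = ordS (ordS j)].
Proof.
by elim/ord3_ind: j; elim/ord3_ind: k; rewrite !ordS3E;
  first [exact: Or31 | exact: Or32 | exact: Or33].
Qed.

Lemma ordS3_neq (j : 'I_3) : (j == ordS j = false) * (ordS j == j = false)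
  * (j == ordS (ordS j) = false) * (ordS (ordS j) == j = false)
  * (ordS j == ordS (ordS j) = false) * (ordS (ordS j) == ordS j = false).
Proof. by elim/ord3_ind: j; rewrite !ordS3E. Qed.

Section Triangle.
Variable R : realType.
Implicit Types (P : 'I_3 -> R * R) (p : R * R) (j : 'I_3).

(* Twice the area of the triangle spanned by the edge j and the point p. *)
Definition edge_fun P j p : R := cross (P (ordS j) - P j) (p - P j).

Definition ccw P : Prop := 0 < cross (P 1 - P 0) (P 2 - P 1).

Definition inside P p : bool := [forall j, 0 < edge_fun P j p].

Lemma insideP P p : reflect (forall j, 0 < edge_fun P j p) (inside P p).
Proof. exact: forallP. Qed.

Lemma edge_fun_sum P j p :
  edge_fun P j p + edge_fun P (ordS j) p + edge_fun P (ordS (ordS j)) p =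
  cross (P 1 - P 0) (P 2 - P 1).
Proof.
by elim/ord3_ind: j; rewrite /edge_fun /cross !ordS3E /=; ring.
Qed.

(** Up to the double area, the three values of [edge_fun] are the barycentric coordinates of [p],
    each attached to the vertex opposite to its edge. *)
Lemma edge_fun_barycentre1 P j p :
  edge_fun P (ordS j) p * (p.1 - (P j).1) +
  edge_fun P (ordS (ordS j)) p * (p.1 - (P (ordS j)).1) +
  edge_fun P j p * (p.1 - (P (ordS (ordS j))).1) = 0.
Proof. by rewrite /edge_fun /cross ordS3K /=; ring. Qed.

(* The edge j is above (resp. below) the triangle at the abscissa x. *)
Definition upper P j x := (P (ordS j)).1 < x < (P j).1.
Definition lower P j x := (P j).1 < x < (P (ordS j)).1.

Definition edge_height P j x : R :=
  (P j).2 + (x - (P j).1) * (((P (ordS j)).2 - (P j).2) / ((P (ordS j)).1 - (P j).1)).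

Lemma edge_funE P j p : (P (ordS j)).1 != (P j).1 ->
  edge_fun P j p =
  ((P (ordS j)).1 - (P j).1) * (p.2 - edge_height P j p.1).
Proof.
by rewrite -subr_eq0 => h; rewrite /edge_fun /edge_height /cross /=; field.
Qed.

(** In counterclockwise order an edge that runs to the left is above the triangle and one that runs
    to the right below. A line that separates the vertices leaves one of them alone and meets the
    two edges at this vertex; the inequality for the third edge follows from the barycentric
    relation. *)
Lemma column_cases P x : ccw P -> (forall j, x != (P j).1) ->
  (forall j, (upper P j x = false) * (lower P j x = false)) /\
    (forall y, inside P (x, y) = false) \/
  exists ju jl, [/\ edge_height P jl x < edge_height P ju x,
    forall y, inside P (x, y) = (edge_height P jl x < y < edge_height P ju x),
    forall j, upper P j x = (j == ju) & forall j, lower P j x = (j == jl)].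
Proof.
move=> D0 hx.
pose goal2 := exists ju jl, [/\ edge_height P jl x < edge_height P ju x,
    forall y, inside P (x, y) = (edge_height P jl x < y < edge_height P ju x),
    forall j, upper P j x = (j == ju) & forall j, lower P j x = (j == jl)].
(* The vertex [j] is alone on the right: the edge [j] leaves it along the upper side, and the edge
   before [j] arrives along the lower side. *)
have pattern_up j : x < (P j).1 -> (P (ordS j)).1 < x -> (P (ordS (ordS j))).1 < x ->
    goal2.
  move=> x0 x1 x2; exists j, (ordS (ordS j)).
  have n0 : (P (ordS j)).1 != (P j).1 by rewrite lt_eqF //; lra.
  have n2 : (P (ordS (ordS (ordS j)))).1 != (P (ordS (ordS j))).1.
    by rewrite ordS3K gt_eqF //; lra.
  have ef0 y := @edge_funE P j (x, y) n0.
  have ef2 y := @edge_funE P (ordS (ordS j)) (x, y) n2.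
  have bar y := edge_fun_barycentre1 P j (x, y).
  have sum y := edge_fun_sum P j (x, y).
  rewrite ordS3K /= in ef0 ef2 bar sum.
  have D := D0; rewrite /ccw in D.
  split.
  - have {}bar := bar (edge_height P j x); have {}sum := sum (edge_height P j x).
    have e0 := ef0 (edge_height P j x); rewrite subrr mulr0 in e0.
    have e2 := ef2 (edge_height P j x).
    rewrite e0 in bar sum; set l1 := edge_fun P (ordS j) _ in bar sum.
    set l2 := edge_fun P (ordS (ordS j)) _ in bar sum e2.
    have l2p : 0 < l2 by nra.
    rewrite -subr_gt0; move: l2p; rewrite e2 pmulr_rgt0 //; lra.
  - move=> y; have {}bar := bar y; have {}sum := sum y.
    have e0 := ef0 y; have e2 := ef2 y.
    apply/insideP/andP => [h|[h1 h2] k].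
      have := h j; have := h (ordS (ordS j)); rewrite e0 e2.
      rewrite pmulr_rgt0 ?subr_gt0; last by lra.
      by rewrite nmulr_rgt0 ?subr_lt0 //; lra.
    have l0 : 0 < edge_fun P j (x, y) by rewrite e0 nmulr_rgt0; lra.
    have l2 : 0 < edge_fun P (ordS (ordS j)) (x, y) by rewrite e2 pmulr_rgt0; lra.
    have l1 : 0 < edge_fun P (ordS j) (x, y).
      move: l0 l2 bar; set L0 := edge_fun _ _ _; set L2 := edge_fun _ _ _.
      set L1 := edge_fun _ _ _ => *; nra.
    by case: (ord3_rot j k) => ->.
  - move=> k; rewrite /upper; case: (ord3_rot j k) => ->;
      rewrite ?ordS3K ?eqxx ?ordS3_neq; apply/andP; lra.
  - move=> k; rewrite /lower; case: (ord3_rot j k) => ->;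
      rewrite ?ordS3K ?eqxx ?ordS3_neq; apply/andP; lra.
have pattern_down j : (P j).1 < x -> x < (P (ordS j)).1 -> x < (P (ordS (ordS j))).1 ->
    goal2.
  move=> x0 x1 x2; exists (ordS (ordS j)), j.
  have n0 : (P (ordS j)).1 != (P j).1 by rewrite gt_eqF //; lra.
  have n2 : (P (ordS (ordS (ordS j)))).1 != (P (ordS (ordS j))).1.
    by rewrite ordS3K lt_eqF //; lra.
  have ef0 y := @edge_funE P j (x, y) n0.
  have ef2 y := @edge_funE P (ordS (ordS j)) (x, y) n2.
  have bar y := edge_fun_barycentre1 P j (x, y).
  have sum y := edge_fun_sum P j (x, y).
  rewrite ordS3K /= in ef0 ef2 bar sum.
  have D := D0; rewrite /ccw in D.
  split.
  - have {}bar := bar (edge_height P j x); have {}sum := sum (edge_height P j x).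
    have e0 := ef0 (edge_height P j x); rewrite subrr mulr0 in e0.
    have e2 := ef2 (edge_height P j x).
    rewrite e0 in bar sum; set l1 := edge_fun P (ordS j) _ in bar sum.
    set l2 := edge_fun P (ordS (ordS j)) _ in bar sum e2.
    have l2p : 0 < l2 by nra.
    move: l2p; rewrite e2 nmulr_rgt0 ?subr_lt0 //; lra.
  - move=> y; have {}bar := bar y; have {}sum := sum y.
    have e0 := ef0 y; have e2 := ef2 y.
    apply/insideP/andP => [h|[h1 h2] k].
      have := h j; have := h (ordS (ordS j)); rewrite e0 e2.
      rewrite nmulr_rgt0 ?subr_lt0; last by lra.
      by move=> -> ; rewrite pmulr_rgt0 ?subr_gt0 //; lra.
    have l0 : 0 < edge_fun P j (x, y) by rewrite e0 pmulr_rgt0; lra.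
    have l2 : 0 < edge_fun P (ordS (ordS j)) (x, y) by rewrite e2 nmulr_rgt0; lra.
    have l1 : 0 < edge_fun P (ordS j) (x, y).
      move: l0 l2 bar; set L0 := edge_fun _ _ _; set L2 := edge_fun _ _ _.
      set L1 := edge_fun _ _ _ => *; nra.
    by case: (ord3_rot j k) => ->.
  - move=> k; rewrite /upper; case: (ord3_rot j k) => ->;
      rewrite ?ordS3K ?eqxx ?ordS3_neq; apply/andP; lra.
  - move=> k; rewrite /lower; case: (ord3_rot j k) => ->;
      rewrite ?ordS3K ?eqxx ?ordS3_neq; apply/andP; lra.
have d j : (x < (P j).1) || ((P j).1 < x).
  by have := hx j; rewrite neq_lt => /orP[->|->] //; rewrite orbT.
have same : (forall j, x < (P j).1) \/ (forall j, (P j).1 < x) ->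
    (forall j, (upper P j x = false) * (lower P j x = false)) /\
    (forall y, inside P (x, y) = false).
  move=> h; split=> [j|y].
    by rewrite /upper /lower; case: h => h;
      have := h j; have := h (ordS j); split; apply/negP => /andP[]; lra.
  apply/negP => /insideP hi; have := edge_fun_barycentre1 P 0 (x, y).
  move: (hi 0) (hi (ordS 0)) (hi (ordS (ordS 0))).
  set L0 := edge_fun _ _ _; set L1 := edge_fun _ _ _; set L2 := edge_fun _ _ _ => /=.
  by case: h => h; have := h 0; have := h (ordS 0); have := h (ordS (ordS 0)) => *; nra.
case/orP: (d 0) => h0; case/orP: (d 1) => h1; case/orP: (d 2) => h2.
- by left; apply: same; left; apply: ord3_ind.
- by right; apply: (pattern_down 2); rewrite ?ordS3E.
- by right; apply: (pattern_down 1); rewrite ?ordS3E.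
- by right; apply: (pattern_up 0); rewrite ?ordS3E.
- by right; apply: (pattern_down 0); rewrite ?ordS3E.
- by right; apply: (pattern_up 1); rewrite ?ordS3E.
- by right; apply: (pattern_up 2); rewrite ?ordS3E.
- by left; apply: same; right; apply: ord3_ind.
Qed.

End Triangle.

Lemma sum_indicator_unique (R : realFieldType) (I : finType) (N b : pred I) :
  (exists2 i, N i & b i) ->
  (forall i j, N i -> b i -> N j -> b j -> i = j) ->
  \sum_(i | N i) (b i)%:R = 1 :> R.
Proof.
move=> [i Ni bi] uniq; rewrite (bigD1 i) //= bi big1 ?addr0 // => j /andP[Nj ji].
by case: (boolP (b j)) => // bj; case/eqP: ji; apply: uniq.
Qed.

Lemma sum_indicator_pick (V : nmodType) (I : finType) (b : pred I) (f : I -> V) i :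
  b i -> (forall j, b j -> j = i) -> \sum_j f j *+ b j = f i.
Proof.
move=> bi uniq; rewrite (bigD1 i) //= bi big1 ?addr0 // => j ji.
by case: (boolP (b j)) => // /uniq e; rewrite e eqxx in ji.
Qed.

(** * The form of a surface tiled by squares *)

(* Triangles P i whose edges are glued in pairs by translations, cut into
   squares with horizontal and vertical sides: the piece a lies in the
   triangle ti a and in the square sq a, whose lower left corner is at c a in
   the chart of that triangle. *)
Section SquareTiling.
Variables (R : realType) (I K A : finType).
Variables (P : I -> 'I_3 -> R * R) (mate : {i : I & 'I_3} -> {i : I & 'I_3}).
Variables (ti : A -> I) (sq : A -> K) (c : A -> R * R) (l : K -> R).

Local Notation edge := {i : I & 'I_3}.
Implicit Types (a : A) (e : edge) (x y : R) (i : I) (k : K).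

Definition src e := P (tag e) (tagged e).
Definition tgt e := P (tag e) (ordS (tagged e)).
Definition trans e : R * R := tgt (mate e) - src e.
Definition len a := l (sq a).
Definition up e x := upper (P (tag e)) (tagged e) x.
Definition low e x := lower (P (tag e)) (tagged e) x.
Definition height e x := edge_height (P (tag e)) (tagged e) x.
Definition above a x := (c a).1 < x < (c a).1 + len a.

(** The interval is half open so that exactly one piece counts when two squares meet on the edge:
    from below, the one whose top is there; in [touch_low], the one whose bottom is there. *)
Definition touch_up a e x :=
  [&& ti a == tag e, up e x, above a x & (c a).2 < height e x <= (c a).2 + len a].
Definition touch_low a e x :=
  [&& ti a == tag e, low e x, above a x & (c a).2 <= height e x < (c a).2 + len a].
(** Unless [e] is horizontal this holds for at most one [x], so it really concerns tops that run
    along an edge. *)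
Definition top_on a e x := touch_up a e x && (height e x == (c a).2 + len a).
Definition top_inside a x :=
  above a x && inside (P (ti a)) (x, (c a).2 + len a).

Definition in_square a (p : R * R) :=
  ((c a).1 < p.1 < (c a).1 + len a) && ((c a).2 < p.2 < (c a).2 + len a).

Section Mate.
Hypothesis hmate : forall e, tgt (mate e) - src (mate e) = - (tgt e - src e).

Lemma mate_trans e :
  tgt (mate e) = src e + trans e /\ src (mate e) = tgt e + trans e.
Proof.
rewrite /trans addrC subrK; split=> //.
by rewrite -[LHS](subKr (tgt (mate e))) hmate opprK addrCA.
Qed.

Lemma low_mate e x : low (mate e) (x + (trans e).1) = up e x.
Proof.
have [h1 h2] := mate_trans e.
rewrite /low /up /upper /lower -[P _ (ordS _)]/(tgt _) -[P _ (tagged _)]/(src _) h1 h2.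
by rewrite -[P _ (ordS _)]/(tgt _) -[P _ (tagged _)]/(src _) /= !ltrD2r.
Qed.

Lemma up_neq e x : up e x -> (tgt e).1 != (src e).1.
Proof. by move=> /andP[h1 h2]; rewrite lt_eqF // (lt_trans h1 h2). Qed.

Lemma height_mate e x : up e x ->
  height (mate e) (x + (trans e).1) = height e x + (trans e).2.
Proof.
move=> /up_neq; rewrite -subr_eq0.
have [h1 h2] := mate_trans e.
rewrite /height /edge_height -[P _ (ordS _)]/(tgt _) -[P _ (tagged _)]/(src _) h1 h2.
rewrite -[P _ (ordS _)]/(tgt _) -[P _ (tagged _)]/(src _) /= => {h1 h2} h.
field; apply/andP; split; [move: h|move: h]; apply: contraNneq => ?; lra.
Qed.

End Mate.

(** All that the computation retains of the surface, in terms of plane charts. In [tiling_edge] an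
    upward passage through [e] either stays in the same square, whose corner moves with the change
    of charts, or leaves [a] through its top and enters [b] through its bottom. *)
Record square_tiling : Prop := SquareTiling {
  tiling_ccw : forall i, ccw (P i);
  tiling_mateK : involutive mate;
  tiling_mate : forall e, tgt (mate e) - src (mate e) = - (tgt e - src e);
  tiling_len : forall k, 0 < l k;
  tiling_cover : forall i p, inside (P i) p -> exists2 a, ti a = i &
    ((c a).1 <= p.1 <= (c a).1 + len a) && ((c a).2 <= p.2 <= (c a).2 + len a);
  tiling_disjoint : forall a b p, ti a = ti b -> inside (P (ti a)) p ->
    in_square a p -> in_square b p -> a = b;
  tiling_square : forall k p, (0 < p.1 < l k) && (0 < p.2 < l k) ->
    exists2 a, sq a = k & forall j, 0 <= edge_fun (P (ti a)) j (c a + p);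
  tiling_square_disjoint : forall a b p, sq a = sq b ->
    (0 < p.1 < len a) && (0 < p.2 < len a) ->
    inside (P (ti a)) (c a + p) -> inside (P (ti b)) (c b + p) -> a = b;
  tiling_edge : forall e a b x, touch_up a e x ->
    touch_low b (mate e) (x + (trans e).1) ->
    (c b).2 - (c a).2 =
      (trans e).2 + len a *+ (height e x == (c a).2 + len a)
}.

Hypothesis ST : square_tiling.

Let len_gt0 a : 0 < len a. Proof. exact: tiling_len. Qed.

Definition generic x : Prop := (forall i j, x != (P i j).1) /\
  (forall a, (x != (c a).1) && (x != (c a).1 + len a)).

Lemma almost_all_generic : almost_all generic.
Proof.
apply: almost_allI.
  by apply: almost_all_fin => i; apply: almost_all_fin => j; apply: almost_all_neq.
apply: almost_all_fin => a.
by apply: almost_allS2 (almost_all_neq (c a).1) (almost_all_neq ((c a).1 + len a)) => x -> ->.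
Qed.

Section Column.
Variables (i : I) (x : R).
Hypothesis gx : generic x.
Variables (ju jl : 'I_3).
Let bot := edge_height (P i) jl x.
Let top := edge_height (P i) ju x.
Hypothesis column : forall y, inside (P i) (x, y) = (bot < y < top).

Let N a := (ti a == i) && above a x.

Lemma column_tile : almost_all (fun y => bot < y < top ->
  \sum_(a | N a) ((c a).2 < y < (c a).2 + len a)%R%:R = 1 :> R).
Proof.
have : almost_all (fun y => forall a, y != (c a).2 /\ y != (c a).2 + len a).
  apply: almost_all_fin => a; apply: almost_allI; exact: almost_all_neq.
apply: almost_allS => y hy; rewrite -column => hin; apply: sum_indicator_unique.
  have [a tia /andP[/andP[h1 h2] /andP[h3 h4]]] := tiling_cover ST hin.
  have [n1 n2] := hy a; have /andP[n3 n4] := gx.2 a.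
  by exists a; rewrite /N /above ?tia ?eqxx /= !lt_neqAle ?h1 ?h2 ?h3 ?h4 ?n2 ?n4 eq_sym
     ?[_ == y]eq_sym ?n1 ?n3.
move=> a b /andP[/eqP tia ha1] ha2 /andP[/eqP tib hb1] hb2.
by apply: (tiling_disjoint ST (p := (x, y))); rewrite ?tia ?tib //; apply/andP.
Qed.

End Column.

Lemma sum_upper (V : nmodType) i x ju (f : edge -> V) :
  (forall j, upper (P i) j x = (j == ju)) ->
  (forall e, ~~ up e x -> f e = 0) ->
  \sum_(e | tag e == i) f e = f (existT _ i ju).
Proof.
move=> hu f0; rewrite (bigD1 (existT (fun=> 'I_3) i ju)) //= big1 ?addr0 //.
move=> [i' j] /= /andP[/eqP -> ne]; apply: f0; rewrite /up hu /=.
by apply: contra ne => /eqP->.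
Qed.

Lemma sum_lower (V : nmodType) i x jl (f : edge -> V) :
  (forall j, lower (P i) j x = (j == jl)) ->
  (forall e, ~~ low e x -> f e = 0) ->
  \sum_(e | tag e == i) f e = f (existT _ i jl).
Proof.
move=> hu f0; rewrite (bigD1 (existT (fun=> 'I_3) i jl)) //= big1 ?addr0 //.
move=> [i' j] /= /andP[/eqP -> ne]; apply: f0; rewrite /low hu /=.
by apply: contra ne => /eqP->.
Qed.

Lemma touch_up_sum e x : generic x -> up e x ->
  \sum_a (touch_up a e x)%:R = 1 :> R.
Proof.
move=> gx ux; have [[h _]|[ju [jl [bt hin hu hl]]]] :=
    column_cases (tiling_ccw ST (tag e)) (gx.1 (tag e)).
  by rewrite /up h in ux.
have uxE := ux; rewrite /up hu in uxE.
have pq a : (ti a == tag e) && above a x -> (c a).2 <= (c a).2 + len a.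
  by rewrite lerDl ltW.
rewrite -[RHS](tiled_interval_top bt pq (column_tile gx hin)).
rewrite [RHS]big_mkcond; apply: eq_bigr => a _.
rewrite /touch_up ux /height (eqP uxE) /=.
by case: (ti a == tag e) => //=; case: (above a x).
Qed.

Lemma touch_low_sum e x : generic x -> low e x ->
  \sum_a (touch_low a e x)%:R = 1 :> R.
Proof.
move=> gx lx; have [[h _]|[ju [jl [bt hin hu hl]]]] :=
    column_cases (tiling_ccw ST (tag e)) (gx.1 (tag e)).
  by rewrite /low h in lx.
have lxE := lx; rewrite /low hl in lxE.
have pq a : (ti a == tag e) && above a x -> (c a).2 <= (c a).2 + len a.
  by rewrite lerDl ltW.
rewrite -[RHS](tiled_interval_bot bt pq (column_tile gx hin)).
rewrite [RHS]big_mkcond; apply: eq_bigr => a _.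
rewrite /touch_low lx /height (eqP lxE) /=.
by case: (ti a == tag e) => //=; case: (above a x).
Qed.

(** This is [tiled_interval_jumps] for the vertical extents of the squares in the column over
    [x]. *)
Lemma triangle_jumps i x : generic x ->
  \sum_(e | tag e == i) \sum_a (c a).2 *+ touch_up a e x -
  \sum_(e | tag e == i) \sum_a (c a).2 *+ touch_low a e x =
  \sum_(a | ti a == i) len a *+ top_inside a x.
Proof.
move=> gx; have [[h hin]|[ju [jl [bt hin hu hl]]]] :=
    column_cases (tiling_ccw ST i) (gx.1 i).
  rewrite !big1 ?subrr // => [a|[i' j]|[i' j]] /= /eqP.
  - by move=> tia; rewrite /top_inside tia hin andbF.
  - by move=> ->; rewrite big1 // => a _; rewrite /touch_low /low /= h andbF.
  - by move=> ->; rewrite big1 // => a _; rewrite /touch_up /up /= h andbF.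
rewrite (sum_upper hu) => [|e /negbTE ux]; last first.
  by rewrite big1 // => a _; rewrite /touch_up ux andbF.
rewrite (sum_lower hl) => [|e /negbTE ux]; last first.
  by rewrite big1 // => a _; rewrite /touch_low ux andbF.
have pq a : (ti a == i) && above a x -> (c a).2 <= (c a).2 + len a.
  by rewrite lerDl ltW.
have := tiled_interval_jumps bt pq (column_tile gx hin).
have E f (b : A -> bool) : \sum_a f a *+ [&& ti a == i, true, above a x & b a] =
    \sum_(a | (ti a == i) && above a x) f a *+ b a :> R.
  by rewrite [RHS]big_mkcond; apply: eq_bigr => a _; case: (ti a == i) => //=; case: (above a x).
move=> e; apply: etrans (etrans _ e) _.
  congr (_ - _); rewrite -E; apply: eq_bigr => a _; congr (_ *+ nat_of_bool _).
    by rewrite /touch_up /up /= hu eqxx.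
  by rewrite /touch_low /low /= hl eqxx.
rewrite [RHS]big_mkcond [LHS]big_mkcond; apply: eq_bigr => a _.
rewrite /top_inside; case: eqP => //= ->; rewrite hin.
by case: (above a x) => //=; rewrite addrC addKr.
Qed.

(** At a generic abscissa each of the sums has at most one nonzero term, and the claim is
    [tiling_edge]. The abscissa has to be generic in the charts on both sides of the edge. *)
Lemma edge_jumps e x : generic x -> generic (x + (trans e).1) ->
  \sum_a (c a).2 *+ touch_low a (mate e) (x + (trans e).1) -
  \sum_a (c a).2 *+ touch_up a e x - \sum_a len a *+ top_on a e x =
  (trans e).2 *+ up e x.
Proof.
move=> gx gx'; case: (boolP (up e x)) => ux; last first.
  rewrite !big1 ?subrr // => a _.
  - by rewrite /top_on /touch_up (negbTE ux) !andbF.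
  - by rewrite /touch_up (negbTE ux) !andbF.
  - by rewrite /touch_low (low_mate (tiling_mate ST)) (negbTE ux) !andbF.
have [a ha ua] := sum_indicator1 (touch_up_sum gx ux).
have lx : low (mate e) (x + (trans e).1) by rewrite (low_mate (tiling_mate ST)).
have [b hb ub] := sum_indicator1 (touch_low_sum gx' lx).
rewrite (sum_indicator_pick (b := fun a => touch_up a e x) _ ha ua).
rewrite (sum_indicator_pick
  (b := fun b => touch_low b (mate e) (x + (trans e).1)) _ hb ub).
have -> : \sum_a' len a' *+ top_on a' e x = len a *+ top_on a e x.
  rewrite (bigD1 a) //= big1 ?addr0 // => a' na; rewrite /top_on.
  by case: (boolP (touch_up a' e x)) => // /ua e'; rewrite e' eqxx in na.
by rewrite (tiling_edge ST ha hb) /top_on ha addrK.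
Qed.

Lemma is_interval_affine_lt (S S' : pred R) u v : is_interval S ->
  (forall x, S' x = S x && (u * x + v < 0)) -> is_interval S'.
Proof.
move=> hS h; apply: is_interval_ext (is_interval_and_lt u v hS).
by apply: almost_allW => x; rewrite h.
Qed.

Lemma is_interval_affine_le (S S' : pred R) u v : is_interval S ->
  (forall x, S' x = S x && (u * x + v <= 0)) -> is_interval S'.
Proof.
move=> hS h; apply: is_interval_ext (is_interval_and_le u v hS).
by apply: almost_allW => x; rewrite h.
Qed.

Lemma height_affine e : exists u v, forall x, height e x = u * x + v.
Proof.
set s := ((tgt e).2 - (src e).2) / ((tgt e).1 - (src e).1).
exists s, ((src e).2 - (src e).1 * s) => x.
rewrite /height /edge_height -[P _ (ordS _)]/(tgt _) -[P _ (tagged _)]/(src _).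
by rewrite -/s; ring.
Qed.

Lemma is_interval_touch_up a e : is_interval (touch_up a e).
Proof.
have [u [v h]] := height_affine e.
pose S x := [&& ti a == tag e, up e x & above a x].
have iS : is_interval S.
  apply: is_interval_ext (is_interval_andb (ti a == tag e)
    (is_interval_and (is_interval_itv _ _) (is_interval_itv _ _))).
  by apply: almost_allW => x; rewrite andbC.
pose S' x := S x && ((c a).2 < height e x).
have iS' : is_interval S'.
  apply: (is_interval_affine_lt (u := - u) (v := (c a).2 - v) iS) => x.
  by rewrite /S' h; congr (_ && _); apply/idP/idP => ?; lra.
apply: (is_interval_affine_le (u := u) (v := v - ((c a).2 + len a)) iS') => x.
rewrite /touch_up /S' /S -!andbA h; do 4!congr (_ && _).
by apply/idP/idP => ?; lra.
Qed.

Lemma is_interval_touch_low a e : is_interval (touch_low a e).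
Proof.
have [u [v h]] := height_affine e.
pose S x := [&& ti a == tag e, low e x & above a x].
have iS : is_interval S.
  apply: is_interval_ext (is_interval_andb (ti a == tag e)
    (is_interval_and (is_interval_itv _ _) (is_interval_itv _ _))).
  by apply: almost_allW => x; rewrite andbC.
pose S' x := S x && ((c a).2 <= height e x).
have iS' : is_interval S'.
  apply: (is_interval_affine_le (u := - u) (v := (c a).2 - v) iS) => x.
  by rewrite /S' h; congr (_ && _); apply/idP/idP => ?; lra.
apply: (is_interval_affine_lt (u := u) (v := v - ((c a).2 + len a)) iS') => x.
rewrite /touch_low /S' /S -!andbA h; do 4!congr (_ && _).
by apply/idP/idP => ?; lra.
Qed.

Lemma is_interval_top_on a e : is_interval (top_on a e).
Proof.
have [u [v h]] := height_affine e.
have := is_interval_and_eq u (v - ((c a).2 + len a)) (is_interval_touch_up a e).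
apply: is_interval_ext; apply: almost_allW => x.
by rewrite /top_on h addrA subr_eq0.
Qed.

Lemma is_interval_top_inside a : is_interval (top_inside a).
Proof.
pose y := (c a).2 + len a.
pose H j x := 0 < edge_fun (P (ti a)) j (x, y).
have step (S : pred R) j : is_interval S -> is_interval (fun x => S x && H j x).
  move=> iS; pose p := P (ti a) j; pose q := P (ti a) (ordS j).
  apply: (is_interval_affine_lt (u := q.2 - p.2)
    (v := - ((q.1 - p.1) * (y - p.2)) - (q.2 - p.2) * p.1) iS) => x.
  rewrite /H /edge_fun /cross -/p -/q /=.
  by congr (_ && _); apply/idP/idP => ?; lra.
have := step _ 2 (step _ 1 (step _ 0 (is_interval_itv (c a).1 ((c a).1 + len a)))).
apply: is_interval_ext; apply: almost_allW => x.
rewrite /top_inside /above -andbA -andbA; congr (_ && _); apply/idP/insideP.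
  by move=> /and3P[h0 h1 h2]; apply: ord3_ind.
by move=> h; rewrite /H !h.
Qed.

Lemma edge_fun_neq0 i j x y : generic x -> y != edge_height (P i) j x ->
  edge_fun (P i) j (x, y) != 0.
Proof.
move=> gx yh; have [dx|dx] := eqVneq (P i (ordS j)).1 (P i j).1; last first.
  by rewrite edge_funE // mulf_neq0 ?subr_eq0.
apply/eqP; rewrite /edge_fun /cross /= dx subrr mul0r sub0r => /eqP.
rewrite oppr_eq0 mulf_eq0 !subr_eq0 (negbTE (gx.1 i j)) orbF => /eqP dy.
have e : P i (ordS j) = P i j by rewrite [LHS]surjective_pairing dx dy -surjective_pairing.
have := tiling_ccw ST i; rewrite /ccw -(edge_fun_sum _ (ordS j) (P i j)).
suff -> : edge_fun (P i) (ordS j) (P i j) + edge_fun (P i) (ordS (ordS j)) (P i j) +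
  edge_fun (P i) (ordS (ordS (ordS j))) (P i j) = 0 by rewrite ltxx.
by rewrite /edge_fun /cross !ordS3K e /=; ring.
Qed.

Lemma inside_of_edge_fun i x y : generic x ->
  (forall j, y != edge_height (P i) j x) ->
  (forall j, 0 <= edge_fun (P i) j (x, y)) -> inside (P i) (x, y).
Proof.
move=> gx hy h; apply/insideP => j.
by rewrite lt_neqAle eq_sym edge_fun_neq0 // h.
Qed.

(** Coordinates are now those of the square. The section of a triangle that reaches the top side
    from below either continues beyond it, which gives [top_inside], or ends on it, which gives
    [top_on] for the upper edge. *)
Lemma column_in_square k a x : sq a = k -> 0 < x < l k -> generic (x + (c a).1) ->
  exists pq : R * R, [/\ pq.1 <= pq.2,
    forall y, inside (P (ti a)) (x + (c a).1, y + (c a).2) = (pq.1 < y < pq.2) &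
    (pq.1 < l k <= pq.2)%R%:R = (top_inside a (x + (c a).1))%:R +
      \sum_e (top_on a e (x + (c a).1))%:R :> R].
Proof.
move=> sqa xk gx.
have ab : above a (x + (c a).1) by rewrite /above /len sqa addrC ltrDl ltrD2l.
have lk : len a = l k by rewrite /len sqa.
have l0 : 0 < l k by rewrite -lk.
have [[h hin]|[ju [jl [bt hin hu hl]]]] :=
    column_cases (tiling_ccw ST (ti a)) (gx.1 (ti a)).
  (* The line misses the triangle: its section is encoded by an empty interval. *)
  exists (0, 0); split=> [//|y|]; first by rewrite hin; apply/esym/negP => /andP[]; lra.
  rewrite /top_inside ab hin add0r big1 => [|e _].
    by case: andP => // -[/=]; lra.
  by rewrite /top_on /touch_up /up; case: eqP => //= <-; rewrite h.
pose bot := edge_height (P (ti a)) jl (x + (c a).1).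
pose top := edge_height (P (ti a)) ju (x + (c a).1).
exists (bot - (c a).2, top - (c a).2); split=> [|y|] /=.
- by rewrite lerD2r ltW.
- by rewrite hin ltrBlDr ltrBrDr.
rewrite /top_inside ab hin lk /= -/bot -/top.
have -> : \sum_e (top_on a e (x + (c a).1))%:R = (top == (c a).2 + l k)%:R :> R.
  rewrite (bigID (fun e => tag e == ti a)) /= [X in _ + X]big1 ?addr0; last first.
    by move=> e ne; rewrite /top_on /touch_up eq_sym (negbTE ne).
  rewrite (sum_upper hu) => [|e /negbTE ux]; last first.
    by rewrite /top_on /touch_up ux andbF.
  rewrite /top_on /touch_up eqxx ab /up /= hu eqxx /= /height /= -/top lk.
  by case: eqP => [->|]; rewrite ?andbF // ltrDl l0 lexx.
have := bt; rewrite -/bot -/top; case: (ltgtP top ((c a).2 + l k)) => h1 h2 /=.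
- by rewrite andbF /= [_ <= top - _]leNgt (_ : top - _ < _) ?andbF ?addr0 //; lra.
- have -> : (l k <= top - (c a).2) by lra.
  by rewrite !andbT addr0 ltrBlDr addrC.
- have -> : (bot - (c a).2 < l k) by lra.
  have -> : (l k <= top - (c a).2) by lra.
  by rewrite andbF add0r.
Qed.

(** The roles are exchanged: a vertical segment of one square is tiled by its sections with the
    triangles, and by [tiled_interval_top] exactly one of them reaches the top. *)
Lemma square_column k : almost_all (fun x =>
  \sum_(a | sq a == k) ((top_inside a (x + (c a).1))%:R +
     \sum_e (top_on a e (x + (c a).1))%:R) = (0 < x < l k)%R%:R :> R).
Proof.
have : almost_all (fun x => forall a, generic (x + (c a).1)).
  by apply: almost_all_fin => a; apply: almost_all_shift almost_all_generic.
apply: almost_allS => x gx.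
have aboveE a : sq a = k -> above a (x + (c a).1) = (0 < x < l k).
  by move=> <-; rewrite /above /len addrC ltrDl ltrD2l.
case: (boolP (0 < x < l k)) => xk; last first.
  rewrite big1 // => a /eqP sqa; rewrite /top_inside aboveE // (negbTE xk) /=.
  rewrite add0r big1 // => e _.
  by rewrite /top_on /touch_up aboveE // (negbTE xk) !andbF.
have /choice[pq hpq] : forall a, exists pq : R * R, sq a == k -> [/\ pq.1 <= pq.2,
    forall y, inside (P (ti a)) (x + (c a).1, y + (c a).2) = (pq.1 < y < pq.2) &
    (pq.1 < l k <= pq.2)%R%:R = (top_inside a (x + (c a).1))%:R +
      \sum_e (top_on a e (x + (c a).1))%:R :> R].
  move=> a; case: (eqVneq (sq a) k) => [sqa|_]; last by exists (0, 0).
  by have [pq ?] := column_in_square sqa xk (gx a); exists pq.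
transitivity (\sum_(a | sq a == k) ((pq a).1 < l k <= (pq a).2)%R%:R : R).
  by apply: eq_bigr => a /hpq[_ _ ->].
apply: tiled_interval_top (tiling_len ST k) _ _; first by move=> a /hpq[].
have : almost_all (fun y => forall a j, y != edge_height (P (ti a)) j (x + (c a).1) - (c a).2).
  by apply: almost_all_fin => a; apply: almost_all_fin => j; apply: almost_all_neq.
apply: almost_allS => y hy yk; apply: sum_indicator_unique.
  have [|a sqa ha] := tiling_square ST (k := k) (p := (x, y)); first by rewrite xk.
  exists a; first by rewrite sqa.
  have [|_ <- _] := hpq a; first by rewrite sqa.
  apply: inside_of_edge_fun => // j; last first.
    by have := ha j; rewrite [c a]surjective_pairing addrC.
  by have := hy a j; rewrite -subr_eq0 opprB addrA subr_eq0.
move=> a b /[dup] /eqP sqa /hpq[_ ha _] pa /[dup] /eqP sqb /hpq[_ hb _] pb.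
have addE d : (x, y) + c d = (x + (c d).1, y + (c d).2) by case: (c d).
apply: (tiling_square_disjoint ST (p := (x, y))); rewrite ?sqa ?sqb //.
- by rewrite /len sqa xk.
- by rewrite addrC addE ha.
- by rewrite addrC addE hb.
Qed.

(** * Summation over triangles, edges and squares *)

Section Area.
Variables (W : comNzRingType) (B : R -> R -> W).
Hypothesis BB : biadditive B.

(** Positive for at most one of an edge and its mate, namely the one that runs to the left; vertical
    edges count for nothing. *)
Definition up_length e := Num.max 0 ((src e).1 - (tgt e).1).

Lemma interval_length_up e : interval_length (up e) (up_length e).
Proof.
rewrite /up_length; case: ltP => h.
  by apply: interval_length_ends; [lra|apply: almost_allW].
exists 0; split=> //; apply: almost_allW => x; rewrite addr0.
by apply/idP/idP => /andP[]; rewrite -?[P _ (ordS _)]/(tgt _) -?[P _ (tagged _)]/(src _) => *; lra.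
Qed.

Lemma up_lengthB e : up_length (mate e) - up_length e = (tgt e).1 - (src e).1.
Proof.
have [h1 h2] := mate_trans (tiling_mate ST) e; rewrite /up_length h1 h2 /=.
by case: ltP => h; case: ltP => h'; lra.
Qed.

(** The trapezoid formula for the double area, with [B] in place of the product. *)
Lemma triangle_form i :
  B ((P i 1).1 - (P i 0).1) ((P i 2).2 - (P i 1).2) -
  B ((P i 2).1 - (P i 1).1) ((P i 1).2 - (P i 0).2) =
  - \sum_(j < 3) B ((P i (ordS j)).1 - (P i j).1) ((P i j).2 + (P i (ordS j)).2).
Proof.
rewrite !big_ord_recl big_ord0.
have -> : ord0 = 0 :> 'I_3 by exact: val_inj.
have -> : lift 0 ord0 = 1 :> 'I_3 by exact: val_inj.
have -> : lift 0 (lift 0 ord0) = 2 :> 'I_3 by exact: val_inj.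
rewrite !ordS3E !(biaddBl BB) !(biaddBr BB) !(biaddDr BB); ring.
Qed.

(** An edge and its mate have opposite increments of the abscissa, and their sums of ordinates
    differ by twice the translation; this is the origin of the factor 2. *)
Lemma sum_triangle_forms :
  \sum_i (B ((P i 1).1 - (P i 0).1) ((P i 2).2 - (P i 1).2) -
          B ((P i 2).1 - (P i 1).1) ((P i 1).2 - (P i 0).2)) =
  - (\sum_e B (up_length e) (trans e).2) *+ 2.
Proof.
under eq_bigr do rewrite triangle_form.
rewrite mulNrn sumrN sig_big_dep /=; congr (- _).
transitivity (\sum_e (B (up_length (mate e)) ((src e).2 + (tgt e).2) -
                      B (up_length e) ((src e).2 + (tgt e).2))).
  by apply: eq_bigr => e _; rewrite -(biaddBl BB) up_lengthB.
rewrite sumrB (reindex_inj (inv_inj (tiling_mateK ST))) /= -sumrB -sumrMnl.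
apply: eq_bigr => e _; rewrite tiling_mateK // -(biaddBr BB) -(biaddMnr BB).
congr B; have [-> ->] := mate_trans (tiling_mate ST) e; rewrite /= mulr2n; ring.
Qed.

(** Three identities are integrated over the abscissa: [eT] in the triangles, [eE] at the edges and
    [eS] at the tops of the squares. After reindexing by [mate] the touching terms of [eE] become
    those of [eT], so that only the tops remain, with a minus sign. *)
Lemma sum_up_trans :
  \sum_e B (up_length e) (trans e).2 = - \sum_k B (l k) (l k).
Proof.
have /choice[dU hU] : forall ae : A * edge, exists d,
    interval_length (touch_up ae.1 ae.2) d.
  by move=> ae; apply: is_interval_touch_up.
have /choice[dL hL] : forall ae : A * edge, exists d,
    interval_length (touch_low ae.1 ae.2) d.
  by move=> ae; apply: is_interval_touch_low.
have /choice[dT hT] : forall ae : A * edge, exists d,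
    interval_length (top_on ae.1 ae.2) d.
  by move=> ae; apply: is_interval_top_on.
have /choice[dS hS] : forall a, exists d, interval_length (top_inside a) d.
  by move=> a; apply: is_interval_top_inside.
have eT : \sum_e \sum_a B (dU (a, e)) (c a).2 - \sum_e \sum_a B (dL (a, e)) (c a).2 =
    \sum_a B (dS a) (len a).
  rewrite (partition_big ti predT) //= (partition_big (fun e => tag e) predT) //=.
  rewrite [X in _ - X](partition_big (fun e => tag e) predT) //= -sumrB.
  apply: eq_bigr => i _.
  apply: (step_integral_uniq BB (F := id)
    (h := fun x => \sum_(e | tag e == i) \sum_a (c a).2 *+ touch_up a e x -
                   \sum_(e | tag e == i) \sum_a (c a).2 *+ touch_low a e x)
    (h' := fun x => \sum_(a | ti a == i) len a *+ top_inside a x)).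
  - by apply: almost_allS almost_all_generic => x; apply: triangle_jumps.
  - apply: step_integralB => //; apply: step_integral_sum => e _ _;
      apply: step_integral_sum => a _ _; apply: step_integral_length.
      exact: (hU (a, e)).
    exact: (hL (a, e)).
  - by apply: step_integral_sum => a _ _; apply: step_integral_length.
have eE e : B (up_length e) (trans e).2 = \sum_a B (dL (a, mate e)) (c a).2 -
    \sum_a B (dU (a, e)) (c a).2 - \sum_a B (dT (a, e)) (len a).
  apply/esym; apply: (step_integral_uniq BB (F := id)
    (h := fun x => \sum_a (c a).2 *+ touch_low a (mate e) (x + (trans e).1) -
      \sum_a (c a).2 *+ touch_up a e x - \sum_a len a *+ top_on a e x)
    (h' := fun x => (trans e).2 *+ up e x)).
  - apply: almost_allS2 almost_all_generic
      (almost_all_shift (trans e).1 almost_all_generic) => x.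
    exact: edge_jumps.
  - apply: step_integralB => //; [apply: step_integralB => //|];
      apply: step_integral_sum => a _ _; apply: step_integral_length.
    (* The change of chart shifts the abscissa but not the length, so the same [dL] serves in
       [eT]. *)
    + by apply: interval_length_shift; apply: (hL (a, mate e)).
    + exact: (hU (a, e)).
    + exact: (hT (a, e)).
  - by apply: step_integral_length; apply: interval_length_up.
have eS k : \sum_(a | sq a == k) (B (dS a) (len a) + \sum_e B (dT (a, e)) (len a)) =
    B (l k) (l k).
  transitivity (\sum_(a | sq a == k) (B (dS a) (l k) + \sum_e B (dT (a, e)) (l k))).
    by apply: eq_bigr => a /eqP sqa; rewrite /len sqa.
  apply: (step_integral_uniq BB (F := id)
    (h := fun x => \sum_(a | sq a == k) (l k *+ top_inside a (x + (c a).1) +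
       \sum_e l k *+ top_on a e (x + (c a).1)))
    (h' := fun x => l k *+ (0 < x < l k)%R)).
  - apply: almost_allS (square_column k) => x h.
    rewrite -mulr_natr -h mulr_sumr; apply: eq_bigr => a _.
    rewrite mulrDr mulr_natr mulr_sumr; congr (_ + _).
    by apply: eq_bigr => e _; rewrite mulr_natr.
  - apply: step_integral_sum => a _ _; apply: step_integralD.
      by apply: step_integral_length; apply: interval_length_shift.
    apply: step_integral_sum => e _ _; apply: step_integral_length.
    by apply: interval_length_shift; apply: (hT (a, e)).
  - apply: step_integral_length; rewrite -[X in interval_length _ X]subr0.
    by apply: interval_length_ends; [rewrite ltW ?tiling_len|apply: almost_allW].
under eq_bigr do rewrite eE.
have <- : \sum_a (B (dS a) (len a) + \sum_e B (dT (a, e)) (len a)) =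
    \sum_k B (l k) (l k).
  by rewrite (partition_big sq predT) //=; apply: eq_bigr => k _; rewrite -eS.
rewrite !sumrB big_split /= -eT [in X in _ = - (_ + X)]exchange_big /=.
rewrite [X in X - _ - _ = _](reindex_inj (inv_inj (tiling_mateK ST))) /=.
under [X in X - _ - _ = _]eq_bigr do rewrite (tiling_mateK ST).
by rewrite opprD opprB.
Qed.

Lemma square_tiling_form :
  \sum_i (B ((P i 1).1 - (P i 0).1) ((P i 2).2 - (P i 1).2) -
          B ((P i 2).1 - (P i 1).1) ((P i 1).2 - (P i 0).2)) =
  (\sum_k B (l k) (l k)) *+ 2.
Proof. by rewrite sum_triangle_forms sum_up_trans opprK. Qed.

End Area.

End SquareTiling.

(** * Local structure of the surface *)

Import numFieldNormedType.Exports.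
Local Open Scope classical_set_scope.
Local Open Scope ring_scope.

(** A supremum argument. Only implications in the direction of increasing parameter are required, so
    that a property and its negation can be propagated separately. *)
Lemma real_induction (R : realType) (P : R -> Prop) : P 0 ->
  (forall t, 0 <= t <= 1 -> exists2 e : R, 0 < e &
    forall s, 0 <= s <= 1 -> `|s - t| < e ->
      (s < t -> P s -> P t) /\ (t < s -> P t -> P s)) ->
  P 1.
Proof.
move=> P0 hP; pose E := [set t : R | 0 <= t <= 1 /\ P t].
have E0 : E 0 by split; rewrite ?lexx ?ler01.
have hE : has_sup E by split; [exists 0|exists 1 => t [/andP[]]].
have supE : 0 <= sup E <= 1.
  by rewrite ub_le_sup ?ge_sup //; [exists 0|move=> t [/andP[]]|case: hE].
have [e e0 he] := hP _ supE.
have Psup : P (sup E).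
  have [t [t01 Pt] te] := sup_adherent e0 hE.
  have ts : t <= sup E by apply: ub_le_sup => //; case: hE.
  have [<- //|tns] := eqVneq t (sup E).
  have [|h _] := he t t01; first by rewrite ltr_norml; apply/andP; split; lra.
  by apply: h Pt; rewrite lt_neqAle tns.
have [<- //|ne1] := eqVneq (sup E) 1.
have lt1 : sup E < 1 by case/andP: supE => _; rewrite le_eqVlt (negbTE ne1).
pose s := Num.min 1 (sup E + e / 2).
have s1 : sup E < s by rewrite /s lt_min lt1 ltrDl divr_gt0.
have s01 : 0 <= s <= 1 by rewrite (le_trans _ (ltW s1)) ?ge_min ?lexx //; case/andP: supE.
have [|_ h] := he s s01.
  have s2 : s <= sup E + e / 2 by rewrite /s ge_min lexx orbT.
  by rewrite gtr0_norm ?subr_gt0 //; lra.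
have : s <= sup E by apply: ub_le_sup; [case: hE|split=> //; apply: h].
by rewrite leNgt s1.
Qed.

Lemma almost_all_affine (R : realFieldType) (a b : R) :
  a != 0 -> almost_all (fun t => a * t + b != 0).
Proof.
move=> a0; apply: almost_allS (almost_all_neq (- b / a)) => t; apply: contraNneq => h.
by apply/eqP/(mulfI a0); rewrite [RHS]mulrC divfK //; lra.
Qed.

(** * Plane geometry *)

Section Plane.
Variable R : realType.
Implicit Types (u v p z : R * R).

Lemma pairE (p q : R * R) : p.1 = q.1 -> p.2 = q.2 -> p = q.
Proof. by case: p q => ? ? [? ?] /= -> ->. Qed.

Lemma fst_sub p (q : R * R) : (p - q).1 = p.1 - q.1. Proof. by []. Qed.
Lemma snd_sub p (q : R * R) : (p - q).2 = p.2 - q.2. Proof. by []. Qed.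

Lemma scale_pairE (a : R) p : a *: p = (a * p.1, a * p.2).
Proof. by []. Qed.

Lemma normE2 p e : (`|p| < e) = (`|p.1| < e) && (`|p.2| < e).
Proof. by rewrite prod_normE gt_max. Qed.

Definition dot u v : R := u.1 * v.1 + u.2 * v.2.

Lemma dot_gt0 u : u != 0 -> 0 < dot u u.
Proof.
case: u => a b ne; rewrite /dot /= -!expr2 lt_neqAle addr_ge0 ?sqr_ge0 // andbT.
rewrite eq_sym paddr_eq0 ?sqr_ge0 // !sqrf_eq0.
by apply: contra ne => /andP[/eqP-> /eqP->].
Qed.

Lemma square_coordinates u z : u != 0 ->
  z = (dot u z / dot u u) *: u + (cross u z / dot u u) *: rot90 u.
Proof.
move=> /dot_gt0 u0; have : dot u u != 0 by rewrite gt_eqF.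
by move=> ne; apply: pairE; rewrite !scale_pairE /dot /cross /rot90 /=; field; move: ne; rewrite /dot.
Qed.

Lemma dot_comb u s t : dot u (s *: u + t *: rot90 u) = s * dot u u.
Proof. by rewrite !scale_pairE /dot /rot90 /=; ring. Qed.

Lemma cross_comb u s t : cross u (s *: u + t *: rot90 u) = t * dot u u.
Proof. by rewrite !scale_pairE /dot /cross /rot90 /=; ring. Qed.

Lemma closed_squareP u z : u != 0 -> closed_square u z <->
  (0 <= dot u z <= dot u u) && (0 <= cross u z <= dot u u).
Proof.
move=> une; have u0 := dot_gt0 une; split.
  move=> [s [t [s01 t01 ->]]].
  by rewrite dot_comb cross_comb !pmulr_lge0 // !ger_pMl //; apply/andP.
move=> /andP[/andP[h1 h2] /andP[h3 h4]].
exists (dot u z / dot u u), (cross u z / dot u u).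
rewrite !divr_ge0 ?(ltW u0) // !ler_pdivrMr // !mul1r h2 h4.
by split=> //; apply: square_coordinates.
Qed.

Lemma open_squareP u z : u != 0 -> open_square u z <->
  (0 < dot u z < dot u u) && (0 < cross u z < dot u u).
Proof.
move=> une; have u0 := dot_gt0 une; split.
  move=> [s [t [s01 t01 ->]]].
  by rewrite dot_comb cross_comb !pmulr_lgt0 // !gtr_pMl //; apply/andP.
move=> /andP[/andP[h1 h2] /andP[h3 h4]].
exists (dot u z / dot u u), (cross u z / dot u u).
rewrite !divr_gt0 ?(ltW u0) // !ltr_pdivrMr // !mul1r h2 h4.
by split=> //; apply: square_coordinates.
Qed.

Lemma open_square_closed u z : open_square u z -> closed_square u z.
Proof.
by move=> [s [t [/andP[? ?] /andP[? ?] ->]]]; exists s, t; rewrite !ltW.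
Qed.

Lemma closed_square_convex u z z' t : closed_square u z -> closed_square u z' ->
  0 <= t <= 1 -> closed_square u (z + t *: (z' - z)).
Proof.
move=> [a [b [/andP[a0 a1] /andP[b0 b1] ->]]] [c [d [/andP[c0 c1] /andP[d0 d1] ->]]] /andP[t0 t1].
exists (a + t * (c - a)), (b + t * (d - b)); split.
- by apply/andP; split; nra.
- by apply/andP; split; nra.
- by apply: pairE; rewrite !scale_pairE /rot90 /=; ring.
Qed.

(** Along a line through [z] that is parallel to none of the given ones, each of them excludes a
    single parameter. A slope [m] between 0 and 1 makes the parameter equal to the distance from [z]
    in the maximum norm. *)
Lemma avoid_lines (I : eqType) (r : seq I) (w : I -> R * R) (b : I -> R) z e :
  0 < e -> (forall i, i \in r -> w i != 0) ->
  exists2 y, `|y - z| < e & forall i, i \in r -> cross (w i) y + b i != 0.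
Proof.
move=> e0 w0.
have : almost_all (fun m => forall i, i \in r -> (w i).1 * m + - (w i).2 != 0).
  apply: almost_all_seq => i ir; have [w1|w1] := eqVneq (w i).1 0; last first.
    exact: almost_all_affine.
  apply: almost_allW => m; rewrite w1 mul0r add0r oppr_eq0.
  by apply: contra (w0 i ir) => /eqP w2; apply/eqP/pairE.
move=> /almost_all_ex /(_ ltr01)[m /andP[m0 m1] hm].
have : almost_all (fun t => forall i, i \in r ->
    ((w i).1 * m + - (w i).2) * t + (cross (w i) z + b i) != 0).
  by apply: almost_all_seq => i ir; apply: almost_all_affine; apply: hm.
move=> /almost_all_ex /(_ e0)[t /andP[t0 te] ht].
exists (z + t *: (1, m)) => [|i ir].
  rewrite addrAC subrr add0r normE2 scale_pairE /= mulr1.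
  rewrite !gtr0_norm ?mulr_gt0 // te /=.
  by apply: lt_trans te; rewrite gtr_pMr.
have := ht i ir; rewrite scale_pairE /cross /=; apply: contraNneq => h.
by apply/eqP; rewrite -h; ring.
Qed.

End Plane.

Section Same.
Variables (R : realType) (G : gluing R).
Hypothesis tr : glued_by_translations G.
Implicit Types (x y z : rep G) (v : R * R).

Lemma glued_sym x y : glued x y -> glued y x.
Proof.
case: tr => invm vecm [e [t [t01 -> ->]]]; exists (mate G e), (1 - t); split.
- by move: t01 => /andP[? ?]; apply/andP; split; lra.
- congr pair; have := vecm e; rewrite /edge_vec.
  set a := edge_tgt (mate G e); set b := edge_src (mate G e); set d := _ - edge_src e.
  move=> h; have -> : d = b - a by rewrite -[d]opprK -h opprB.
  by apply: pairE; rewrite !scale_pairE /=; ring.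
- rewrite invm vecm; congr pair; rewrite /edge_vec.
  by apply: pairE; rewrite !scale_pairE /=; ring.
Qed.

Lemma same_closed (Q : rep G -> Prop) :
  (forall x y, glued x y -> Q x -> Q y) -> forall x y, same x y -> Q x -> Q y.
Proof.
move=> hQ x y; suff H : same x y -> (Q x <-> Q y) by move=> /H[].
elim=> {x y} [x y /[dup] g /glued_sym g'|x|x y _ [h1 h2]|x y z _ [h1 h2] _ [h3 h4]].
- by split; apply: hQ.
- by [].
- by split.
- by split=> [/h1/h3|/h4/h2].
Qed.

Lemma same_refl x : same x x. Proof. exact: rst_refl. Qed.
Lemma same_sym x y : same x y -> same y x. Proof. exact: rst_sym. Qed.
Lemma same_trans y x z : same x y -> same y z -> same x z.
Proof. exact: rst_trans. Qed.

Lemma step_same x x' y y' v : same x x' -> same y y' -> step x y v -> step x' y' v.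
Proof.
move=> xx' yy' [i [p [h1 h2 h3]]]; exists i, p; split=> //.
  exact: same_trans (same_sym xx') h1.
exact: same_trans (same_sym yy') h2.
Qed.

End Same.

(** * Surfaces glued from triangles *)

Definition convex_hull3 (R : realType) (P : 'I_3 -> R * R) : set (R * R) :=
  [set x | exists a : 'I_3 -> R, [/\ forall k, 0 <= a k,
     \sum_k a k = 1 & x = \sum_k a k *: P k]].

(** Convertible with the [tri_gluing] of a triangulation, so that the results below apply to it
    directly. *)
Definition tri_surface (R : realType) (I : finType) (P : I -> 'I_3 -> R * R)
    (mate : {i : I & 'I_3} -> {i : I & 'I_3}) : gluing R :=
  @Gluing R I (fun=> 3%N) P (fun i => convex_hull3 (P i)) mate.

Lemma convex_hull3P (R : realType) (P : 'I_3 -> R * R) p : ccw P ->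
  convex_hull3 P p <-> forall j, 0 <= edge_fun P j p.
Proof.
move=> D0; have D1 : cross (P 1 - P 0) (P 2 - P 1) != 0 by rewrite gt_eqF.
have sumE (V : zmodType) (f : 'I_3 -> V) : \sum_k f k = f 0 + f 1 + f 2.
  rewrite !big_ord_recl big_ord0 addr0 addrA; congr (f _ + f _ + f _); exact: val_inj.
split=> [[a [a0 a1 ->]] j|h].
  move: a1 (a0 0) (a0 1) (a0 2); rewrite !sumE => a1 h0 h1 h2.
  have -> : edge_fun P j (a 0 *: P 0 + a 1 *: P 1 + a 2 *: P 2) =
      a (ordS (ordS j)) * cross (P 1 - P 0) (P 2 - P 1).
    have a2 : a 2 = 1 - a 0 - a 1 by lra.
    by elim/ord3_ind: j; rewrite /edge_fun !ordS3E !scale_pairE a2 /cross /=; ring.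
  by rewrite mulr_ge0 ?a0 // ltW.
exists (fun k => edge_fun P (ordS k) p / cross (P 1 - P 0) (P 2 - P 1)); split.
- by move=> k; rewrite divr_ge0 ?h // ltW.
- rewrite -mulr_suml sumE !ordS3E; have := edge_fun_sum P 1 p.
  by rewrite !ordS3E => ->; rewrite divff.
- rewrite sumE; apply: pairE; rewrite !scale_pairE /edge_fun !ordS3E /cross /=;
    field; exact: D1.
Qed.

Section TriangulatedSurface.
Variables (R : realType) (I : finType) (P : I -> 'I_3 -> R * R).
Variable mate : {i : I & 'I_3} -> {i : I & 'I_3}.
Local Notation G := (tri_surface P mate).
Hypothesis tr : glued_by_translations G.
Hypothesis P_ccw : forall i, ccw (P i).
Implicit Types (i : I) (e : {i : I & 'I_3}) (p : R * R) (t : R) (x y : rep G).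

Definition edge_point e t : rep G := (tag e, edge_src (G := G) e + t *: edge_vec (G := G) e).

Definition in_tri i p : Prop := forall j, 0 <= edge_fun (P i) j p.

Lemma is_pointP i p : is_point ((i, p) : rep G) <-> in_tri i p.
Proof. exact: convex_hull3P. Qed.

Lemma inside_in_tri i p : inside (P i) p -> in_tri i p.
Proof. by move=> /insideP h j; exact: ltW. Qed.

Lemma edge_fun_segment i j p q t :
  edge_fun (P i) j (p + t *: (q - p)) =
  (1 - t) * edge_fun (P i) j p + t * edge_fun (P i) j q.
Proof. by rewrite /edge_fun /cross !scale_pairE /=; ring. Qed.

Lemma inside_segment i p q t : inside (P i) p -> in_tri i q -> 0 <= t < 1 ->
  inside (P i) (p + t *: (q - p)).
Proof.
move=> /insideP hp hq /andP[t0 t1]; apply/insideP => j; rewrite edge_fun_segment.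
by rewrite ltr_wpDr ?mulr_ge0 ?mulr_gt0 // ?subr_gt0 //; apply: hq.
Qed.

Lemma edge_fun_edge_point e t j :
  edge_fun (P (tag e)) j (edge_point e t).2 =
  if j == tagged e then 0 else
  (if j == ordS (tagged e) then 1 - t else t) *
  cross (P (tag e) 1 - P (tag e) 0) (P (tag e) 2 - P (tag e) 1).
Proof.
rewrite /edge_point /edge_vec /edge_src /edge_tgt /=; case: e => i k /=.
by case: (ord3_rot k j) => ->; rewrite ?ordS3_neq ?eqxx; elim/ord3_ind: k;
  rewrite /edge_fun /cross !ordS3E !scale_pairE /=; ring.
Qed.

Lemma edge_point_neq0 i : cross (P i 1 - P i 0) (P i 2 - P i 1) != 0.
Proof. by rewrite gt_eqF //; apply: P_ccw. Qed.

Lemma edge_point_not_inside e t : inside (P (tag e)) (edge_point e t).2 = false.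
Proof.
apply/negP => /insideP /(_ (tagged e)).
by rewrite edge_fun_edge_point eqxx ltxx.
Qed.

Lemma edge_point_inj e e' t t' : edge_point e t = edge_point e' t' ->
  (e = e' /\ t = t') \/ ((t == 0) || (t == 1)) && ((t' == 0) || (t' == 1)).
Proof.
case: e e' => i k [i' k'] /[dup] h [/= ii' _]; move: h; case: i' / ii' k' => k' h.
have D0 := edge_point_neq0 i.
have key j := edge_fun_edge_point (existT (fun=> 'I_3) i k) t j.
have key' j := edge_fun_edge_point (existT (fun=> 'I_3) i k') t' j.
have {}key j : (if j == k then 0 else (if j == ordS k then 1 - t else t) *
    cross (P i 1 - P i 0) (P i 2 - P i 1)) = (if j == k' then 0 else
    (if j == ordS k' then 1 - t' else t') * cross (P i 1 - P i 0) (P i 2 - P i 1)).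
  exact: etrans (esym (key j)) (etrans (congr1 (fun x : rep G => edge_fun (P i) j x.2) h) (key' j)).
have := key k; have := key (ordS k); have := key (ordS (ordS k)).
case: (ord3_rot k k') => ->; rewrite ?ordS3_neq ?ordS3K ?ordS3_neq ?eqxx ?ordS3_neq.
- by move=> /(mulIf D0) -> _ _; left.
- move=> /(mulIf D0) t1 /eqP; rewrite mulf_eq0 (negbTE D0) orbF => /eqP t2 _.
  by right; apply/andP; split; apply/orP; [right|left]; apply/eqP; lra.
- move=> /eqP; rewrite mulf_eq0 (negbTE D0) orbF => /eqP t1 /(mulIf D0) t2 _.
  by right; apply/andP; split; apply/orP; [left|right]; apply/eqP; lra.
Qed.

End TriangulatedSurface.

Lemma pair_split (A B : Type) (a a' : A) (b b' : B) : (a, b) = (a', b') -> a = a' /\ b = b'.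
Proof. by move=> [-> ->]. Qed.

(** * Overlaps of a square with a triangle *)

Section Pieces.
Variables (R : realType) (I : finType) (P : I -> 'I_3 -> R * R).
Variable mate : {i : I & 'I_3} -> {i : I & 'I_3}.
Local Notation G := (tri_surface P mate).
Hypothesis tr : glued_by_translations G.
Hypothesis P_ccw : forall i, ccw (P i).
Implicit Types (i : I) (e : {i : I & 'I_3}) (p : R * R) (t : R) (x y : rep G).

Let mateK : involutive mate. Proof. exact: tr.1. Qed.

Local Notation epoint := (@edge_point R I P mate).

Lemma glued_edge_point x y : glued x y -> exists e t,
  [/\ 0 <= t <= 1, x = epoint e t & y = epoint (mate e) (1 - t)].
Proof.
move=> [e [t [t01 -> ->]]]; exists e, t; split=> //.
rewrite /edge_point; have -> : @edge_vec R G e = - @edge_vec R G (mate e).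
  by rewrite [RHS](congr1 -%R (tr.2 e)) opprK.
by congr pair; rewrite /edge_vec; apply: pairE; rewrite !scale_pairE /=; ring.
Qed.

Lemma same_inside x y : same x y -> inside (P x.1) x.2 -> y = x.
Proof.
move=> xy hx; apply: (same_closed tr (Q := fun z => z = x)) xy _ => // z z'.
move=> /glued_edge_point[e [t [_ zE _]]] zx; case/negP: (negbT (edge_point_not_inside P mate e t)).
by move: zE; rewrite zx => xE; have := hx; rewrite xE.
Qed.

Lemma same_edge_point e t y : 0 < t < 1 -> same (epoint e t) y ->
  y = epoint e t \/ y = epoint (mate e) (1 - t).
Proof.
move=> t01 xy; pose Q z := z = epoint e t \/ z = epoint (mate e) (1 - t).
have open01 (s : R) : 0 < s < 1 -> ((s == 0) || (s == 1)) = false.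
  by move=> /andP[? ?]; apply/negbTE; rewrite negb_or gt_eqF ?lt_eqF.
apply: (same_closed tr (Q := Q)) xy _; last by left.
move=> z z' /glued_edge_point[e' [t' [_ zE ->]]] [] zE'; rewrite zE in zE'.
  have [[-> ->]|] := edge_point_inj P_ccw zE'; first by right.
  by rewrite (open01 t) ?andbF.
have [[-> ->]|] := edge_point_inj P_ccw zE'.
  by left; rewrite mateK subKr.
by rewrite (open01 (1 - t)) ?andbF //; move/andP: t01 => [? ?]; apply/andP; split; lra.
Qed.

(** Gluing sends the parameter [t] of an edge point to [1 - t], and ends to ends. Hence the points
    of all edges with parameter [t] or [1 - t] form a finite set closed under gluing, which also
    settles the vertices without following the triangles around them. *)
Lemma same_finite x : exists s : seq (I * (R * R)), forall y, same x y -> y \in s.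
Proof.
have [[e [t [t01 xE]]]|nx] := pselect (exists e t, 0 <= t <= 1 /\ x = epoint e t).
  exists ([seq epoint e t | e <- enum {: {i : I & 'I_3}}] ++
          [seq epoint e (1 - t) | e <- enum {: {i : I & 'I_3}}]).
  move=> y xy.
  pose Q (z : rep G) := exists e, z = epoint e t \/ z = epoint e (1 - t).
  have [e' [->|->]] : Q y.
  - apply: (same_closed tr (Q := Q)) xy _; last by exists e; left.
    move=> z z' /glued_edge_point[e1 [t1 [_ zE ->]]] [e2].
    have end1 (s : R) : ((s == 0) || (s == 1)) = ((1 - s == 0) || (1 - s == 1)).
      by rewrite orbC; apply/orP/orP => -[] /eqP h; [left|right|left|right]; apply/eqP; lra.
    suff H s : s = t \/ s = 1 - t -> epoint e1 t1 = epoint e2 s ->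
        exists e3, epoint (mate e1) (1 - t1) = epoint e3 t \/
                   epoint (mate e1) (1 - t1) = epoint e3 (1 - t).
      by rewrite zE => -[/(H _ (or_introl erefl))|/(H _ (or_intror erefl))].
    move=> st /(edge_point_inj P_ccw)[[_ ->]|/andP[t1E sE]]; exists (mate e1).
      by case: st => ->; [right|left; rewrite subKr].
    have : ((t == 0) || (t == 1)) by case: st sE => -> //; rewrite -end1.
    by move: t1E => /orP[]/eqP-> /orP[]/eqP->; rewrite ?subrr ?subr0; auto.
  - by rewrite mem_cat; apply/orP; left; apply/mapP; exists e'; rewrite ?mem_enum.
  - by rewrite mem_cat; apply/orP; right; apply/mapP; exists e'; rewrite ?mem_enum.
exists [:: x] => y xy; rewrite inE; apply/eqP.
apply: (same_closed tr (Q := fun z => z = x)) xy _ => // z z'.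
by move=> /glued_edge_point[e [t [t01 zE _]]] zx; case: nx; exists e, t; rewrite -zx.
Qed.

Variable Q : square_decomposition G.
Implicit Types (k : square Q) (z : R * R).

(** [tau] is the translation from the chart of the triangle to the plane of the square. One common
    point in the interior of the triangle is enough, by [piece_same]. *)
Definition is_piece k i (tau : R * R) : Prop := exists z,
  [/\ closed_square (side k) z, inside (P i) (z - tau) &
      same (square_map k z : rep G) (i, z - tau)].

Lemma segment_end p (q : R * R) : p + 1 *: (q - p) = q.
Proof. by rewrite scale1r addrC subrK. Qed.

Lemma segment_start p (q : R * R) : p + 0 *: (q - p) = p.
Proof. by rewrite scale0r addr0. Qed.

Lemma segment_close p (q : R * R) (e : R) : 0 < e -> exists2 d : R, 0 < d &
  forall s t, `|s - t| < d -> `|(p + s *: (q - p)) - (p + t *: (q - p))| < e.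
Proof.
move=> e0; exists (e / (`|q - p| + 1)); first by rewrite divr_gt0 ?ltr_wpDl.
move=> s t; rewrite ltr_pdivlMr ?ltr_wpDl // => h.
rewrite opprD addrACA subrr add0r -scalerBl prod_norm_scale.
by apply: le_lt_trans h; rewrite ler_wpM2l // lerDl.
Qed.

(** The two descriptions are compared along the segment from the common point [z0] to [z]. Before
    the end it runs inside the triangle, where points have a single representative, so a local step
    of the square has no choice of chart. *)
Lemma piece_same k i tau z : is_piece k i tau ->
  closed_square (side k) z -> in_tri P i (z - tau) ->
  same (square_map k z : rep G) (i, z - tau).
Proof.
move=> [z0 [sq0 in0 same0]] sqz inz.
pose zt t := z0 + t *: (z - z0).
suff : same (square_map k (zt 1) : rep G) (i, zt 1 - tau).
  by rewrite /zt segment_end.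
have sqt t : 0 <= t <= 1 -> closed_square (side k) (zt t).
  exact: closed_square_convex.
have int t : 0 <= t < 1 -> inside (P i) (zt t - tau).
  move=> t01; have -> : zt t - tau = (z0 - tau) + t *: ((z - tau) - (z0 - tau)).
    by rewrite /zt opprB addrA subrK addrAC.
  exact: inside_segment.
apply: (real_induction (P := fun t => same (square_map k (zt t) : rep G) (i, zt t - tau))).
  by rewrite /zt segment_start.
move=> t t01; have [e e0 he] := square_local (sqt t t01).
have [d d0 hd] := segment_close z0 z e0.
exists d => // s s01 /hd /(he _ (sqt s s01))[i' [p' [h1 h2 _]]].
have zE : p' + (zt s - zt t) = zt s - tau -> p' = zt t - tau.
  by move=> h; rewrite -[p'](addrK (zt s - zt t)) h opprB addrC addrA subrK.
split=> [st hs|ts ht].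
  have s1 : 0 <= s < 1.
    by move: s01 t01 => /andP[-> _] /andP[_]; apply: lt_le_trans.
  have [ii' pE] := pair_split (same_inside (same_trans (same_sym hs) h2) (int s s1)).
  by move: h1; rewrite ii' (zE pE).
have t1 : 0 <= t < 1.
  by move: s01 t01 => /andP[_ s1] /andP[-> _]; apply: lt_le_trans s1.
have [ii' pE] := pair_split (same_inside (same_trans (same_sym ht) h1) (int t t1)).
have e1 : zt t - tau + (zt s - zt t) = zt s - tau by rewrite addrC addrA subrK.
by move: h2; rewrite ii' pE e1.
Qed.

(** Compactness of the square: the steps from one point to its neighbours start at one of finitely
    many representatives, and the representative determines the triangle and the translation. *)
Lemma pieces_finite : exists s : seq (square Q * I * (R * R)),
  uniq s /\ forall a, (a \in s) = `[< is_piece a.1.1 a.1.2 a.2 >].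
Proof.
suff H k : exists s : seq (I * (R * R)), forall i tau, is_piece k i tau -> (i, tau) \in s.
  have {H} /choice[s hs] := H.
  exists (undup [seq a <- [seq (k, b.1, b.2) | k <- enum (square Q), b <- s k] |
    `[< is_piece a.1.1 a.1.2 a.2 >]]); split=> [|[[k i] tau]]; first exact: undup_uniq.
  rewrite mem_undup mem_filter /=; case: asboolP => //= /hs h.
  by apply/allpairsPdep; exists k, (i, tau); rewrite mem_enum.
(* The filter of lists that contain a given finite list. A property that holds near every point of
   the square for large lists then holds for one list on the whole square. *)
pose F : set_system (seq (I * (R * R))) := [set U : set (seq (I * (R * R))) |
  exists s : seq (I * (R * R)), forall s' : seq (I * (R * R)), {subset s <= s'} -> U s'].
have FF : Filter F.
  split.
  - by exists [::].
  - move=> U V [s hs] [s' hs']; exists (s ++ s') => s'' hs''; split.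
      by apply: hs => a ha; apply: hs''; rewrite mem_cat ha.
    by apply: hs' => a ha; apply: hs''; rewrite mem_cat ha orbT.
  - by move=> U V UV [s hs]; exists s => s' /hs /UV.
pose z (st : R * R) : R * R := st.1 *: side k + st.2 *: rot90 (side k).
pose Pr (s : seq (I * (R * R))) (st : R * R) := forall i tau,
  closed_square (side k) (z st) -> inside (P i) (z st - tau) -> same (square_map k (z st) : rep G) (i, z st - tau) ->
  (i, tau) \in s.
have cpt : compact (`[0, 1] `*` `[0, 1] : set (R * R)).
  by apply: compact_setX; apply: segment_compact.
have /compact_near_coveringP cov := cpt.
have sqz st : (`[0, 1] `*` `[0, 1]) st -> closed_square (side k) (z st).
  by move=> [/= ]; rewrite !in_itv /= => s01 t01; exists st.1, st.2.
have zc : continuous z.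
  by move=> st; apply: cvgD; apply: cvgZr_tmp; [apply: cvg_fst|apply: cvg_snd].
have [s0 hs0] : \near F, `[0, 1] `*` `[0, 1] `<=` Pr F.
  apply: cov => st /sqz sqst.
  have [e e0 he] := square_local sqst.
  have [s1 hs1] := same_finite (square_map k (z st) : rep G).
  pose s2 := [seq (a.1, z st - a.2) | a <- s1].
  exists ([set st' | `|z st' - z st| < e],
    [set s : seq (I * (R * R)) | {subset s2 <= s}]).
    split=> /=; last by exists s2.
    have /cvgrPdist_lt /(_ e e0) := zc st.
    by apply: filterS => st' /=; rewrite distrC.
  move=> [st' s] /= [near_st s2s] i tau sqst' ins hsame.
  apply: s2s; have [i' [p' [h1 h2 _]]] := he _ sqst' near_st.
  have [ii' pE] := pair_split (same_inside (same_trans (same_sym hsame) h2) ins).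
  apply/mapP; exists (i', p'); first exact: hs1.
  congr pair; rewrite ?ii' //= -[p'](addrK (z st' - z st)) pE.
  by rewrite opprB addrA; apply: pairE => /=; ring.
exists s0 => i tau [y [sqy iny samey]].
have [a [b [a01 b01 yE]]] := sqy.
have := hs0 s0 (fun _ h => h) (a, b); rewrite /Pr /z /= -yE.
by apply=> //; rewrite /= !in_itv.
Qed.

End Pieces.

(** * Directions into a square at one of its points *)

Section Germs.
Variable R : realType.
Implicit Types (u v w x y z n : R * R).

Lemma cross_le w y : `|cross w y| <= 2 * `|w| * `|y|.
Proof.
have [w1 w2] : `|w.1| <= `|w| /\ `|w.2| <= `|w|.
  by rewrite prod_normE !le_max !lexx orbT.
have [y1 y2] : `|y.1| <= `|y| /\ `|y.2| <= `|y|.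
  by rewrite prod_normE !le_max !lexx orbT.
have := ler_normB (w.1 * y.2) (w.2 * y.1); rewrite !normrM.
have := ler_pM (normr_ge0 _) (normr_ge0 _) w1 y2.
have := ler_pM (normr_ge0 _) (normr_ge0 _) w2 y1.
by rewrite /cross => *; lra.
Qed.

Lemma cross_pos_near w b x : 0 < cross w x + b -> exists2 e : R, 0 < e &
  forall y, `|y - x| < e -> 0 < cross w y + b.
Proof.
move=> h; have h1 : 0 < 2 * `|w| + 1 by have := normr_ge0 w; lra.
exists ((cross w x + b) / (2 * `|w| + 1)); first exact: divr_gt0.
move=> y; rewrite ltr_pdivlMr // => h2; have := cross_le w (y - x).
have -> : cross w (y - x) = cross w y - cross w x by rewrite /cross /=; ring.
rewrite ler_norml => /andP[h3 _]; have := normr_ge0 (y - x).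
by move: h2 h3; set c := cross w y; set d := cross w x; set N := `|w|; set M := `|y - x| => *; lra.
Qed.

Lemma near_all (I : eqType) (r : seq I) (T : I -> R -> Prop) :
  (forall i, i \in r -> exists2 e : R, 0 < e & forall s, s < e -> T i s) ->
  exists2 e : R, 0 < e & forall i s, i \in r -> s < e -> T i s.
Proof.
elim: r => [|i r IH] h; first by exists 1.
have [e e0 he] := h i (mem_head _ _).
have [|d d0 hd] := IH; first by move=> j jr; apply: h; rewrite inE jr orbT.
exists (Num.min e d) => [|j s]; first by rewrite lt_min e0.
by rewrite inE lt_min => /predU1P[->|jr] /andP[se sd]; [apply: he|apply: hd].
Qed.

Lemma dot_cross u z : dot u z = cross (u.2, - u.1) z.
Proof. by rewrite /dot /cross /=; ring. Qed.

Lemma closed_square_far u x : u != 0 -> ~ closed_square u x ->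
  exists2 e : R, 0 < e & forall y, `|y - x| < e -> ~ closed_square u y.
Proof.
move=> une nx; suff [w [b [h1 h2]]] : exists w b, 0 < cross w x + b /\
    forall y, closed_square u y -> cross w y + b <= 0.
  have [e e0 he] := cross_pos_near h1; exists e => // y /he + /h2.
  by rewrite leNgt => ->.
move: nx => /(closed_squareP _ une)/negP; rewrite !negb_and -!ltNge.
case/orP => /orP[] h.
- exists (- (u.2, - u.1)), 0; split=> [|y /(closed_squareP _ une)];
    rewrite ?dot_cross /cross /=; move: h; rewrite dot_cross /cross /=; lra.
- exists (u.2, - u.1), (- dot u u); split=> [|y /(closed_squareP _ une)].
    by rewrite -dot_cross subr_gt0.
  by rewrite -dot_cross => /andP[/andP[_ ?] _]; rewrite subr_le0.
- exists (- u), 0; split=> [|y /(closed_squareP _ une)];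
    rewrite /cross /=; move: h; rewrite /cross /=; lra.
- exists u, (- dot u u); split=> [|y /(closed_squareP _ une)].
    by rewrite subr_gt0.
  by move=> /andP[_ /andP[_ ?]]; rewrite subr_le0.
Qed.

Lemma open_square_near u z : u != 0 -> open_square u z ->
  exists2 d : R, 0 < d & forall y, `|y - z| < d -> open_square u y.
Proof.
move=> une /(open_squareP _ une)/andP[/andP[h1 h2] /andP[h3 h4]].
pose w1 : R * R := (u.2, - u.1); pose N := dot u u.
have [|a a0 ha] := @cross_pos_near w1 0 z; first by rewrite addr0 -dot_cross.
have NN n y : cross (- n) y = - cross n y by rewrite /cross /=; ring.
have [|b b0 hb] := @cross_pos_near (- w1) N z.
  by rewrite NN -dot_cross addrC subr_gt0.
have [|c c0 hc] := @cross_pos_near u 0 z; first by rewrite addr0.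
have [|d d0 hd] := @cross_pos_near (- u) N z; first by rewrite NN addrC subr_gt0.
exists (Num.min (Num.min a b) (Num.min c d)) => [|y]; first by rewrite !lt_min a0 b0 c0.
rewrite !lt_min => /andP[/andP[/ha ya /hb yb] /andP[/hc yc /hd yd]].
rewrite !addr0 !NN -?dot_cross in ya yb yc yd.
apply/(open_squareP _ une); rewrite ya yc /=; apply/andP; split.
  by rewrite -subr_gt0 addrC.
by rewrite -subr_gt0 addrC.
Qed.

Lemma itv_germ (a c N : R) : 0 <= a <= N -> 0 < N -> (a = 0 -> 0 < c) ->
  (a = N -> c < 0) ->
  exists2 d : R, 0 < d & forall s, 0 < s < d -> 0 < a + s * c < N.
Proof.
move=> /andP[a0 aN] N0 h0 hN.
have c1 : 0 < `|c| + 1 by rewrite ltr_wpDl.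
have cle := ler_norm c; have := ler_norm (- c); rewrite normrN => cge.
have bound s m : 0 < s -> s < m / (`|c| + 1) -> s * c < m /\ - m < s * c.
  move=> s0; rewrite ltr_pdivlMr // => h; split.
    by apply: le_lt_trans h; rewrite ler_pM2l //; lra.
  by rewrite ltrNl -mulrN; apply: le_lt_trans h; rewrite ler_pM2l //; lra.
have [aE|an0] := eqVneq a 0.
  exists (N / (`|c| + 1)) => [|s /andP[s0 sd]]; first exact: divr_gt0.
  have [h1 h2] := bound s N s0 sd; rewrite aE add0r h1 andbT.
  by rewrite mulr_gt0 // h0.
have [aE|anN] := eqVneq a N.
  exists (N / (`|c| + 1)) => [|s /andP[s0 sd]]; first exact: divr_gt0.
  have [h1 h2] := bound s N s0 sd; have : s * c < 0 by rewrite pmulr_rlt0 ?hN.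
  by rewrite aE => ?; apply/andP; split; lra.
have a0' : 0 < a by rewrite lt_neqAle eq_sym an0.
have aN' : 0 < N - a by rewrite subr_gt0 lt_neqAle anN.
exists (Num.min (a / (`|c| + 1)) ((N - a) / (`|c| + 1))).
  by rewrite lt_min !divr_gt0.
move=> s /andP[s0]; rewrite lt_min => /andP[sa sN].
have [_ ?] := bound s _ s0 sa; have [? _] := bound s _ s0 sN.
by apply/andP; split; lra.
Qed.

Definition corner u z : bool :=
  ((dot u z == 0) || (dot u z == dot u u)) && ((cross u z == 0) || (cross u z == dot u u)).

Definition aligned u w : Prop := dot u w = 0 \/ cross u w = 0.

(** A point that is not a corner lies on at most one side, and [n] is the inner normal of that side;
    at an interior point any choice of [n] will do. *)
Lemma half_germ u z : u != 0 -> closed_square u z -> ~~ corner u z ->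
  exists n, [/\ n = u \/ n = rot90 u \/ n = - u \/ n = - rot90 u &
    forall v, 0 < dot n v -> exists2 d : R, 0 < d & forall s, 0 < s < d ->
      open_square u (z + s *: v)].
Proof.
move=> une /(closed_squareP _ une)/andP[ha hb] nc; have N0 := dot_gt0 une.
have dotD v s : dot u (z + s *: v) = dot u z + s * dot u v.
  by rewrite scale_pairE /dot /=; ring.
have crossD v s : cross u (z + s *: v) = cross u z + s * cross u v.
  by rewrite scale_pairE /cross /=; ring.
have main v : (dot u z = 0 -> 0 < dot u v) -> (dot u z = dot u u -> dot u v < 0) ->
    (cross u z = 0 -> 0 < cross u v) -> (cross u z = dot u u -> cross u v < 0) ->
    exists2 d : R, 0 < d & forall s, 0 < s < d -> open_square u (z + s *: v).
  move=> h1 h2 h3 h4; have [d d0 hd] := itv_germ ha N0 h1 h2.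
  have [e e0 he] := itv_germ hb N0 h3 h4.
  exists (Num.min d e) => [|s /andP[s0]]; first by rewrite lt_min d0.
  rewrite lt_min => /andP[sd se]; apply/(open_squareP _ une).
  by rewrite dotD crossD hd ?he // s0.
have rotE v : dot (rot90 u) v = cross u v by rewrite /rot90 /dot /cross /=; ring.
have NN n v : dot (- n) v = - dot n v by rewrite /dot /=; ring.
have [a0|a0] := eqVneq (dot u z) 0.
  exists u; split=> [|v uv]; first by left.
  apply: main => // [|b0|bN]; first by rewrite a0 => e; rewrite -e ltxx in N0.
    by case/negP: nc; rewrite /corner a0 b0 !eqxx.
  by case/negP: nc; rewrite /corner a0 bN !eqxx orbT.
have [aN|aN] := eqVneq (dot u z) (dot u u).
  exists (- u); split=> [|v]; first by right; right; left.
  rewrite NN oppr_gt0 => uv; apply: main => // [|b0|bN]; first by move/eqP: a0.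
    by case/negP: nc; rewrite /corner aN b0 !eqxx orbT.
  by case/negP: nc; rewrite /corner aN bN !eqxx !orbT.
have [b0|b0] := eqVneq (cross u z) 0.
  exists (rot90 u); split=> [|v]; first by right; left.
  rewrite rotE => uv; apply: main => //; [by move/eqP: a0|by move/eqP: aN|].
  by rewrite b0 => e; rewrite -e ltxx in N0.
have [bN|bN] := eqVneq (cross u z) (dot u u).
  exists (- rot90 u); split=> [|v]; first by right; right; right.
  by rewrite NN rotE oppr_gt0 => uv; apply: main => //; [move/eqP: a0|move/eqP: aN|move/eqP: b0].
exists u; split=> [|v uv]; first by left.
by apply: main; [move/eqP: a0|move/eqP: aN|move/eqP: b0|move/eqP: bN].
Qed.

Lemma aligned_refl u : aligned u u.
Proof. by right; rewrite /cross; ring. Qed.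

Lemma aligned_trans v u w : v != 0 -> aligned u v -> aligned v w -> aligned u w.
Proof.
move=> /dot_gt0 v0 huv hvw.
have id1 : dot u w * dot v v = dot u v * dot v w - cross u v * cross v w.
  by rewrite /dot /cross; ring.
have id2 : cross u w * dot v v = dot u v * cross v w + cross u v * dot v w.
  by rewrite /dot /cross; ring.
have v1 : dot v v != 0 by rewrite gt_eqF.
case: huv hvw => h1 [] h2; rewrite h1 h2 ?mulr0 ?mul0r ?addr0 ?subr0 in id1 id2.
- by right; apply: (mulIf v1); rewrite id2 mul0r.
- by left; apply: (mulIf v1); rewrite id1 mul0r.
- by left; apply: (mulIf v1); rewrite id1 mul0r.
- by right; apply: (mulIf v1); rewrite id2 mul0r.
Qed.

(** [v b] has inner products 1 and [b] with [n] and [n']. Its cross product with [d] is affine in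
    [b] and not identically zero, so it does not vanish at both [b = 1] and [b = 2]. *)
Lemma common_direction n n' d : cross n n' != 0 -> d != 0 ->
  exists v, [/\ 0 < dot n v, 0 < dot n' v & cross d v != 0].
Proof.
move=> c0 d0; pose v b := (cross n n')^-1 *: (b *: rot90 n - rot90 n').
have v1 b : dot n (v b) = 1.
  by rewrite /v !scale_pairE /dot /rot90 /=; move: c0; rewrite /cross => c0; field.
have v2 b : dot n' (v b) = b.
  by rewrite /v !scale_pairE /dot /rot90 /=; move: c0; rewrite /cross => c0; field.
suff [b [b0 hb]] : exists b, 0 < b /\ cross d (v b) != 0.
  by exists (v b); rewrite v1 v2.
have dv b : cross d (v b) * cross n n' = b * dot d n - dot d n'.
  by rewrite /v !scale_pairE /dot /rot90; move: c0; rewrite /cross /= => c0; field.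
have [h1|] := eqVneq (cross d (v 1)) 0; last by exists 1.
have [h2|] := eqVneq (cross d (v 2)) 0; last by exists 2.
have := dv 1; have := dv 2; rewrite h1 h2 !mul0r => e2 e1.
have dn : dot d n = 0 by lra.
have dn' : dot d n' = 0 by lra.
have E1 : d.1 * cross n n' = dot d n * n'.2 - dot d n' * n.2.
  by rewrite /dot /cross; ring.
have E2 : d.2 * cross n n' = dot d n' * n.1 - dot d n * n'.1.
  by rewrite /dot /cross; ring.
case/eqP: d0; apply: pairE; apply: (mulIf c0);
  by rewrite ?E1 ?E2 dn dn' !mul0r subrr.
Qed.

Lemma not_aligned_cross u w n n' : ~ aligned u w ->
  n = u \/ n = rot90 u \/ n = - u \/ n = - rot90 u ->
  n' = w \/ n' = rot90 w \/ n' = - w \/ n' = - rot90 w -> cross n n' != 0.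
Proof.
move=> na hn hn'.
have c0 : cross u w != 0 by apply/eqP => h; apply: na; right.
have d0 : dot u w != 0 by apply/eqP => h; apply: na; left.
suff : (cross n n') ^+ 2 = (cross u w) ^+ 2 \/ (cross n n') ^+ 2 = (dot u w) ^+ 2.
  by case=> h; rewrite -sqrf_eq0 h sqrf_eq0.
by case: hn => [->|[->|[->|->]]]; case: hn' => [->|[->|[->|->]]];
  rewrite /cross /dot /rot90 /=; (try by left; ring); right; ring.
Qed.

End Germs.

(** * Parallelism of the squares *)

Section Alignment.
Variables (R : realType) (I : finType) (P : I -> 'I_3 -> R * R).
Variable mate : {i : I & 'I_3} -> {i : I & 'I_3}.
Local Notation G := (tri_surface P mate).
Hypothesis tr : glued_by_translations G.
Hypothesis P_ccw : forall i, ccw (P i).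
Variable Q : square_decomposition G.
Implicit Types (i : I) (e : {i : I & 'I_3}) (p : R * R) (t : R) (x y : rep G).
Implicit Types (k l : square Q) (z v : R * R).
Local Notation epoint := (@edge_point R I P mate).
Local Notation smap k z := (square_map k z : rep G).

Lemma in_tri_boundary i p : in_tri P i p -> inside (P i) p \/
  exists j t, 0 <= t <= 1 /\ (i, p) = epoint (existT _ i j) t.
Proof.
move=> hp; case: (boolP (inside (P i) p)) => [|/forallPn[j]]; first by left.
rewrite lt_neqAle hp andbT negbK eq_sym => /eqP h0; right.
have D0 := P_ccw i; rewrite /ccw in D0; set D := cross _ _ in D0.
have := edge_fun_sum (P i) j p; rewrite -/D h0 add0r => hD.
exists j, (edge_fun (P i) (ordS (ordS j)) p / D); split.
  rewrite divr_ge0 ?hp ?(ltW D0) // ler_pdivrMr // mul1r -hD lerDr; exact: hp.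
have b1 := edge_fun_barycentre1 (P i) j p.
have b2 : edge_fun (P i) (ordS j) p * (p.2 - (P i j).2) +
  edge_fun (P i) (ordS (ordS j)) p * (p.2 - (P i (ordS j)).2) +
  edge_fun (P i) j p * (p.2 - (P i (ordS (ordS j))).2) = 0.
  by rewrite /edge_fun /cross ordS3K /=; ring.
rewrite h0 mul0r addr0 in b1; rewrite h0 mul0r addr0 in b2.
have Dn : D != 0 by rewrite gt_eqF.
have e1 : edge_fun (P i) (ordS j) p = D - edge_fun (P i) (ordS (ordS j)) p.
  by rewrite -hD addrK.
rewrite e1 in b1 b2; congr pair; rewrite /edge_vec /edge_src /edge_tgt /=.
apply: pairE; rewrite !scale_pairE /=; apply: (mulIf Dn).
  by rewrite mulrDl mulrAC divfK //; lra.
by rewrite mulrDl mulrAC divfK //; lra.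
Qed.

Lemma edge_vec_neq0 e : edge_vec (G := G) e != 0.
Proof.
apply/eqP => h; have := edge_fun_edge_point P mate e 1 (ordS (ordS (tagged e))).
have := edge_fun_edge_point P mate e 0 (ordS (ordS (tagged e))).
rewrite /edge_point h !scaler0 => ->; rewrite ?ordS3_neq mul0r mul1r => /esym/eqP.
by rewrite (negbTE (edge_point_neq0 P_ccw _)).
Qed.

(** The points where a square need not fill a half disc, or where more than two triangles may meet.
    They form a finite set that paths can avoid. *)
Definition bad x : Prop :=
  (exists k z, [/\ closed_square (side k) z, corner (side k) z & same (smap k z) x]) \/
  exists i j, same ((i, P i j) : rep G) x.

Lemma bad_same x y : same x y -> bad x -> bad y.
Proof.
move=> xy [[k [z [h1 h2 h3]]]|[i [j h]]].
  by left; exists k, z; split=> //; apply: same_trans xy.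
by right; exists i, j; apply: same_trans xy.
Qed.

Lemma corner_square u z : u != 0 -> corner u z ->
  exists s t : bool, z = s%:R *: u + t%:R *: rot90 u.
Proof.
move=> une /andP[h1 h2]; have N0 := dot_gt0 une.
exists (dot u z == dot u u), (cross u z == dot u u).
rewrite [LHS](square_coordinates z une); congr (_ *: _ + _ *: _).
  case/orP: h1 => /eqP ->; first by rewrite mul0r lt_eqF.
  by rewrite eqxx divff // gt_eqF.
case/orP: h2 => /eqP ->; first by rewrite mul0r lt_eqF.
by rewrite eqxx divff // gt_eqF.
Qed.

Lemma bad_finite : exists s : seq (I * (R * R)), forall x, (x \in s) = `[< bad x >].
Proof.
suff [s hs] : exists s : seq (I * (R * R)), forall x, bad x -> x \in s.
  exists [seq x <- s | `[< bad x >]] => x; rewrite mem_filter.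
  by case: asboolP => //= /hs ->.
have /choice[f hf] := same_finite tr P_ccw.
pose s1 := [seq smap c.1.1 ((nat_of_bool c.1.2)%:R *: side c.1.1 + (nat_of_bool c.2)%:R *: rot90 (side c.1.1))
   | c <- enum {: square Q * bool * bool}].
pose s2 := [seq ((c.1, P c.1 c.2) : rep G) | c <- enum {: I * 'I_3}].
exists (flatten [seq f x | x <- s1 ++ s2]) => x hx; apply/flatten_mapP.
case: hx => [[k [z [h1 h2 h3]]]|[i [j h]]].
  exists (smap k z); last exact: hf.
  have [s [t zE]] := corner_square (side_neq0 k) h2.
  rewrite mem_cat; apply/orP; left; apply/mapP; exists (k, s, t); rewrite ?mem_enum //.
  by rewrite zE.
exists (i, P i j); last exact: hf.
rewrite mem_cat; apply/orP; right; apply/mapP; exists (i, j); rewrite ?mem_enum //.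
Qed.

Lemma in_tri_edge_dir e t v : in_tri P (tag e) ((epoint e t).2 + v) ->
  0 <= cross (edge_vec (G := G) e) v.
Proof.
move=> /(_ (tagged e)); congr (0 <= _).
have := edge_fun_edge_point P mate e t (tagged e); rewrite eqxx /edge_fun => e0.
rewrite -[RHS]add0r -e0 /edge_vec /edge_src /edge_tgt /cross /=; ring.
Qed.

(* The witness d is the direction of an edge through x, if there is one. *)
Lemma direction_cell x : in_tri P x.1 x.2 -> ~ bad x ->
  exists2 d, d != 0 & forall v j r j' r', cross d v != 0 ->
    same x (j, r) -> same x (j', r') -> in_tri P j (r + v) -> in_tri P j' (r' + v) ->
    (j, r) = (j', r').
Proof.
move=> hx nbx; have [inx|[k [t [t01 xE]]]] := in_tri_boundary hx.
  exists (1, 0); first by apply/eqP => -[/eqP]; rewrite oner_eq0.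
  by move=> v j r j' r' _ /same_inside -> // /same_inside -> //.
set e := existT _ _ _ in xE; rewrite -surjective_pairing in xE.
exists (edge_vec (G := G) e); first exact: edge_vec_neq0.
have t0 : t != 0.
  apply/eqP => t0; apply: nbx; right; exists x.1, k.
  rewrite xE /edge_point t0 scale0r addr0; exact: same_refl.
have t1 : t != 1.
  apply/eqP => t1; apply: nbx; right; exists x.1, (ordS k).
  rewrite xE /edge_point t1 scale1r /edge_vec addrC subrK; exact: same_refl.
have {}t01 : 0 < t < 1 by case/andP: t01 => a b; rewrite !lt_neqAle a b eq_sym t0 t1.
have onedge := in_tri_edge_dir.
have vm v : cross (edge_vec (G := G) (mate e)) v = - cross (edge_vec (G := G) e) v.
  by rewrite [edge_vec (G := G) (mate e)](tr.2 e) /cross /=; ring.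
move=> v j r j' r' cv; rewrite xE => h h'.
have hE : (j, r) = epoint e t \/ (j, r) = epoint (mate e) (1 - t).
  exact: same_edge_point t01 h.
have hE' : (j', r') = epoint e t \/ (j', r') = epoint (mate e) (1 - t).
  exact: same_edge_point t01 h'.
(* The two triangles lie on opposite sides of the edge, so a direction transversal to it points into
   only one of them. *)
case: hE hE' => hE [] hE'; rewrite ?hE ?hE' //;
  have [-> ->] := pair_split hE; have [-> ->] := pair_split hE' => a b;
  exfalso; have := onedge _ _ _ a; have := onedge _ _ _ b; rewrite vm => *;
  by case/eqP: cv; lra.
Qed.

Lemma square_germ k z x v : closed_square (side k) z -> same (smap k z) x ->
  (exists2 d : R, 0 < d & forall s, 0 < s < d -> open_square (side k) (z + s *: v)) ->
  exists2 d : R, 0 < d & forall s, 0 < s < d ->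
   open_square (side k) (z + s *: v) /\
   exists j r, [/\ same x (j, r), same (smap k (z + s *: v)) (j, r + s *: v) &
                   in_tri P j (r + s *: v)].
Proof.
move=> sqz zx [d d0 hd]; have [e e0 he] := square_local sqz.
exists (Num.min d (e / (`|v| + 1))); first by rewrite lt_min d0 divr_gt0 ?ltr_wpDl.
move=> s /andP[s0]; rewrite lt_min => /andP[sd]; rewrite ltr_pdivlMr ?ltr_wpDl // => se.
have sq : open_square (side k) (z + s *: v) by apply: hd; rewrite s0.
split=> //; have [|j [r [h1 h2 h3]]] := he _ (open_square_closed sq).
  rewrite addrAC subrr add0r prod_norm_scale gtr0_norm //.
  by apply: le_lt_trans se; rewrite ler_pM2l // lerDl.
rewrite addrAC subrr add0r in h2 h3.
exists j, r; split=> //; first exact: same_trans (same_sym zx) h1.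
by have := h3 1; rewrite ler01 lexx scale1r => /(_ isT) /(convex_hull3P _ (P_ccw j)).
Qed.

(** The half discs of two squares that are not aligned share an open set of directions. A short move
    in such a direction, transversal to a possible edge, ends in a single triangle and hence at a
    common interior point of the two squares. *)
Lemma squares_aligned k l z z' x : in_tri P x.1 x.2 -> ~ bad x ->
  closed_square (side k) z -> closed_square (side l) z' ->
  same (smap k z) x -> same (smap l z') x -> aligned (side k) (side l).
Proof.
move=> inx nbx sqz sqz' zx zx'; apply: contrapT => na.
have ncz : ~~ corner (side k) z.
  by apply/negP => c; apply: nbx; left; exists k, z.
have ncz' : ~~ corner (side l) z'.
  by apply/negP => c; apply: nbx; left; exists l, z'.
have [n [hn gn]] := half_germ (side_neq0 k) sqz ncz.
have [n' [hn' gn']] := half_germ (side_neq0 l) sqz' ncz'.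
have [d d0 hd] := direction_cell inx nbx.
have [v [/gn gv /gn' gv' cv]] := common_direction (not_aligned_cross na hn hn') d0.
have [a a0 ha] := square_germ sqz zx gv.
have [b b0 hb] := square_germ sqz' zx' gv'.
have [s /andP[s0]] : exists s, 0 < s < Num.min a b.
  by exists (Num.min a b / 2); rewrite divr_gt0 ?ltr_pdivrMr ?ltr_pMr ?lt_min ?a0 ?b0 ?ltr1n.
rewrite lt_min => /andP[sa sb].
have [|o1 [j [r [h1 h2 h3]]]] := ha s; first by rewrite s0.
have [|o2 [j' [r' [h1' h2' h3']]]] := hb s; first by rewrite s0.
have cs : cross d (s *: v) != 0.
  have -> : cross d (s *: v) = s * cross d v by rewrite scale_pairE /cross /=; ring.
  by rewrite mulf_neq0 // gt_eqF.
have [jj rr] := pair_split (hd _ _ _ _ _ cs h1 h1' h3 h3').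
rewrite jj rr in h2; have [kl _] := square_disjoint o1 o2 (same_trans h2 (same_sym h2')).
by apply: na; rewrite kl; apply: aligned_refl.
Qed.

End Alignment.

Section Alignment.
Variables (R : realType) (I : finType) (P : I -> 'I_3 -> R * R).
Variable mate : {i : I & 'I_3} -> {i : I & 'I_3}.
Local Notation G := (tri_surface P mate).
Hypothesis tr : glued_by_translations G.
Hypothesis P_ccw : forall i, ccw (P i).
Variable Q : square_decomposition G.
Implicit Types (i : I) (e : {i : I & 'I_3}) (p : R * R) (t : R) (x y : rep G).
Implicit Types (k l : square Q) (z v : R * R).
Local Notation epoint := (@edge_point R I P mate).
Local Notation smap k z := (square_map k z : rep G).
Local Notation bad := (bad Q).

Lemma inside_cover i p : inside (P i) p -> exists k z,
  [/\ closed_square (side k) z, same (smap k z) (i, p) & is_piece k i (z - p)].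
Proof.
move=> hin; have := is_pointP mate P_ccw i p; case=> _ /(_ (inside_in_tri hin)).
move=> /(square_cover Q)[k [z [sqz h]]]; exists k, z; split=> //.
by exists z; rewrite subKr.
Qed.

(** There are finitely many pieces, and a closed square that misses the position of [p] also misses
    a neighbourhood of it. *)
Lemma near_squares i p : in_tri P i p -> exists2 d : R, 0 < d &
  forall p', `|p' - p| < d -> inside (P i) p' -> forall k z,
    closed_square (side k) z -> same (smap k z) (i, p') ->
    exists2 z', closed_square (side k) z' & same (smap k z') (i, p).
Proof.
move=> inp; have [s [_ hs]] := pieces_finite tr P_ccw Q.
pose T (a : square Q * I * (R * R)) (d : R) := a.1.2 = i ->
  closed_square (side a.1.1) (p + a.2) \/
  forall y : R * R, `|y - (p + a.2)| <= d -> ~ closed_square (side a.1.1) y.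
have [a as_|d d0 hd] := near_all (r := s) (T := T).
  have [h|h] := pselect (closed_square (side a.1.1) (p + a.2)).
    by exists 1 => // d _ _; left.
  have [d d0 hd] := closed_square_far (side_neq0 a.1.1) h.
  by exists d => // d' dd' _; right => y hy; apply: hd; apply: le_lt_trans dd'.
exists d => // p' pp' inp' k z sqz zp'.
have as_ : (k, i, z - p') \in s.
  by rewrite hs; apply/asboolP; exists z; rewrite subKr.
have [sq|far] := hd _ _ as_ pp' erefl; last first.
  case: (far z) => //=; have -> : z - (p + (z - p')) = p' - p.
    by apply: pairE => /=; ring.
  exact: lexx.
exists (p + (z - p')) => //.
have pc : is_piece k i (z - p') by exists z; rewrite subKr.
by have := piece_same tr pc sq; rewrite /= addrK; apply.
Qed.

Variable k0 : square Q.

Definition on_aligned x : Prop := exists k z,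
  [/\ closed_square (side k) z, same (smap k z) x & aligned (side k0) (side k)].

Lemma on_aligned_same x y : same x y -> on_aligned x -> on_aligned y.
Proof.
by move=> xy [k [z [h1 h2 h3]]]; exists k, z; split=> //; apply: same_trans xy.
Qed.

Lemma on_aligned_all x k z : in_tri P x.1 x.2 -> ~ bad x -> on_aligned x ->
  closed_square (side k) z -> same (smap k z) x -> aligned (side k0) (side k).
Proof.
move=> inx nbx [l [z' [h1 h2 h3]]] sqz zx.
apply: aligned_trans (side_neq0 l) h3 _.
exact: (squares_aligned tr P_ccw inx nbx h1 sqz h2 zx).
Qed.

(** A square through a point near a given point of the segment also passes through the given point,
    and all squares through a good point are aligned with each other. *)
Lemma on_aligned_segment i p p' : inside (P i) p -> in_tri P i p' ->
  (forall t, 0 <= t <= 1 -> ~ bad (i, p + t *: (p' - p))) ->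
  on_aligned (i, p) <-> on_aligned (i, p').
Proof.
move=> inp inp' good; pose f t := p + t *: (p' - p).
have inf t : 0 <= t < 1 -> inside (P i) (f t) by move=> ?; apply: inside_segment.
have intri t : 0 <= t <= 1 -> in_tri P i (f t).
  move=> /andP[t0]; rewrite le_eqVlt => /predU1P[->|t1]; first by rewrite /f segment_end.
  by apply/inside_in_tri/inf; rewrite t0.
have local t : 0 <= t <= 1 -> exists2 d : R, 0 < d & forall s, 0 <= s < 1 ->
    `|s - t| < d -> (on_aligned (i, f s) <-> on_aligned (i, f t)).
  move=> t01; have [d d0 hd] := near_squares (intri t t01).
  have [d' d'0 hd'] := segment_close p p' d0.
  exists d' => // s s01 /hd' st.
  have s01' : 0 <= s <= 1 by case/andP: s01 => -> /ltW.
  have [k [z [h1 h2 _]]] := inside_cover (inf s s01).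
  have [z' h1' h2'] := hd _ st (inf s s01) k z h1 h2.
  split=> h.
    exists k, z'; split=> //.
    exact: (@on_aligned_all (i, f s) _ _ (intri s s01') (good s s01') h h1 h2).
  exists k, z; split=> //.
  exact: (@on_aligned_all (i, f t) _ _ (intri t t01) (good t t01) h h1' h2').
(* Taking [T] to be the identity or the negation gives the two directions of the equivalence. *)
have ind (T : Prop -> Prop) : (forall A B : Prop, (A <-> B) -> T A -> T B) ->
    T (on_aligned (i, p)) -> T (on_aligned (i, p')).
  move=> hT h0; rewrite -[p'](segment_end p); apply: (real_induction (P := fun t => T (on_aligned (i, f t)))).
    by rewrite /f segment_start.
  move=> t t01; have [d d0 hd] := local t t01.
  (* The end [p'] may be on the boundary and [local] needs [s < 1], so the neighbourhood of any
     other parameter is made to exclude 1. *)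
  exists (if t == 1 then d else Num.min d (1 - t)).
    case: eqP => // /eqP t1; rewrite lt_min d0 subr_gt0 lt_neqAle t1.
    by case/andP: t01.
  move=> s s01 sd; have s1 : s != t -> s < 1.
    move: sd; case: eqP => [-> _ s1|_]; first by rewrite lt_neqAle s1; case/andP: s01.
    by rewrite lt_min => /andP[_]; rewrite ltr_norml => /andP[_ ?] _; lra.
  have {}sd : `|s - t| < d by move: sd; case: eqP => // _; rewrite lt_min => /andP[].
  have iff : s != t -> (on_aligned (i, f s) <-> on_aligned (i, f t)).
    by move=> /s1 s1'; apply: hd => //; rewrite s1' andbT; case/andP: s01.
  split=> [/lt_eqF/negbT/iff[h1 h2]|/gt_eqF/negbT/iff[h1 h2]]; exact: hT.
split; first by apply: (ind id) => A B [].
apply: contraPP; apply: (ind not) => A B [h1 h2] nA hB; exact/nA/h2.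
Qed.

Lemma inside_near i p : inside (P i) p -> exists2 d : R, 0 < d &
  forall p', `|p' - p| < d -> inside (P i) p'.
Proof.
move=> /insideP hp.
have efE j (y : R * R) : edge_fun (P i) j y = cross (P i (ordS j) - P i j) y +
    - cross (P i (ordS j) - P i j) (P i j) by rewrite /edge_fun /cross /=; ring.
pose T (j : 'I_3) (d : R) := forall p', `|p' - p| <= d -> 0 < edge_fun (P i) j p'.
have [j _|d d0 hd] := near_all (r := enum 'I_3) (T := T).
  have := hp j; rewrite efE => /cross_pos_near[d d0 hd]; exists d => // d' dd' p' pp'.
  by rewrite efE; apply: hd; apply: le_lt_trans dd'.
exists d => // p' pp'; apply/insideP => j.
by apply: (hd j _ _ pp'); rewrite ?mem_enum.
Qed.

Definition centre i : R * R := 3^-1 *: (P i 0 + P i 1 + P i 2).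

Lemma inside_centre i : inside (P i) (centre i).
Proof.
apply/insideP => j; have := P_ccw i; rewrite /ccw => D0.
have -> : edge_fun (P i) j (centre i) = 3^-1 * cross (P i 1 - P i 0) (P i 2 - P i 1).
  by elim/ord3_ind: j; rewrite /edge_fun /centre !ordS3E scale_pairE /cross /=; field.
by rewrite mulr_gt0 ?invr_gt0.
Qed.

(** A detour over a point [m] near the centre that is on none of the finitely many lines joining [p]
    or [p'] to a bad point of the triangle. *)
Lemma on_aligned_tri i p p' : in_tri P i p -> in_tri P i p' ->
  ~ bad (i, p) -> ~ bad (i, p') -> on_aligned (i, p) <-> on_aligned (i, p').
Proof.
move=> inp inp' gp gp'; have [B hB] := bad_finite tr P_ccw Q.
have badP x : bad x <-> x \in B by rewrite hB; split=> /asboolP.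
pose r := [seq (b.2 : R * R, q) | b <- [seq b <- B | b.1 == i], q <- [:: p; p']].
have [d d0 hd] := inside_near (inside_centre i).
pose w (c : (R * R) * (R * R)) := c.1 - c.2.
have wn c : c \in r -> w c != 0.
  move=> /allpairsP[[[i' b] q] /= [h1 hq ->]] /=; move: h1.
  rewrite mem_filter => /andP[/= /eqP -> bB].
  rewrite /w subr_eq0 /=; apply/eqP => bq.
  move: hq; rewrite -bq !inE => /orP[] /eqP e; [apply: gp|apply: gp']; apply/badP;
    by rewrite -e.
have [m /hd inm hm] := avoid_lines (fun c => - cross (w c) c.2) (centre i) d0 wn.
have seg q : q \in [:: p; p'] -> ~ bad (i, q) -> forall t, 0 <= t <= 1 ->
    ~ bad (i, m + t *: (q - m)).
  move=> qpp gq t t01 /badP bB.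
  have bq : (m + t *: (q - m), q) \in r.
    apply/allpairsP; exists ((i, m + t *: (q - m)), q).
    by rewrite mem_filter /= eqxx bB.
  case/eqP: (hm _ bq); rewrite /w scale_pairE /cross /=; ring.
have inq q : q \in [:: p; p'] -> ~ bad (i, q) -> in_tri P i q ->
    on_aligned (i, m) <-> on_aligned (i, q).
  by move=> qpp gq inq; apply: on_aligned_segment => //; apply: seg.
have h1 := inq p (mem_head _ _) gp inp.
have h2 : on_aligned (i, m) <-> on_aligned (i, p') by apply: inq; rewrite ?inE ?eqxx ?orbT.
by split=> [/h1/h2|/h2/h1].
Qed.

Lemma good_edge_point e : exists t, 0 < t < 1 /\ ~ bad (epoint e t).
Proof.
have [B hB] := bad_finite tr P_ccw Q.
have : almost_all (fun t : R => forall b, b \in B -> epoint e t <> b).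
  apply: almost_all_seq => b _.
  have [[t0 tb]|nt] := pselect (exists t0, epoint e t0 = b); last first.
    by apply: almost_allW => t tb; apply: nt; exists t.
  exists [:: t0; 0; 1] => t; rewrite !inE !negb_or => /and3P[n0 n1 n2]; rewrite -tb.
  move=> /(edge_point_inj P_ccw)[[_ /eqP]|/andP[]]; first by rewrite (negbTE n0).
  by rewrite (negbTE n1) (negbTE n2).
move=> /almost_all_ex /(_ ltr01)[t t01 ht]; exists t; split=> // bt.
by apply: (ht (epoint e t)) => //; rewrite hB; apply/asboolP.
Qed.

Lemma in_tri_edge_point e t : 0 <= t <= 1 -> in_tri P (tag e) (epoint e t).2.
Proof.
move=> /andP[t0 t1] j; rewrite edge_fun_edge_point; case: eqP => // _.
have := P_ccw (tag e); rewrite /ccw => D0.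
by case: eqP => _; rewrite mulr_ge0 ?(ltW D0) // subr_ge0.
Qed.

Lemma glued_mate e t : 0 <= t <= 1 ->
  glued (epoint e t) (epoint (mate e) (1 - t)).
Proof.
move=> t01; exists e, t; split=> //; congr pair.
have -> : edge_vec (G := G) e = - edge_vec (G := G) (mate e).
  by rewrite [RHS](congr1 -%R (tr.2 e)) opprK.
by rewrite /edge_vec; apply: pairE; rewrite !scale_pairE /=; ring.
Qed.

Definition tri_aligned i : Prop :=
  forall p, in_tri P i p -> ~ bad (i, p) -> on_aligned (i, p).

Lemma tri_aligned_mate e : tri_aligned (tag e) -> tri_aligned (tag (mate e)).
Proof.
move=> he p inp gp; have [t [t01 gt]] := good_edge_point e.
have t01' : 0 <= t <= 1 by case/andP: t01 => a b; rewrite !ltW.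
have t01'' : 0 <= 1 - t <= 1 by case/andP: t01' => a b; apply/andP; split; lra.
have g : same (epoint e t) (epoint (mate e) (1 - t)).
  exact/rst_step/glued_mate.
have h : on_aligned (epoint e t) by apply: he => //; apply: in_tri_edge_point.
have := on_aligned_same g h.
apply: (iffLR (on_aligned_tri _ inp _ gp)); first exact: in_tri_edge_point.
by move=> b; apply: gt; apply: bad_same (same_sym g) b.
Qed.

Lemma good_open_point k : exists z, open_square (side k) z /\ ~ bad (smap k z).
Proof.
have [B hB] := bad_finite tr P_ccw Q.
pose z t := t *: side k + t *: rot90 (side k).
have zo t : 0 < t < 1 -> open_square (side k) (z t) by exists t, t.
have zi t s : z t = z s -> t = s.
  move=> /(congr1 (dot (side k))); rewrite !dot_comb; apply: mulIf.
  by rewrite gt_eqF // dot_gt0 // side_neq0.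
have : almost_all (fun t : R => forall b, b \in B -> 0 < t < 1 ->
    ~ same (smap k (z t)) b).
  apply: almost_all_seq => b _.
  have [[t0 [t01 tb]]|nt] := pselect (exists t0, 0 < t0 < 1 /\ same (smap k (z t0)) b).
    apply: almost_allS (almost_all_neq t0) => t /eqP tt0 ht tb'; apply: tt0.
    by have [_ /zi] := square_disjoint (zo _ ht) (zo _ t01) (same_trans tb' (same_sym tb)).
  by apply: almost_allW => t ht tb; apply: nt; exists t.
move=> /almost_all_ex /(_ ltr01)[t t01 ht]; exists (z t); split; first exact: zo.
move=> bt; apply: (ht (smap k (z t))) => //; last exact: same_refl.
by rewrite hB; apply/asboolP.
Qed.

Lemma all_aligned k : glued_connected G -> aligned (side k0) (side k).
Proof.
move=> conn; have [z [zo zg]] := good_open_point k0.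
have [z' [zo' zg']] := good_open_point k.
have pt l w : open_square (side l) w -> in_tri P (smap l w).1 (smap l w).2.
  move=> /open_square_closed /(square_point (s := Q)) /(is_pointP mate P_ccw).
  by rewrite /is_point; apply.
have h0 : on_aligned (smap k0 z).
  exists k0, z; split; [exact: open_square_closed|exact: same_refl|exact: aligned_refl].
have t0 : tri_aligned (smap k0 z).1.
  move=> p inp gp; apply: (iffLR (on_aligned_tri (pt _ _ zo) inp _ gp)).
    by move: zg; case: (smap k0 z).
  by move: h0; case: (smap k0 z).
have /connectP[s hs se] := conn (smap k0 z).1 (smap k z').1.
have : tri_aligned (smap k z').1.
  rewrite se; elim: s (smap k0 z).1 t0 hs {se} => [|b s IH] a ta //=.
  move=> /andP[/existsP[e /andP[/eqP ea /eqP eb]] hs]; apply: IH hs.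
  by rewrite -eb; apply: tri_aligned_mate; rewrite ea.
move=> h; apply: (@on_aligned_all (smap k z') _ z') => //.
- exact: pt.
- by move: h => /(_ (smap k z').2 (pt _ _ zo')); move: zg'; case: (smap k z') => i p gp; apply.
- exact: open_square_closed.
- exact: same_refl.
Qed.

End Alignment.

(** * From square decompositions to tilings *)

Section Frame.
Variables (R : realType) (w : R * R).
Hypothesis w0 : w != 0.
Implicit Types (u v z : R * R).

(** A similarity whose ratio is the length of [w], not an isometry: no square root is needed, and
    all side lengths are multiplied by the same factor. *)
Definition frame v : R * R := (dot w v, cross w v).
Definition frame_inv v : R * R :=
  (dot w w)^-1 *: (v.1 *: w + v.2 *: rot90 w).

Let N0 := dot_gt0 w0.
Let Nn : dot w w != 0. Proof. by rewrite gt_eqF. Qed.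

Lemma frameD u v : frame (u + v) = frame u + frame v.
Proof. by apply: pairE; rewrite /frame /dot /cross /=; ring. Qed.

Lemma frameN u : frame (- u) = - frame u.
Proof. by apply: pairE; rewrite /frame /dot /cross /=; ring. Qed.

Lemma frameB u v : frame (u - v) = frame u - frame v.
Proof. by rewrite frameD frameN. Qed.

Lemma frameZ t v : frame (t *: v) = t *: frame v.
Proof. by apply: pairE; rewrite !scale_pairE /frame /dot /cross /=; ring. Qed.

Lemma frame_invK v : frame (frame_inv v) = v.
Proof.
move: Nn; rewrite /dot => Nn'.
by apply: pairE; rewrite /frame_inv !scale_pairE /frame /dot /cross /rot90 /=; field.
Qed.

Lemma cross_frame u v : cross (frame u) (frame v) = dot w w * cross u v.
Proof. by rewrite /frame /dot /cross /=; ring. Qed.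

Lemma frame_edge_fun (P : 'I_3 -> R * R) j p :
  edge_fun (frame \o P) j (frame p) = dot w w * edge_fun P j p.
Proof. by rewrite /edge_fun /= -!frameB cross_frame. Qed.

Lemma frame_inside (P : 'I_3 -> R * R) p :
  inside (frame \o P) (frame p) = inside P p.
Proof. by apply: eq_forallb => j; rewrite frame_edge_fun pmulr_rgt0. Qed.

Definition in_box (m : R * R) (l : R) (p : R * R) :=
  (m.1 <= p.1 <= m.1 + l) && (m.2 <= p.2 <= m.2 + l).
Definition in_open_box (m : R * R) (l : R) (p : R * R) :=
  (m.1 < p.1 < m.1 + l) && (m.2 < p.2 < m.2 + l).

Lemma scaled_interval (c x : R) : c != 0 ->
  (0 <= c * x <= c ^+ 2) = (Num.min 0 c <= x <= Num.min 0 c + `|c|) /\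
  (0 < c * x < c ^+ 2) = (Num.min 0 c < x < Num.min 0 c + `|c|).
Proof.
rewrite neq_lt expr2 => /orP[] c0.
  rewrite (min_idPr (ltW c0)) ltr0_norm // subrr.
  by rewrite nmulr_rge0 // nmulr_rgt0 // ler_nM2l // ltr_nM2l // andbC [_ && (_ < 0)]andbC.
rewrite (min_idPl (ltW c0)) gtr0_norm // add0r.
by rewrite pmulr_rge0 // pmulr_rgt0 // ler_pM2l // ltr_pM2l.
Qed.

(** In the frame the sides of the square are [(a, b)] and [(- b, a)], with [a = 0] or [b = 0]. The
    minima with 0 give the lower left corner whatever the signs are. *)
Lemma aligned_square_box u : u != 0 -> aligned w u ->
  exists m l, [/\ 0 < l, forall z, closed_square u z <-> in_box m l (frame z) &
    forall z, open_square u z <-> in_open_box m l (frame z)].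
Proof.
move=> u0 al; pose a := dot w u; pose b := cross w u.
have id1 z : dot w w * dot u z = a * (frame z).1 + b * (frame z).2.
  by rewrite /a /b /frame /dot /cross /=; ring.
have id2 z : dot w w * cross u z = a * (frame z).2 - b * (frame z).1.
  by rewrite /a /b /frame /dot /cross /=; ring.
have id3 : dot w w * dot u u = a ^+ 2 + b ^+ 2 by rewrite /a /b /dot /cross; ring.
have clE z : closed_square u z <-> (0 <= dot w w * dot u z <= dot w w * dot u u) &&
    (0 <= dot w w * cross u z <= dot w w * dot u u).
  by rewrite !pmulr_rge0 // !ler_pM2l //; apply: closed_squareP.
have opE z : open_square u z <-> (0 < dot w w * dot u z < dot w w * dot u u) &&
    (0 < dot w w * cross u z < dot w w * dot u u).
  by rewrite !pmulr_rgt0 // !ltr_pM2l //; apply: open_squareP.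
have D0 : a ^+ 2 + b ^+ 2 != 0 by rewrite -id3 mulf_neq0 // gt_eqF // dot_gt0.
case: al => [a0|b0].
  have {}a0 : a = 0 by [].
  have bn : b != 0 by apply: contra D0 => /eqP ->; rewrite a0 expr0n /= addr0.
  have bn' : - b != 0 by rewrite oppr_eq0.
  exists (Num.min 0 (- b), Num.min 0 b), `|b|; split=> [|z|z]; first by rewrite normr_gt0.
    rewrite clE id1 id2 id3 a0 !mul0r expr0n /= !add0r -mulNr.
    have [-> _] := scaled_interval (frame z).2 bn.
    rewrite -[b ^+ 2]sqrrN; have [-> _] := scaled_interval (frame z).1 bn'.
    by rewrite normrN andbC.
  rewrite opE id1 id2 id3 a0 !mul0r expr0n /= !add0r -mulNr.
  have [_ ->] := scaled_interval (frame z).2 bn.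
  rewrite -[b ^+ 2]sqrrN; have [_ ->] := scaled_interval (frame z).1 bn'.
  by rewrite normrN andbC.
have {}b0 : b = 0 by [].
have an : a != 0 by apply: contra D0 => /eqP ->; rewrite b0 expr0n /= addr0.
exists (Num.min 0 a, Num.min 0 a), `|a|; split=> [|z|z]; first by rewrite normr_gt0.
  rewrite clE id1 id2 id3 b0 !mul0r expr0n /= !addr0 subr0.
  have [-> _] := scaled_interval (frame z).1 an.
  by have [-> _] := scaled_interval (frame z).2 an.
rewrite opE id1 id2 id3 b0 !mul0r expr0n /= !addr0 subr0.
have [_ ->] := scaled_interval (frame z).1 an.
by have [_ ->] := scaled_interval (frame z).2 an.
Qed.

End Frame.

(** * The tiling by pieces *)

Section Tiling.
Variables (R : realType) (I : finType) (P : I -> 'I_3 -> R * R).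
Variable mate : {i : I & 'I_3} -> {i : I & 'I_3}.
Local Notation G := (tri_surface P mate).
Hypothesis tr : glued_by_translations G.
Hypothesis P_ccw : forall i, ccw (P i).
Variable Q : square_decomposition G.
Variable w : R * R.
Hypothesis w0 : w != 0.
Implicit Types (i : I) (e : {i : I & 'I_3}) (p : R * R) (t : R) (x y : rep G).
Implicit Types (k l : square Q) (z v : R * R).
Local Notation epoint := (@edge_point R I P mate).
Local Notation smap k z := (square_map k z : rep G).
Local Notation frame := (frame w).
Local Notation frame_inv := (frame_inv w).

Variables (m : square Q -> R * R) (ell : square Q -> R).
Hypothesis ell_gt0 : forall k, 0 < ell k.
Hypothesis closed_box : forall k z,
  closed_square (side k) z <-> in_box (m k) (ell k) (frame z).
Hypothesis open_box : forall k z,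
  open_square (side k) z <-> in_open_box (m k) (ell k) (frame z).

Variable s : seq (square Q * I * (R * R)).
Hypothesis hs : forall a, (a \in s) = `[< is_piece a.1.1 a.1.2 a.2 >].

Let FP i j : R * R := frame (P i j).
Let ti (a : seq_sub s) : I := (ssval a).1.2.
Let sq (a : seq_sub s) : square Q := (ssval a).1.1.
Let tau (a : seq_sub s) : R * R := (ssval a).2.
Let c (a : seq_sub s) : R * R := m (sq a) - frame (tau a).

Let pieceP a : is_piece (sq a) (ti a) (tau a).
Proof. by apply/asboolP; rewrite -hs ssvalP. Qed.

Let piece_ext a b : sq a = sq b -> ti a = ti b -> tau a = tau b -> a = b.
Proof.
case: a b => [[[? ?] ?] ?] [[[? ?] ?] ?]; rewrite /sq /ti /tau /= => e1 e2 e3.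
by apply: val_inj => /=; rewrite e1 e2 e3.
Qed.

Let insideE i p : inside (FP i) (frame p) = inside (P i) p.
Proof. exact: frame_inside. Qed.

Lemma piece_box a p :
  ((c a).1 <= (frame p).1 <= (c a).1 + ell (sq a)) &&
  ((c a).2 <= (frame p).2 <= (c a).2 + ell (sq a)) =
  in_box (m (sq a)) (ell (sq a)) (frame (p + tau a)).
Proof.
rewrite /in_box frameD /c /=; congr (_ && _); apply/idP/idP => /andP[? ?];
  apply/andP; split; lra.
Qed.

Lemma piece_open_box a p :
  ((c a).1 < (frame p).1 < (c a).1 + ell (sq a)) &&
  ((c a).2 < (frame p).2 < (c a).2 + ell (sq a)) =
  in_open_box (m (sq a)) (ell (sq a)) (frame (p + tau a)).
Proof.
rewrite /in_open_box frameD /c /=; congr (_ && _); apply/idP/idP => /andP[? ?];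
  apply/andP; split; lra.
Qed.

(* The steps from z to nearby points of the square use finitely many
   representatives of z; most of the nearby points are not on an edge. *)
Lemma square_in_piece k z : open_square (side k) z ->
  exists a, sq a = k /\ in_tri P (ti a) (z - tau a).
Proof.
move=> zo; have zc := open_square_closed zo.
have [d d0 hd] := square_local zc.
have [B hB] := same_finite tr P_ccw (smap k z).
have [d' d'0 hd'] := open_square_near (side_neq0 k) zo.
pose r := [seq (b, j) | b <- B, j <- enum 'I_3].
pose f (bj : (I * (R * R)) * 'I_3) := P bj.1.1 (ordS bj.2) - P bj.1.1 bj.2.
have fn bj : bj \in r -> f bj != 0.
  by move=> _; have := edge_vec_neq0 mate P_ccw (existT _ bj.1.1 bj.2).
have dd : 0 < Num.min d d' by rewrite lt_min d0.
have [y] := avoid_lines (fun bj => cross (f bj) (bj.1.2 - z - P bj.1.1 bj.2)) z dd fn.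
rewrite lt_min => /andP[yd /hd' yo] hy.
have [i [p [h1 h2 h3]]] := hd y (open_square_closed yo) yd.
have intri t : 0 <= t <= 1 -> in_tri P i (p + t *: (y - z)).
  by move=> /h3 /(convex_hull3P _ (P_ccw i)).
have ins : inside (P i) (y - (z - p)).
  apply/insideP => j; have -> : y - (z - p) = p + 1 *: (y - z).
    by apply: pairE; rewrite scale_pairE /=; ring.
  rewrite lt_neqAle intri ?ler01 ?lexx // andbT eq_sym.
  have : ((i, p), j) \in r.
    by apply/allpairsP; exists ((i, p), j); rewrite mem_enum hB.
  move=> /hy; congr (~~ (_ == _)).
  by rewrite /f /edge_fun scale_pairE /cross /=; ring.
have as_ : (k, i, z - p) \in s.
  rewrite hs; apply/asboolP; exists y; split=> //; first exact: open_square_closed.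
  by have -> : y - (z - p) = p + (y - z) by apply: pairE => /=; ring.
exists (SeqSub as_); split=> //.
rewrite /tau /ti /= subKr; have := intri 0; rewrite scale0r addr0 lexx ler01.
exact.
Qed.

Lemma piece_point a p : closed_square (side (sq a)) (p + tau a) ->
  in_tri P (ti a) p -> same (smap (sq a) (p + tau a)) (ti a, p).
Proof.
move=> h1 h2; have := piece_same tr (pieceP a) h1; rewrite addrK; exact.
Qed.

Let vert sg : R * R := frame_inv (0, sg).

Let frame_vert z (r sg : R) : frame (z + r *: vert sg) =
  ((frame z).1, (frame z).2 + r * sg).
Proof.
rewrite frameD frameZ frame_invK //.
by apply: pairE; rewrite scale_pairE /= ?mulr0 ?addr0.
Qed.

Lemma vertical_germ k z (sg : R) :
  (m k).1 < (frame z).1 < (m k).1 + ell k ->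
  (m k).2 <= (frame z).2 <= (m k).2 + ell k ->
  ((frame z).2 = (m k).2 -> 0 < sg) -> ((frame z).2 = (m k).2 + ell k -> sg < 0) ->
  exists2 d : R, 0 < d & forall r, 0 < r < d -> open_square (side k) (z + r *: vert sg).
Proof.
move=> hx hy h0 h1; have := @itv_germ R ((frame z).2 - (m k).2) sg (ell k).
case=> [||h|h|d d0 hd].
- by move: hy => /andP[? ?]; apply/andP; split; lra.
- exact: ell_gt0.
- by apply: h0; lra.
- by apply: h1; lra.
exists d => // r /hd hr; apply/open_box; rewrite frame_vert.
move: hx hr; case: (frame z) => X Y /= hx /andP[? ?]; rewrite /in_open_box /= hx /=.
by apply/andP; split; lra.
Qed.

(** A triangle lies to the left of its edges, so upward motion leaves it through an edge that runs
    to the left and downward motion through one that runs to the right. *)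
Lemma vertical_leaves e t (r sg : R) : 0 < r ->
  ((frame (edge_tgt (G := G) e)).1 - (frame (edge_src (G := G) e)).1) * sg < 0 ->
  ~ in_tri P (tag e) ((epoint e t).2 + r *: vert sg).
Proof.
move=> r0 h /in_tri_edge_dir; rewrite -(pmulr_rge0 _ (dot_gt0 w0)) -cross_frame.
rewrite /edge_vec frameB frameZ frame_invK // scale_pairE /cross /= !mulr0 subr0.
by rewrite mulrCA pmulr_rge0 // leNgt h.
Qed.

Lemma frame_edge_point e t : frame (epoint e t).2 =
  src FP e + t *: (tgt FP e - src FP e).
Proof. by rewrite /edge_vec frameD frameZ frameB. Qed.

Lemma frame_mate_point e t :
  frame (epoint (mate e) (1 - t)).2 = frame (epoint e t).2 + trans FP mate e.
Proof.
have vm : edge_vec (G := G) e = - edge_vec (G := G) (mate e).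
  by rewrite [RHS](congr1 -%R (tr.2 e)) opprK.
have -> : trans FP mate e = frame (edge_tgt (G := G) (mate e) - edge_src (G := G) e).
  by rewrite frameB.
rewrite -frameD; congr frame; rewrite /edge_point vm /= /edge_vec.
by apply: pairE; rewrite !scale_pairE /=; ring.
Qed.

(** If the top of [a] is not on the edge, both squares extend upwards from the crossing point, hence
    they are one square at one position. If it is and the bottom of [b] were not, both would extend
    downwards and again coincide, although one point is on the top side and the other strictly below
    it. *)
Lemma tiling_edge_crossing e (a b : seq_sub s) (x : R) :
  touch_up FP ti sq c ell a e x ->
  touch_low FP ti sq c ell b (mate e) (x + (trans FP mate e).1) ->
  (c b).2 - (c a).2 = (trans FP mate e).2 +
    len sq ell a *+ (height FP e x == (c a).2 + len sq ell a).
Proof.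
have edgeK : involutive mate by exact: tr.1.
move=> /and5P[/eqP tia ue abx ha1 ha2] /and5P[/eqP tib ue' abx' hb1 hb2].
pose t := (x - (src FP e).1) / ((tgt FP e).1 - (src FP e).1).
set S := src FP e; set T := tgt FP e; rewrite -/S -/T in t.
have [xT xS] : T.1 < x /\ x < S.1 by move/andP: ue.
have dx : T.1 - S.1 < 0 by lra.
have t01 : 0 < t < 1.
  by rewrite /t ltr_ndivlMr // ltr_ndivrMr //; apply/andP; split; lra.
have t01' : 0 <= t <= 1 by case/andP: t01 => /ltW -> /ltW ->.
have t01'' : 0 <= 1 - t <= 1 by case/andP: t01' => ? ?; apply/andP; split; lra.
have td : t * (T.1 - S.1) = x - S.1 by rewrite /t divfK // lt_eqF.
set y := height FP e x.
have fp : frame (epoint e t).2 = (x, y).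
  rewrite frame_edge_point -/S -/T; apply: pairE; rewrite scale_pairE /= ?td.
    by rewrite addrC subrK.
  rewrite /y /height /edge_height -[FP _ (ordS _)]/T -[FP _ (tagged _)]/S.
  by rewrite /t mulrA mulrAC.
have fp2 : frame (epoint (mate e) (1 - t)).2 =
    (x + (trans FP mate e).1, y + (trans FP mate e).2).
  by rewrite frame_mate_point fp.
have hm : height FP (mate e) (x + (trans FP mate e).1) = y + (trans FP mate e).2.
  apply: height_mate => // e'; rewrite /tgt /src /FP -!frameB -frameN; congr frame.
  exact: tr.2.
set p := (epoint e t).2 in fp; set p2 := (epoint (mate e) (1 - t)).2 in fp2.
have inp : in_tri P (ti a) p by rewrite tia; apply: in_tri_edge_point.
have inp2 : in_tri P (ti b) p2 by rewrite tib; apply: in_tri_edge_point.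
rewrite hm in hb1 hb2.
set z := p + tau a; set z2 := p2 + tau b.
have fz : frame z = (x + (frame (tau a)).1, y + (frame (tau a)).2).
  by rewrite frameD fp.
have fz2 : frame z2 = (x + (trans FP mate e).1 + (frame (tau b)).1,
    y + (trans FP mate e).2 + (frame (tau b)).2).
  by rewrite frameD fp2.
rewrite /above /len in abx abx' ha2 hb2 *.
have ca : c a = m (sq a) - frame (tau a) by [].
have cb : c b = m (sq b) - frame (tau b) by [].
rewrite ca cb !(fst_sub (m _)) !(snd_sub (m _)) in abx abx' ha1 ha2 hb1 hb2 *.
have fz1 : (frame z).1 = x + (frame (tau a)).1 by rewrite fz.
have fzy : (frame z).2 = y + (frame (tau a)).2 by rewrite fz.
have fz21 : (frame z2).1 = x + (trans FP mate e).1 + (frame (tau b)).1 by rewrite fz2.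
have fz2y : (frame z2).2 = y + (trans FP mate e).2 + (frame (tau b)).2 by rewrite fz2.
clear fz fz2 ca cb fp fp2 hm.
have ltB (X f l u : R) : (u < X - f + l) = (u + f < X + l).
  by rewrite addrAC ltrBrDr.
have leB (X f l u : R) : (u <= X - f + l) = (u + f <= X + l).
  by rewrite addrAC lerBrDr.
have zx : (m (sq a)).1 < (frame z).1 < (m (sq a)).1 + ell (sq a).
  by rewrite fz1 -ltrBlDr -ltB.
have z2x : (m (sq b)).1 < (frame z2).1 < (m (sq b)).1 + ell (sq b).
  by rewrite fz21 -ltB -[_ < _ + (frame (tau b)).1]ltrBlDr.
have zy : (m (sq a)).2 < (frame z).2 <= (m (sq a)).2 + ell (sq a).
  by rewrite fzy -ltrBlDr -leB ha1.
have z2y : (m (sq b)).2 <= (frame z2).2 < (m (sq b)).2 + ell (sq b).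
  by rewrite fz2y -ltB -[_ <= _ + (frame (tau b)).2]lerBlDr hb1.
have zc : closed_square (side (sq a)) z.
  by apply/closed_box; rewrite /in_box; case/andP: zx => /ltW-> /ltW->;
     case/andP: zy => /ltW-> ->.
have z2c : closed_square (side (sq b)) z2.
  by apply/closed_box; rewrite /in_box; case/andP: z2x => /ltW-> /ltW->;
     case/andP: z2y => -> /ltW->.
have sz : same (smap (sq a) z) (epoint e t).
  by have := piece_point zc inp; rewrite tia.
have sz2 : same (smap (sq b) z2) (epoint (mate e) (1 - t)).
  by have := piece_point z2c inp2; rewrite tib.
have sm : same (epoint e t) (epoint (mate e) (1 - t)).
  exact/rst_step/glued_mate.
have dxm : ((frame (edge_tgt (G := G) (mate e))).1 -
    (frame (edge_src (G := G) (mate e))).1) = S.1 - T.1.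
  have := tr.2 e => /(congr1 frame); rewrite frameN /edge_vec !frameB.
  by move=> /(congr1 fst); rewrite fst_sub => -> ; rewrite -[RHS]opprB.
(* Since [v] leaves one of the two triangles, both germs are seen in the chart of the other, where
   they end at the same point of the surface; disjointness of the squares does the rest. *)
have common v : (exists2 d : R, 0 < d & forall r, 0 < r < d ->
      open_square (side (sq a)) (z + r *: v)) ->
    (exists2 d : R, 0 < d & forall r, 0 < r < d ->
      open_square (side (sq b)) (z2 + r *: v)) ->
    (forall r, 0 < r -> ~ in_tri P (tag e) (p + r *: v)) \/
    (forall r, 0 < r -> ~ in_tri P (tag (mate e)) (p2 + r *: v)) ->
    sq a = sq b /\ z = z2.
  move=> ga gb leave.
  have [d d0 hd] := square_germ P_ccw zc sz ga.
  have [d' d'0 hd'] := square_germ P_ccw z2c sz2 gb.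
  have [r /andP[r0]] : exists r, 0 < r < Num.min d d'.
    exists (Num.min d d' / 2).
    by rewrite divr_gt0 ?ltr_pdivrMr ?ltr_pMr ?lt_min ?d0 ?d'0 ?ltr1n.
  rewrite lt_min => /andP[rd rd'].
  have [|oa [j [q [ja jb jc]]]] := hd r; first by rewrite r0.
  have [|ob [j' [q' [ja' jb' jc']]]] := hd' r; first by rewrite r0.
  suff ss : same (smap (sq a) (z + r *: v)) (smap (sq b) (z2 + r *: v)).
    by have [h1 /addIr h2] := square_disjoint oa ob ss.
  have zr : z + r *: v = p + r *: v + tau a by rewrite addrAC.
  have z2r : z2 + r *: v = p2 + r *: v + tau b by rewrite addrAC.
  case: leave => leave.
    have [h|h] := same_edge_point tr P_ccw t01 ja.
      by case: (leave r r0); have [jE qE] := pair_split h; move: jc; rewrite jE qE.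
    have [jE qE] := pair_split h.
    apply: (same_trans jb); rewrite jE qE z2r; apply: same_sym.
    rewrite -tib; apply: piece_point; first by rewrite -z2r; apply: open_square_closed.
    by move: jc; rewrite tib jE qE.
  have [h|h] := same_edge_point tr P_ccw t01 (same_trans sm ja'); last first.
    by case: (leave r r0); have [jE qE] := pair_split h; move: jc'; rewrite jE qE.
  have [jE qE] := pair_split h.
  apply: (same_trans _ (same_sym jb')); rewrite jE qE zr.
  rewrite -tia; apply: piece_point; first by rewrite -zr; apply: open_square_closed.
  by move: jc'; rewrite tia jE qE.
have zy' : (m (sq a)).2 <= (frame z).2 <= (m (sq a)).2 + ell (sq a).
  by case/andP: zy => /ltW-> ->.
have z2y' : (m (sq b)).2 <= (frame z2).2 <= (m (sq b)).2 + ell (sq b).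
  by case/andP: z2y => -> /ltW->.
rewrite -/y; case: eqP => yt.
  suff h : (frame z2).2 = (m (sq b)).2 by rewrite mulr1n; lra.
  apply/eqP/contraT => nbot; have [|||hsq hz] := common (vert (-1)).
  - apply: vertical_germ zx zy' _ _ => h; last by rewrite oppr_lt0.
    by move: zy; rewrite h ltxx.
  - apply: vertical_germ z2x z2y' _ _ => h; last by rewrite oppr_lt0.
    by move: nbot; rewrite h eqxx.
  - by right=> r r0; apply: vertical_leaves => //; rewrite dxm mulrN1; lra.
  by move: z2y; rewrite -hz -hsq => /andP[_]; lra.
have [|||hsq hz] := common (vert 1).
- apply: vertical_germ zx zy' _ _ => h; first exact: ltr01.
  by case: yt; lra.
- apply: vertical_germ z2x z2y' _ _ => h; first exact: ltr01.
  by move: z2y; rewrite h ltxx andbF.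
- by left=> r r0; apply: vertical_leaves => //; rewrite mulr1.
rewrite mulr0n addr0 hsq; move: fz2y fzy; rewrite hz => -> ?; lra.
Qed.

Lemma tiling : square_tiling FP mate ti sq c ell.
Proof.
have edgeK : involutive mate by exact: tr.1.
split.
- by move=> i; rewrite /ccw /FP -!frameB cross_frame mulr_gt0 ?dot_gt0 // P_ccw.
- exact: edgeK.
- move=> e; rewrite /tgt /src /FP -!frameB -frameN; congr frame.
  exact: tr.2.
- exact: ell_gt0.
- move=> i p; rewrite -[p](frame_invK w0) insideE => inp.
  have [k [z [h1 h2 h3]]] := inside_cover P_ccw Q inp.
  have as_ : (k, i, z - frame_inv p) \in s by rewrite hs; apply/asboolP.
  exists (SeqSub as_) => //; rewrite piece_box; apply/closed_box.
  by rewrite /sq /tau /= addrC subrK.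
- move=> a b p tiab; rewrite -[p](frame_invK w0) insideE => ina.
  rewrite /in_square !piece_open_box => /open_box oa /open_box ob.
  have inb : inside (P (ti b)) (frame_inv p) by rewrite -tiab.
  have ha := piece_point (open_square_closed oa) (inside_in_tri ina).
  have hb := piece_point (open_square_closed ob) (inside_in_tri inb).
  rewrite -tiab in hb; have [h1 h2] := square_disjoint oa ob (same_trans ha (same_sym hb)).
  by apply: piece_ext => //; apply: (addrI (frame_inv p)).
- move=> k p hp; pose z := frame_inv (m k + p).
  have zo : open_square (side k) z.
    by apply/open_box; rewrite frame_invK // /in_open_box /= !ltrDl !ltrD2l.
  have [a [sqa ina]] := square_in_piece zo; exists a => // j.
  have -> : c a + p = frame (z - tau a).
    by rewrite frameB frame_invK // /c sqa addrAC.
  by rewrite /FP frame_edge_fun pmulr_rge0 ?dot_gt0.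
- move=> a b p sqab hp; have sqab' : ell (sq b) = ell (sq a) by rewrite sqab.
  pose z := frame_inv (m (sq a) + p).
  have zo : open_square (side (sq a)) z.
    by apply/open_box; rewrite frame_invK // /in_open_box /= !ltrDl !ltrD2l.
  have aE : c a + p = frame (z - tau a).
    by rewrite frameB frame_invK // /c addrAC.
  have bE : c b + p = frame (z - tau b).
    by rewrite frameB frame_invK // /c -sqab addrAC.
  rewrite aE bE !insideE => ina inb.
  have zo' : open_square (side (sq b)) z by rewrite -sqab.
  have ha := piece_same tr (pieceP a) (open_square_closed zo) (inside_in_tri ina).
  have hb := piece_same tr (pieceP b) (open_square_closed zo') (inside_in_tri inb).
  rewrite -sqab in hb.
  have [h1 h2] := pair_split (same_inside tr (same_trans (same_sym hb) ha) inb).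
  by apply: piece_ext => //; move: h2 => /(congr1 (fun q => z - q)); rewrite !subKr.
- exact: tiling_edge_crossing.
Qed.

End Tiling.

(** * Transport of the squares and of connectedness to the triangles *)

Section Transport.
Variables (R : realType) (G H : gluing R) (f : rep G -> rep H).
Hypothesis fiso : is_translation_iso f.

Lemma square_decomposition_transport :
  square_decomposition H -> inhabited (square_decomposition G).
Proof.
move=> Q; have sq0 (k : square Q) : closed_square (side k) 0.
  by exists 0, 0; rewrite !scale0r addr0 lexx ler01.
have /choice[g hg] : forall kx : square Q * (R * R), exists y : rep G,
    closed_square (side kx.1) kx.2 -> is_point y /\ same (f y) (square_map kx.1 kx.2).
  move=> [k x] /=; have [sqx|nsq] := pselect (closed_square (side k) x).
    by have [y y1 y2] := iso_surj fiso (square_point sqx); exists y.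
  by have [y _ _] := iso_surj fiso (square_point (sq0 k)); exists y.
have gsame k x : closed_square (side k) x -> same (f (g (k, x))) (square_map k x).
  by move=> /(hg (k, x))[].
have gpoint k x : closed_square (side k) x -> is_point (g (k, x)).
  by move=> /(hg (k, x))[].
constructor; apply: (@SquareDecomposition R G (square Q) (@side R H Q) (fun k x => g (k, x))).
- exact: side_neq0.
- exact: gpoint.
- move=> k x sqx; have [e e0 he] := square_local sqx.
  have [d d0 hd] := iso_local fiso (gpoint k x sqx).
  exists (Num.min e d) => [|y sqy]; first by rewrite lt_min e0.
  rewrite lt_min => /andP[/(he y sqy) st yd]; apply/(hd _ _ yd (gpoint k y sqy)).
  by apply: step_same st; apply: same_sym; apply: gsame.
- move=> k l x y ox oy; have sx := open_square_closed ox; have sy := open_square_closed oy.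
  move=> /(iso_same fiso (gpoint k x sx) (gpoint l y sy)) h.
  apply: square_disjoint ox oy _.
  exact: same_trans (same_sym (gsame _ _ sx)) (same_trans h (gsame _ _ sy)).
- move=> z pz; have [k [x [sqx h]]] := square_cover Q (iso_point fiso pz).
  exists k, x; split=> //; apply/(iso_same fiso (gpoint k x sqx) pz).
  exact: same_trans (gsame _ _ sqx) h.
Qed.

End Transport.

Lemma ordS_stable n (C : 'I_n -> Prop) : (forall k, C k -> C (ordS k)) ->
  forall k l, C k -> C l.
Proof.
move=> hC k l Ck; have n0 : (0 < n)%N by apply: leq_ltn_trans (ltn_ord k).
have iterE m : val (iter m (@ordS n) k) = ((k + m) %% n)%N.
  elim: m => [|m IH] /=; first by rewrite addn0 modn_small.
  by rewrite IH -addn1 modnDml addn1 addnS.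
have -> : l = iter (n - k + l) (@ordS n) k.
  apply: val_inj; rewrite iterE addnA subnKC ?(ltnW (ltn_ord k)) //.
  by rewrite modnDl modn_small.
by elim: (_ + _)%N => //= m; apply: hC.
Qed.

Lemma compact_bounded2 (R : realType) (A : set (R * R)) : compact A ->
  exists M : R, forall x, A x -> `|x| <= M.
Proof.
move=> /compact_bounded [M [_ hM]]; exists (M + 1) => x Ax.
by apply: (hM (M + 1)) => //; rewrite ltrDl.
Qed.

Section Polygon.
Variables (R : realType) (n : nat) (p : 'I_n -> R * R) (A : set (R * R)).
Hypothesis poly : is_polygon p A.

Let A_closed : closed A.
Proof. exact: compact_closed (@norm_hausdorff _ _) (polygon_compact poly). Qed.

Lemma polygon_edge k x : seg (p k) (p (ordS k)) x -> A x.
Proof.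
move=> hx; have [clx _] : (closure A `\` A°) x.
  by rewrite (polygon_frontier poly); exists k.
by rewrite (closure_id A).1.
Qed.

(* Follow a ray from x up to the point where it leaves A. *)
Lemma polygon_ray x : A x -> exists b, (exists k, seg (p k) (p (ordS k)) b) /\
  forall t : R, 0 <= t <= 1 -> A (x + t *: (b - x)).
Proof.
move=> Ax; pose v : R * R := (1, 0).
pose E := [set t : R | 0 <= t /\ forall s, 0 <= s <= t -> A (x + s *: v)].
have E0 : E 0.
  split=> // s /andP[s0 s1]; have -> : s = 0 by apply/eqP; rewrite eq_le s0 s1.
  by rewrite scale0r addr0.
have [M hM] := compact_bounded2 (polygon_compact poly).
have supE : has_sup E.
  split; first by exists 0.
  exists (M + `|x|) => t [t0 ht]; have := hM _ (ht t _); rewrite t0 lexx => /(_ isT) h.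
  have := ler_normB (x + t *: v) x; rewrite addrAC subrr add0r.
  have -> : `|t *: v| = t.
    by rewrite prod_norm_scale prod_normE /= normr1 normr0 (max_idPl _) ?mulr1 ?ger0_norm.
  by move=> ?; lra.
pose m := sup E; have m0 : 0 <= m by apply: ub_le_sup => //; case: supE.
have lt_m s : 0 <= s < m -> A (x + s *: v).
  move=> /andP[s0 sm]; have [|t [t0 ht] st] := @sup_adherent _ E (m - s) _ supE.
    by rewrite subr_gt0.
  by apply: ht; rewrite s0 /= ltW //; move: st; rewrite -/m; lra.
have diff s : x + s *: v - (x + m *: v) = (s - m) *: v.
  by rewrite opprD addrACA subrr add0r scalerBl.
have nv : `|v| = 1 by rewrite prod_normE /= normr1 normr0 (max_idPl _).
have Am : A (x + m *: v).
  have [m1|m1] := eqVneq m 0; first by rewrite m1 scale0r addr0.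
  rewrite (closure_id A).1 // => B /nbhs_ballP[e /= e0 he].
  pose s := Num.max 0 (m - e / 2).
  have sm : s < m by rewrite /s gt_max lt_neqAle eq_sym m1 m0; lra.
  have s0 : 0 <= s by rewrite /s le_max lexx.
  exists (x + s *: v); split; first by apply: lt_m; rewrite s0.
  apply: he; rewrite -ball_normE /= -normrN opprB diff prod_norm_scale nv mulr1.
  have : m - e / 2 <= s by rewrite /s le_max lexx orbT.
  by rewrite ltr0_norm ?subr_lt0 // => ?; lra.
have nint : ~ A° (x + m *: v).
  move=> /nbhs_ballP[e /= e0 he].
  have : E (m + e / 2).
    split; first by rewrite addr_ge0 // ltW // divr_gt0.
    move=> s /andP[s0 sme]; have [sm|ms] := ltP s m; first by apply: lt_m; rewrite s0.
    apply: he; rewrite -ball_normE /= -normrN opprB diff prod_norm_scale nv mulr1.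
    by rewrite ger0_norm ?subr_ge0 //; lra.
  by move=> /ub_le_sup; case: supE => _ hu /(_ hu); rewrite -/m; lra.
exists (x + m *: v); split.
  have : (closure A `\` A°) (x + m *: v) by split=> //; apply: subset_closure.
  by rewrite (polygon_frontier poly) => -[k _ hk]; exists k.
move=> t /andP[t0 t1]; rewrite addrAC subrr add0r scalerA.
have : t * m <= m by rewrite ler_piMl.
rewrite le_eqVlt => /predU1P[->//|h]; apply: lt_m.
by rewrite mulr_ge0 //= h.
Qed.

(** Connectedness of the polygon without the Jordan curve theorem: a ray joins each point to the
    frontier inside [A], and the frontier is a cycle of segments. *)
Lemma polygon_locally_constant (c : R * R -> Prop) :
  (forall x, A x -> exists2 e : R, 0 < e & forall y, A y -> `|y - x| < e ->
     (forall t : R, 0 <= t <= 1 -> A (x + t *: (y - x))) -> (c x <-> c y)) ->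
  forall x y, A x -> A y -> c x -> c y.
Proof.
move=> hc.
have along x y : (forall t : R, 0 <= t <= 1 -> A (x + t *: (y - x))) -> c x -> c y.
  move=> hA cx; rewrite -[y](segment_end x).
  apply: (real_induction (P := fun t => c (x + t *: (y - x)))).
    by rewrite segment_start.
  move=> t t01; have [e e0 he] := hc _ (hA t t01).
  have [d d0 hd] := segment_close x y e0.
  exists d => // s s01 /hd st; have iff := he _ (hA s s01) st.
  have sub : forall r : R, 0 <= r <= 1 ->
      A (x + t *: (y - x) + r *: (x + s *: (y - x) - (x + t *: (y - x)))).
    move=> r r01; have -> : x + t *: (y - x) + r *: (x + s *: (y - x) - (x + t *: (y - x))) =
        x + (t + r * (s - t)) *: (y - x).
      by apply: pairE; rewrite !scale_pairE /=; ring.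
    apply: hA; move: t01 s01 r01 => /andP[? ?] /andP[? ?] /andP[? ?].
    by apply/andP; split; nra.
  by have [h1 h2] := iff sub; split.
have back x y : (forall t : R, 0 <= t <= 1 -> A (x + t *: (y - x))) -> c y -> c x.
  move=> hA; apply: along => t /andP[t0 t1].
  have -> : y + t *: (x - y) = x + (1 - t) *: (y - x).
    by apply: pairE; rewrite !scale_pairE /=; ring.
  by apply: hA; apply/andP; split; lra.
have edge k x : seg (p k) (p (ordS k)) x ->
    forall t : R, 0 <= t <= 1 -> A (p k + t *: (x - p k)).
  move=> [s /andP[s0 s1] ->] t /andP[t0 t1]; apply: (@polygon_edge k).
  exists (t * s); last by rewrite addrAC subrr add0r scalerA.
  by rewrite mulr_ge0 // mulr_ile1.
have vertices k l : c (p k) -> c (p l).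
  apply: (ordS_stable (C := fun k => c (p k))) => {k l} k; apply: along; apply: edge.
  by exists 1; rewrite ?ler01 ?lexx // segment_end.
move=> x y /polygon_ray[b [[k kb] xb]] /polygon_ray[b' [[l lb'] yb']] cx.
apply: (back _ _ yb'); apply: (along _ _ (edge _ _ lb')); apply: (vertices k).
exact: (back _ _ (edge _ _ kb) (along _ _ xb cx)).
Qed.

End Polygon.

Section Connected.
Variables (R : realType) (G : gluing R) (S : translation_surface R) (f : rep G -> rep S).
Hypothesis fiso : is_translation_iso f.
Hypothesis tr : glued_by_translations G.
Hypothesis nonempty : forall i : cell G, exists p, region G i p.

(** For a point of [S], coming from a cell that is reachable from [i0] is a locally constant
    property on each polygon and passes across the glued edges, so it spreads over all of [S]. *)
Lemma connected_transport : glued_connected G.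
Proof.
move=> i0; pose C (x : rep G) := connect [rel a b | [exists e : edge G,
  (tag e == a) && (tag (mate G e) == b)]] i0 x.1.
have Csame x y : same x y -> C x -> C y.
  apply: (same_closed tr (Q := C)) => {x y} _ _ [e [t [_ -> ->]]] h.
  apply: connect_trans h _; apply: connect1; apply/existsP; exists e.
  by rewrite !eqxx.
pose c (y : rep S) := exists x, [/\ is_point x, same (f x) y & C x].
have cP x : is_point x -> c (f x) -> C x.
  move=> px [x' [px' /(iso_same fiso px' px) xx' Cx']]; exact: (Csame _ _ xx' Cx').
have csame y y' : same y y' -> c y -> c y'.
  by move=> yy' [x [h1 h2 h3]]; exists x; split=> //; apply: same_trans yy'.
have cellc j q q' : region S j q -> region S j q' -> c (j, q) -> c (j, q').
  apply: (polygon_locally_constant (surface_polygon j) (c := fun q => c (j, q))) => {q q'} q jq.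
  have [x px xq] := iso_surj fiso (jq : is_point ((j, q) : rep S)).
  have [e e0 he] := iso_local fiso px.
  exists e => // q' jq' qe hseg.
  have [x' px' xq'] := iso_surj fiso (jq' : is_point ((j, q') : rep S)).
  have st : step (j, q) (j, q') (q' - q).
    exists j, q; split=> //; first exact: same_refl.
    by rewrite addrC subrK; apply: same_refl.
  have [i [r [h1 h2 _]]] : step x x' (q' - q).
    apply/(he _ _ qe px'); apply: step_same st; exact: same_sym.
  split=> h.
    exists x'; split=> //; apply: (Csame _ _ (same_sym h2)).
    have Cx : C x by apply: cP => //; exact: (csame _ _ (same_sym xq) h).
    exact: (Csame _ _ h1 Cx).
  exists x; split=> //; apply: (Csame _ _ (same_sym h1)).
  have Cx' : C x' by apply: cP => //; exact: (csame _ _ (same_sym xq') h).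
  exact: (Csame _ _ h2 Cx').
have vert (e : edge S) : region S (tag e) (edge_src e).
  apply: (polygon_edge (surface_polygon (tag e)) (k := tagged e)).
  by exists 0; rewrite ?lexx ?ler01 // segment_start.
have vert' (e : edge S) : region S (tag e) (edge_tgt e).
  apply: (polygon_edge (surface_polygon (tag e)) (k := tagged e)).
  by exists 1; rewrite ?lexx ?ler01 // segment_end.
have celle (e : edge S) : (forall q, region S (tag e) q -> c (tag e, q)) ->
    forall q, region S (tag (mate S e)) q -> c (tag (mate S e), q).
  move=> h q hq; apply: (cellc _ _ _ (vert' (mate S e)) hq).
  apply: (csame _ _ _ (h _ (vert e))); apply: rst_step; exists e, 0.
  by rewrite lexx ler01 !scale0r !addr0.
move=> i; have [p0 ip0] := nonempty i0; have [p ip] := nonempty i.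
have ipt : is_point ((i, p) : rep G) by [].
have c0 : c (f (i0, p0)).
  by exists (i0, p0); split=> //; [apply: same_refl|apply: connect0].
have all0 q : region S (f (i0, p0)).1 q -> c ((f (i0, p0)).1, q).
  have := @iso_point _ _ _ _ fiso (i0, p0) ip0; rewrite /is_point => h hq.
  by apply: (cellc _ _ _ h hq); move: c0; case: (f (i0, p0)).
have /connectP[s hs se] := @surface_connected _ S (f (i0, p0)).1 (f (i, p)).1.
have alli q : region S (f (i, p)).1 q -> c ((f (i, p)).1, q).
  rewrite se; elim: s (f (i0, p0)).1 all0 hs {se} q => [|b s IH] a ha //=.
  move=> /andP[/existsP[e /andP[/eqP ea /eqP eb]] hs]; apply: IH hs.
  by rewrite -eb; apply: celle; rewrite ea.
apply: (cP (i, p)) => //; have := alli _ (iso_point fiso ipt).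
by case: (f (i, p)).
Qed.

End Connected.

(** [w] is the side of one square and [l] gives the side lengths multiplied by the length of [w].
    The index [k0] is kept because sums over [K] must later be strictly positive. *)
Theorem square_form (R : realType) (S : translation_surface R)
    (T : triangulation S) (Q : square_decomposition S) :
  exists (K : finType) (k0 : K) (w : R * R) (l : K -> R), [/\ w != 0, forall k, 0 < l k &
    forall (W : comNzRingType) (B : R -> R -> W), biadditive B ->
    \sum_(i : tri T)
      (B (dot w (tri_vtx i 1 - tri_vtx i 0)) (cross w (tri_vtx i 2 - tri_vtx i 1)) -
       B (dot w (tri_vtx i 2 - tri_vtx i 1)) (cross w (tri_vtx i 1 - tri_vtx i 0))) =
    (\sum_k B (l k) (l k)) *+ 2].
Proof.
have trT := tri_translations T.
have P_ccw (i : tri T) : ccw (tri_vtx i) by exact: tri_ccw.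
have [Q'] := square_decomposition_transport (tri_iso T) Q.
change (square_decomposition (tri_surface (@tri_vtx _ _ T) (@tri_mate _ _ T))) in Q'.
have vpt (i : tri T) : inside (tri_vtx i) (centre (@tri_vtx _ _ T) i).
  exact: inside_centre.
have conn : glued_connected (tri_gluing T).
  apply: (connected_transport (tri_iso T) trT) => i.
  exists (centre (@tri_vtx _ _ T) i).
  exact/(convex_hull3P _ (P_ccw i))/inside_in_tri.
have [k0 _] : exists k0 : square Q', True.
  have [j _] : exists j : cell S, True.
    have := surface_nonempty S; rewrite lt0n => /eqP; case: (pickP (fun _ : cell S => true)).
      by move=> j _ _; exists j.
    by move=> h0; rewrite eq_card0.
  have [q Aq] := polygon_interior (surface_polygon j).
  have [x px _] := iso_surj (tri_iso T) (interior_subset Aq : is_point ((j, q) : rep S)).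
  by have [k _] := square_cover Q' px; exists k.
have [s [_ hs]] := pieces_finite trT P_ccw Q'.
have w0 := side_neq0 k0; have box k := aligned_square_box w0 (side_neq0 k)
  (all_aligned trT P_ccw k0 k conn).
have /choice[m hm] : forall k : square Q', exists m : (R * R) * R, [/\ 0 < m.2,
    forall z, closed_square (side k) z <-> in_box m.1 m.2 (frame (side k0) z) &
    forall z, open_square (side k) z <-> in_open_box m.1 m.2 (frame (side k0) z)].
  by move=> k; have [m [l h]] := box k; exists (m, l).
exists (square Q'), k0, (side k0), (fun k => (m k).2); split=> // [k|W B BB].
  by case: (hm k).
have [h1 h2 h3] : [/\ forall k, 0 < (m k).2,
    forall k z, closed_square (side k) z <-> in_box (m k).1 (m k).2 (frame (side k0) z) &
    forall k z, open_square (side k) z <-> in_open_box (m k).1 (m k).2 (frame (side k0) z)].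
  by split=> k; case: (hm k).
rewrite -(square_tiling_form (tiling trT P_ccw w0 h1 h2 h3 hs) BB).
by apply: eq_bigr => i _; rewrite -!fst_sub -!snd_sub -!frameB.
Qed.

(** * Number fields in R *)

(* A maximal subspace avoiding x is a hyperplane complementary to x. *)
Lemma separating_functional (F : fieldType) (V : lmodType F) (x : V) : x != 0 ->
  exists phi : V -> F, [/\ forall u v, phi (u + v) = phi u + phi v,
    forall a u, phi (a *: u) = a * phi u & phi x = 1].
Proof.
move=> x0; pose P (M : set V) :=
  (forall a u v, M u -> M v -> M (a *: u + v)) /\ ~ M x.
have [|A [[Alin Ax] Amax]] := @Zorn_bigcup V P.
  move=> C CP Ctot; split=> [a u v [M CM Mu] [N CN Nv]|[M CM Mx]].
    have [MN|NM] := Ctot M N CM CN.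
      by exists N => //; apply: (CP N CN).1 => //; apply: MN.
    by exists M => //; apply: (CP M CM).1 => //; apply: NM.
  exact: (CP M CM).2.
(* The empty set satisfies [P] as well; if [A] were empty, the zero subspace would contradict its
   maximality. *)
have A0 : A 0.
  have [[u Au]|nA] := pselect (exists u, A u).
    by have := Alin (-1) u u Au Au; rewrite scaleN1r addNr.
  case: (Amax [set 0]); last first.
    split=> [a u v -> ->|/= /eqP]; first by rewrite /= scaler0 addr0.
    by rewrite (negbTE x0).
  by split=> [u Au|]; [case: nA; exists u|move=> /(_ 0 erefl) A0; apply: nA; exists 0].
have AD u v : A u -> A v -> A (u + v).
  by move=> Au Av; have := Alin 1 u v Au Av; rewrite scale1r.
have AZ a u : A u -> A (a *: u).
  by move=> Au; have := Alin a u 0 Au A0; rewrite addr0.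
(* If [y] is not in [A], adjoining it produces [x] by maximality, and the coefficient of [y] in [x]
   can be inverted. *)
have dec y : exists c, A (y - c *: x).
  have [Ay|nAy] := pselect (A y); first by exists 0; rewrite scale0r subr0.
  have [[m Am [c xE]]|nx] := pselect (exists2 m, A m & exists c, x = m + c *: y).
    have c0 : c != 0.
      by apply/eqP => c0; apply: Ax; rewrite xE c0 scale0r addr0.
    exists c^-1; rewrite xE scalerDr scalerA mulVf // scale1r opprD addrCA subrr addr0.
    by rewrite -scaleN1r; apply/AZ/AZ.
  case: (Amax [set z | exists2 m, A m & exists c, z = m + c *: y]); last first.
    split=> [a u v [m Am [c ->]] [m' Am' [c' ->]]|//].
    exists (a *: m + m'); first exact: Alin.
    by exists (a * c + c'); rewrite scalerDr scalerA addrACA -scalerDl.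
  split=> [u Au|sub]; first by exists u => //; exists 0; rewrite scale0r addr0.
  by apply: nAy; apply: sub; exists 0 => //; exists 1; rewrite scale1r add0r.
have [phi hphi] := choice dec.
have uniq y c c' : A (y - c *: x) -> A (y - c' *: x) -> c = c'.
  move=> h h'; apply/eqP; rewrite -subr_eq0; apply/negPn/negP => cc0; apply: Ax.
  have -> : x = (c - c')^-1 *: ((-1) *: (y - c *: x) + (y - c' *: x)).
    rewrite scaleN1r opprB addrC addrA subrK addrC -scalerBl.
    by rewrite scalerA mulVf ?scale1r.
  by apply/AZ/Alin.
exists phi; split=> [u v|a u|].
- apply: (uniq (u + v)) => //; rewrite scalerDl opprD addrACA; exact: AD.
- apply: (uniq (a *: u)) => //; rewrite -scalerA -scalerBr; exact: AZ.
- by apply: (uniq x) => //; rewrite scale1r subrr.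
Qed.

Lemma dependent_rows (F : fieldType) (m k : nat) (M : 'M[F]_(m, k)) : (k < m)%N ->
  exists2 c : 'rV[F]_m, c != 0 & c *m M = 0.
Proof.
move=> km; have : kermx M != 0.
  by rewrite kermx_eq0 /row_free ltn_eqF // (leq_ltn_trans (rank_leq_col M)).
by move=> /rowV0Pn[c /sub_kermxP cM c0]; exists c.
Qed.

(** * Subfields of finite degree over the rationals *)

Section NumberField.
Variables (R : numFieldType) (E : set R) (n : nat).
Hypotheses (E1 : E 1) (EB : forall x y, E x -> E y -> E (x - y)).
Hypotheses (EM : forall x y, E x -> E y -> E (x * y)).
Hypothesis E_dependent : forall s : 'I_n.+1 -> R, (forall j, E (s j)) ->
  exists2 c : 'I_n.+1 -> rat, exists j, c j != 0 & \sum_j ratr (c j) * s j = 0.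

Local Notation "p ^Q" := (map_poly (ratr : rat -> R) p) (at level 2, format "p ^Q").

Let E0 : E 0. Proof. by rewrite -(subrr 1); apply: EB. Qed.
Let EN x : E x -> E (- x). Proof. by move=> Ex; rewrite -sub0r; apply: EB. Qed.
Let ED x y : E x -> E y -> E (x + y).
Proof. by move=> Ex Ey; rewrite -[y]opprK; apply/EB/EN. Qed.

Lemma subring_nat m : E m%:R.
Proof. by elim: m => // m IH; rewrite mulrS; apply: ED. Qed.

Hypothesis EV : forall x, E x -> E x^-1.

Lemma subfield_rat a : E (ratr a).
Proof.
have Eint (z : int) : E z%:~R.
  by case: z => m; rewrite ?NegzE ?mulrNz; [|apply: EN]; apply: subring_nat.
by rewrite /ratr; apply: EM; [|apply: EV]; apply: Eint.
Qed.

Lemma subfield_horner (p : {poly rat}) x : E x -> E (p^Q).[x].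
Proof.
move=> Ex; elim/poly_ind: p => [|p c IH]; first by rewrite map_poly0 horner0.
rewrite rmorphD rmorphM /= map_polyX map_polyC hornerMXaddC.
by apply: ED; [apply: EM|apply: subfield_rat].
Qed.

Lemma subfield_exp x j : E x -> E (x ^+ j).
Proof. by move=> Ex; elim: j => [|j IH]; rewrite ?expr0 // exprS; apply: EM. Qed.

Definition minimal (x : R) (p : {poly rat}) : Prop :=
  [/\ p != 0, root p^Q x & forall q, q != 0 -> root q^Q x -> (size p <= size q)%N].

Lemma minimal_ex x : E x -> exists2 p, minimal x p & (size p <= n.+1)%N.
Proof.
move=> Ex; have [c [j cj] cx] := E_dependent (fun j => subfield_exp j Ex).
pose p0 := \poly_(i < n.+1) c (inord i).
have p00 : p0 != 0.
  apply/eqP => p00; case/eqP: cj; have := coef_poly n.+1 (fun i => c (inord i)) j.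
  by rewrite -/p0 p00 coef0 ltn_ord inord_val.
have p0x : root p0^Q x.
  apply/rootP; rewrite -cx (@horner_coef_wide _ n.+1); last first.
    by rewrite size_map_poly; apply: size_poly.
  by apply: eq_bigr => i _; rewrite coef_map coef_poly ltn_ord inord_val.
pose T m := `[< exists2 p, (p != 0) && root p^Q x & size p = m >].
have exT : exists m, T m by exists (size p0); apply/asboolP; exists p0; rewrite ?p00.
case: (ex_minnP exT) => m /asboolP[p /andP[pn0 px] szp] hmin.
exists p.
  by split=> // q q0 qx; rewrite szp; apply: hmin; apply/asboolP; exists q; rewrite ?q0.
rewrite szp; apply: leq_trans (size_poly n.+1 (fun i => c (inord i))).
by apply: hmin; apply/asboolP; exists p0; rewrite ?p00.
Qed.

(** Degrees are bounded by [n], so an element of greatest degree exists; it turns out to generate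
    the field. *)
Lemma generator_ex : exists th p, [/\ E th, minimal th p &
  forall x q, E x -> minimal x q -> (size q <= size p)%N].
Proof.
pose T m := `[< exists x p, [/\ E x, minimal x p & size p = m] >].
have exT : exists m, T m.
  have [p hp _] := minimal_ex E1.
  by exists (size p); apply/asboolP; exists 1, p.
have bT m : T m -> (m <= n.+1)%N.
  move=> /asboolP[x [p [Ex [p0 px pmin] <-]]].
  have [q [q0 qx _] szq] := minimal_ex Ex.
  exact: leq_trans (pmin _ q0 qx) szq.
case: (ex_maxnP exT bT) => m /asboolP[th [p [Eth hp szp]]] hmax.
exists th, p; split=> // x q Ex hq; rewrite szp; apply: hmax; apply/asboolP.
by exists x, q.
Qed.

Lemma minimal_mod x p q : minimal x p -> (q^Q).[x] = ((q %% p)^Q).[x].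
Proof.
move=> [_ /rootP px _]; rewrite {1}(divp_eq q p) rmorphD rmorphM /=.
by rewrite hornerD hornerM px mulr0 add0r.
Qed.

(** Let [d] be the degree of [th] and [g] a primitive element for [th] and [x]. By maximality [g]
    has degree at most [d], so the [d + 1] numbers 1, [th], ..., [th ^+ (d - 1)], [x], all
    polynomials in [g], are dependent. The coefficient of [x] is nonzero because the powers of [th]
    are independent. *)
Lemma generator_spans th p x : E th -> minimal th p ->
  (forall y q, E y -> minimal y q -> (size q <= size p)%N) ->
  E x -> exists q, x = (q^Q).[th].
Proof.
move=> Eth hp hmax Ex; have [r hr _] := minimal_ex Ex.
have [p0 pth pmin] := hp; have [r0 rx _] := hr.
have [m [[qt qtE] [qx qxE]]] := pchar0_PET p0 pth r0 rx (pchar_num _).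
set g := _ - _ in qtE qxE.
have Eg : E g by apply: EB => //; rewrite -mulr_natr; apply: EM => //; apply: subring_nat.
have [s hs _] := minimal_ex Eg; have sp := hmax _ _ Eg hs.
have [s0 _ _] := hs.
pose d := (size p).-1; pose d' := (size s).-1.
have d1 : d.+1 = size p by rewrite prednK // lt0n size_poly_eq0.
have d1' : d'.+1 = size s by rewrite prednK // lt0n size_poly_eq0.
(* The polynomials in [g] that represent these numbers, reduced modulo its minimal polynomial; the
   last one is [x]. *)
pose f (j : nat) := if (j < d)%N then (qt ^+ j) %% s else qx %% s.
have fE j : ((f j)^Q).[g] = if (j < d)%N then th ^+ j else x.
  rewrite /f; case: ifP => _; rewrite -minimal_mod // ?qxE //.
  by rewrite rmorphXn /= horner_exp qtE.
have szf j : (size (f j) <= d')%N.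
  by rewrite /f; case: ifP => _; rewrite -ltnS d1' ltn_modp.
pose M := \matrix_(j < d.+1, k < d') (f j)`_k.
have [|c c0 cM] := dependent_rows M; first by rewrite d1 (leq_trans _ sp) // -d1'.
have rel : \sum_(j < d.+1) ratr (c 0 j) * (if (j < d)%N then th ^+ j else x) = 0.
  transitivity (\sum_(k < d') (\sum_(j < d.+1) ratr (c 0 j) * ratr (f j)`_k) * g ^+ k).
    under [RHS]eq_bigr do rewrite mulr_suml.
    rewrite exchange_big; apply: eq_bigr => j _.
    rewrite -fE (@horner_coef_wide _ d') ?size_map_poly ?szf // mulr_sumr.
    by apply: eq_bigr => k _; rewrite coef_map /= mulrA.
  rewrite big1 // => k _; have /matrixP/(_ 0 k) := cM; rewrite !mxE => /(congr1 (ratr : rat -> R)).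
  rewrite rmorph0 rmorph_sum /= => e; apply/eqP; rewrite mulf_eq0; apply/orP; left; apply/eqP.
  by rewrite -[RHS]e; apply: eq_bigr => j _; rewrite mxE rmorphM.
rewrite big_ord_recr /= ltnn in rel.
pose h := \poly_(j < d) c 0 (inord j).
have hE : \sum_(j < d) ratr (c 0 (widen_ord (leqnSn d) j)) *
    (if (j < d)%N then th ^+ j else x) = (h^Q).[th].
  rewrite (@horner_coef_wide _ d) ?size_map_poly ?size_poly //.
  apply: eq_bigr => j _; rewrite coef_map coef_poly /= ltn_ord; congr (ratr (c 0 _) * _).
  by apply: val_inj; rewrite /= inordK // ltnW // ltnS.
rewrite hE in rel.
have cmax : c 0 ord_max != 0.
  apply: contra c0 => /eqP cm; rewrite cm rmorph0 mul0r addr0 in rel.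
  have h0 : h = 0.
    apply/eqP/negPn/negP => h0; have := pmin h h0 (introT rootP rel).
    by rewrite -d1 leqNgt ltnS size_poly.
  apply/eqP/rowP => j; rewrite mxE; have [->//|jm] := eqVneq j ord_max.
  have jd : (j < d)%N.
    by have := ltn_ord j; rewrite ltnS leq_eqVlt => /orP[/eqP e|//]; case/eqP: jm; apply: val_inj.
  have := coef_poly d (fun j => c 0 (inord j)) j; rewrite -/h h0 coef0 jd inord_val.
  by move=> ->.
exists (- (c 0 ord_max)^-1 *: h).
rewrite map_polyZ hornerZ rmorphN fmorphV /=.
have cn : (ratr (c 0 ord_max) : R) != 0 by rewrite fmorph_eq0.
apply: (mulfI cn); rewrite mulNr mulrN mulrA divff // mul1r.
by apply/eqP; rewrite -addr_eq0 addrC rel.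
Qed.

Lemma number_field : exists (K : fieldExtType rat) (i : {rmorphism K -> R}),
  range i = E.
Proof.
have [th [p [Eth hp hmax]]] := generator_ex; have [p0 pth pmin] := hp.
have irr_p : irreducible_poly p by apply/(subfx_irreducibleP pth p0)=> q qz0 nzq; apply: pmin.
exists (SubFieldExtType pth irr_p), (@subfx_inj _ _ (ratr : {rmorphism rat -> R}) th p).
rewrite eqEsubset; split=> [_ [y _ <-]|x Ex].
  have [q ->] := subfxEroot pth p0 y.
  rewrite -horner_map /= subfx_inj_root // -map_poly_comp.
  have -> : (map_poly (subfx_inj (iota := ratr) (z := th) (p := p) \o in_alg _) q) = q^Q.
    by apply: eq_map_poly => b /=; apply: subfx_inj_base.
  exact: subfield_horner.
have [q ->] := generator_spans Eth hp hmax Ex.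
by exists (subfx_eval ratr th p q) => //; apply: subfx_inj_eval.
Qed.

End NumberField.

(** * The J-invariant and periodic slopes *)

(* Only from here on, because the name lift of fintype is then shadowed. *)
Import freeg.

Section Alternating.
Variables (V : lmodType rat) (B : V -> V -> rat).
Hypothesis BB : biadditive B.

Definition alternate (u v : V) : rat^o := B u v - B v u.

Definition form_lift : {freeg (V * V) / rat} -> rat^o :=
  fglift (fun p : V * V => alternate p.1 p.2).

Lemma form_lift_zmod : zmod_morphism form_lift.
Proof. exact: lift_is_additive. Qed.
HB.instance Definition _ := GRing.isZmodMorphism.Build
  {freeg (V * V) / rat} rat^o form_lift form_lift_zmod.

Lemma form_liftU a u v : form_lift << a *g (u, v) >> = a * alternate u v.
Proof. exact: liftU. Qed.

(** Additive maps between rational vector spaces are linear, which is why biadditivity is all that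
    is ever asked of a form. *)
Lemma form_liftZ a x : form_lift (a *: x) = a * form_lift x.
Proof. by have := rat_linear form_lift_zmod a x. Qed.

Lemma biadditiveZl a u v : B (a *: u) v = a * B u v.
Proof.
have f_add : zmod_morphism (B^~ v : V -> rat^o) by move=> x y; rewrite (biaddBl BB).
by have := rat_linear f_add a u.
Qed.

Lemma biadditiveZr a u v : B u (a *: v) = a * B u v.
Proof.
have f_add : zmod_morphism (B u : V -> rat^o) by move=> x y; rewrite (biaddBr BB).
by have := rat_linear f_add a v.
Qed.

Lemma form_lift_rel x : ext2_rel x -> form_lift x = 0.
Proof.
elim=> {x} [|a x y _ hx _ hy|u u' w|a u w|u w w'|a u w|u];
  rewrite ?raddf0 ?raddfD ?raddfN /= ?form_liftZ ?form_liftU //= /alternate ?mul1r.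
- by rewrite hx hy mulr0 addr0.
- by rewrite (biaddDl BB) (biaddDr BB); ring.
- by rewrite biadditiveZl biadditiveZr; ring.
- by rewrite (biaddDl BB) (biaddDr BB); ring.
- by rewrite biadditiveZl biadditiveZr; ring.
- by rewrite subrr.
Qed.

Lemma wedge_sum_form (I : finType) (a b : I -> V) :
  \sum_i wedge (a i) (b i) = 0 -> \sum_i alternate (a i) (b i) = 0.
Proof.
pose pi := \pi_(Quotient.quot (@ext2_pred V))%qT.
pose x : {freeg (V * V) / rat} := \sum_i << (a i, b i) >>.
have -> : \sum_i wedge (a i) (b i) = (pi x : ext2 V).
  rewrite /x; elim/big_ind2: _ => // [|u u' v v' -> ->]; last by rewrite /pi pi2D.
  by apply: (addIr (pi 0 : ext2 V)); rewrite /pi -pi2D !add0r.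
have -> : (0 : ext2 V) = pi 0.
  by apply: (addIr (pi 0 : ext2 V)); rewrite /pi -pi2D !add0r.
move=> /ext2_piP; rewrite subr0 => /ext2_predP/form_lift_rel; rewrite raddf_sum /= => h.
by rewrite -[RHS]h; apply: eq_bigr => i _; rewrite form_liftU mul1r.
Qed.

End Alternating.

(** A nonzero element of the exterior square is detected by a linear functional [phi]. The form
    [phi (wedge u v)] is already alternating, so antisymmetrization only doubles it. *)
Lemma wedge_sum_eq0 (V : lmodType rat) (I : finType) (a b : I -> V) :
  (forall B : V -> V -> rat, biadditive B -> \sum_i (B (a i) (b i) - B (b i) (a i)) = 0) ->
  \sum_i wedge (a i) (b i) = 0.
Proof.
move=> h; apply/eqP/negPn/negP => /separating_functional[phi [phiD phiZ phi1]].
have phi0 : phi 0 = 0 by rewrite -(scale0r 0) phiZ mul0r.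
have phiN u : phi (- u) = - phi u by rewrite -scaleN1r phiZ mulN1r.
have : phi (\sum_i wedge (a i) (b i)) = \sum_i phi (wedge (a i) (b i)).
  by apply: (big_morph phi); [apply: phiD|apply: phi0].
rewrite phi1 => e.
have wB : biadditive (fun u v => phi (wedge u v)).
  by split=> [v u u'|u v v']; rewrite ?wedgeDl ?wedgeDr phiD.
have := h _ wB; rewrite (eq_bigr (fun i => phi (wedge (a i) (b i)) *+ 2)).
  by rewrite sumrMnl -e => /eqP; rewrite pnatr_eq0.
move=> i _; rewrite mulr2n; congr (_ + _); rewrite -phiN; congr phi.
apply/eqP; rewrite eq_sym -addr_eq0 -(wedge_alt (a i + b i)).
by rewrite wedgeDl !wedgeDr !wedge_alt addr0 add0r.
Qed.

(** * Periodic slopes and self-adjoint multiplications *)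

Section Balanced.
Variables (R : realType) (I : finType) (v w : I -> R * R).
Implicit Types (s : R) (b p q : R * R).

Definition form_sum (W : zmodType) (B : R * R -> R * R -> W) : W :=
  \sum_i (B (v i) (w i) - B (w i) (v i)).

(** The vanishing of the SAF invariant, tested by forms; [cross b] is the projection along [b] up to
    a factor. *)
Definition periodic b : Prop := forall B : R -> R -> rat, biadditive B ->
  form_sum (fun p q => B (cross b p) (cross b q)) = 0.

(* Multiplication by s on either side of the J-invariant, an element of the
   rational tensor square of the plane, gives the same result. *)
Definition balanced s : Prop := forall B : R * R -> R * R -> rat, biadditive B ->
  form_sum (fun p q => B (s *: p) q) = form_sum (fun p q => B p (s *: q)).

Lemma form_sumD (B B' : R * R -> R * R -> rat) :
  form_sum (fun p q => B p q + B' p q) = form_sum B + form_sum B'.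
Proof. by rewrite /form_sum -big_split; apply: eq_bigr => i _ /=; ring. Qed.

Lemma form_sumN (B : R * R -> R * R -> rat) :
  form_sum (fun p q => - B p q) = - form_sum B.
Proof. by rewrite /form_sum -sumrN; apply: eq_bigr => i _ /=; ring. Qed.

Lemma eq_form_sum (W : zmodType) (B B' : R * R -> R * R -> W) :
  (forall p q, B p q = B' p q) -> form_sum B = form_sum B'.
Proof. by move=> h; apply: eq_bigr => i _; rewrite !h. Qed.

Lemma biadditive_comp (U U' W W' X : zmodType) (f : U -> W) (g : U' -> W')
    (B : W -> W' -> X) : {morph f : x y / x + y} -> {morph g : x y / x + y} ->
  biadditive B -> biadditive (fun x y => B (f x) (g y)).
Proof.
move=> fD gD [B1 B2]; split=> [y x x'|x y y']; first by rewrite fD B1.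
by rewrite gD B2.
Qed.

Section Coordinates.
Variables b1 b2 : R * R.
Hypothesis c0 : cross b1 b2 != 0.
Let xi p := cross p b2 / cross b1 b2.
Let eta p := cross b1 p / cross b1 b2.

Lemma coordinatesE p : p = xi p *: b1 + eta p *: b2.
Proof.
by apply: pairE; rewrite !scale_pairE /xi /eta /=; move: c0; rewrite /cross => ?; field.
Qed.

Let xiD p q : xi (p + q) = xi p + xi q.
Proof. by rewrite /xi -mulrDl; congr (_ / _); rewrite /cross /=; ring. Qed.
Let etaD p q : eta (p + q) = eta p + eta q.
Proof. by rewrite /eta -mulrDl; congr (_ / _); rewrite /cross /=; ring. Qed.
Let xiZ s p : xi (s *: p) = s * xi p.
Proof. by rewrite /xi mulrA; congr (_ / _); rewrite scale_pairE /cross /=; ring. Qed.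
Let etaZ s p : eta (s *: p) = s * eta p.
Proof. by rewrite /eta mulrA; congr (_ / _); rewrite scale_pairE /cross /=; ring. Qed.

Let mulD s : {morph *%R s : x y / x + y}. Proof. by move=> x y; rewrite mulrDr. Qed.

Lemma periodic_slopeP s : periodic (b1 + s *: b2) <->
  forall B : R -> R -> rat, biadditive B ->
    form_sum (fun p q => B (eta p - s * xi p) (eta q - s * xi q)) = 0.
Proof.
have crE p : cross (b1 + s *: b2) p = cross b1 b2 * (eta p - s * xi p).
  by rewrite scale_pairE /eta /xi; move: c0; rewrite /cross /= => ?; field.
split=> h B BB.
  have := h _ (biadditive_comp (mulD (cross b1 b2)^-1) (mulD (cross b1 b2)^-1) BB).
  by move=> <-; apply: eq_form_sum => p q; rewrite !crE !mulKf.
have := h _ (biadditive_comp (mulD (cross b1 b2)) (mulD (cross b1 b2)) BB).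
by move=> <-; apply: eq_form_sum => p q; rewrite !crE.
Qed.

Hypotheses (per1 : periodic b1) (per2 : periodic b2) (per12 : periodic (b1 + b2)).

Lemma form_sum_eta (B : R -> R -> rat) : biadditive B -> form_sum (fun p q => B (eta p) (eta q)) = 0.
Proof.
move=> BB; have : periodic (b1 + 0 *: b2) by rewrite scale0r addr0.
move=> /periodic_slopeP/(_ B BB) e; rewrite -[RHS]e.
by apply: eq_form_sum => p q; rewrite !mul0r !subr0.
Qed.

Lemma form_sum_xi (B : R -> R -> rat) : biadditive B -> form_sum (fun p q => B (xi p) (xi q)) = 0.
Proof.
move=> BB; have hD := mulD (- cross b1 b2)^-1.
have := per2 (biadditive_comp hD hD BB) => e; rewrite -[RHS]e.
have crE p : cross b2 p = - cross b1 b2 * xi p.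
  by rewrite /xi; move: c0; rewrite /cross => ?; field.
by apply: eq_form_sum => p q; rewrite !crE !mulKf ?oppr_eq0.
Qed.

(** The periodicity of [b1] and [b2] removes the terms in [eta] alone and in [xi] alone. *)
Lemma form_sum_slope s (B : R -> R -> rat) : biadditive B ->
  form_sum (fun p q => B (eta p - s * xi p) (eta q - s * xi q)) =
  - (form_sum (fun p q => B (eta p) (s * xi q)) +
     form_sum (fun p q => B (s * xi p) (eta q))).
Proof.
move=> BB; have BBs := biadditive_comp (mulD s) (mulD s) BB.
rewrite -form_sumD -form_sumN -[LHS]subr0 -(form_sum_eta BB) -[LHS]subr0 -(form_sum_xi BBs).
rewrite -!form_sumN -!form_sumD; apply: eq_form_sum => p q.
by rewrite !(biaddBl BB) !(biaddBr BB); ring.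
Qed.

Lemma form_sum_sym (B : R -> R -> rat) : biadditive B ->
  form_sum (fun p q => B (xi p) (eta q)) = - form_sum (fun p q => B (eta p) (xi q)).
Proof.
move=> BB; have : periodic (b1 + 1 *: b2) by rewrite scale1r.
move=> /periodic_slopeP/(_ B BB); rewrite form_sum_slope // => /eqP.
rewrite oppr_eq0 addr_eq0 => /eqP; rewrite (eq_form_sum (B' := fun p q => B (eta p) (xi q))).
  move=> ->; rewrite opprK; apply: eq_form_sum => p q; by rewrite mul1r.
by move=> p q; rewrite mul1r.
Qed.

(** In the basis [b1], [b2] the diagonal blocks of any form vanish, also after multiplying one
    argument by [s]. For a mixed block, the sums of [B(s xi, eta)] and of [B(xi, s eta)] are both
    the opposite of that of [B(eta, s xi)]: the first by the slope [s], the second by the slope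
    1. *)
Lemma periodic_slope_balanced s : periodic (b1 + s *: b2) <-> balanced s.
Proof.
rewrite periodic_slopeP; split=> [h B BB|h B BB]; last first.
  rewrite form_sum_slope //; apply/eqP; rewrite oppr_eq0 addr_eq0; apply/eqP.
  have := h _ (biadditive_comp xiD etaD BB).
  rewrite (eq_form_sum (B' := fun p q => B (s * xi p) (eta q))); last first.
    by move=> p q; rewrite xiZ.
  move=> ->; rewrite -[LHS]opprK; congr (- _).
  rewrite -(form_sum_sym (biadditive_comp (f := id) (fun _ _ => erefl) (mulD s) BB)).
  by apply: eq_form_sum => p q; rewrite etaZ.
have {}h (B' : R -> R -> rat) : biadditive B' -> form_sum (fun p q => B' (s * xi p) (eta q)) =
    - form_sum (fun p q => B' (eta p) (s * xi q)).
  move=> BB'; have /eqP := h _ BB'; rewrite form_sum_slope // oppr_eq0 addrC addr_eq0.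
  by move=> /eqP.
have scD b : {morph (fun t : R => t *: b) : x y / x + y} by move=> x y; rewrite scalerDl.
have B12 := biadditive_comp (scD b1) (scD b2) BB.
have B21 := biadditive_comp (scD b2) (scD b1) BB.
have B11 := biadditive_comp (scD b1) (scD b1) BB.
have B22 := biadditive_comp (scD b2) (scD b2) BB.
have idD : {morph id : x y / x + y :> R} by [].
have expand p q : B p q = B (xi p *: b1) (xi q *: b1) + B (xi p *: b1) (eta q *: b2) +
    (B (eta p *: b2) (xi q *: b1) + B (eta p *: b2) (eta q *: b2)).
  by rewrite -!(biaddDr BB) -(biaddDl BB) -!coordinatesE.
have -> : form_sum (fun p q => B (s *: p) q) =
    form_sum (fun p q => B ((s * xi p) *: b1) (eta q *: b2)) +
    form_sum (fun p q => B ((s * eta p) *: b2) (xi q *: b1)).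
  rewrite (eq_form_sum (fun p q => expand (s *: p) q)) !form_sumD.
  have := form_sum_xi (biadditive_comp (mulD s) idD B11).
  rewrite (eq_form_sum (B' := fun p q => B (xi (s *: p) *: b1) (xi q *: b1))) => [->|p q].
    rewrite add0r; have := form_sum_eta (biadditive_comp (mulD s) idD B22).
    rewrite (eq_form_sum (B' := fun p q => B (eta (s *: p) *: b2) (eta q *: b2))) => [->|p q].
      by rewrite addr0; congr (_ + _); apply: eq_form_sum => p q; rewrite ?xiZ ?etaZ.
    by rewrite etaZ.
  by rewrite xiZ.
have -> : form_sum (fun p q => B p (s *: q)) =
    form_sum (fun p q => B (xi p *: b1) ((s * eta q) *: b2)) +
    form_sum (fun p q => B (eta p *: b2) ((s * xi q) *: b1)).
  rewrite (eq_form_sum (fun p q => expand p (s *: q))) !form_sumD.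
  have := form_sum_xi (biadditive_comp idD (mulD s) B11).
  rewrite (eq_form_sum (B' := fun p q => B (xi p *: b1) (xi (s *: q) *: b1))) => [->|p q].
    rewrite add0r; have := form_sum_eta (biadditive_comp idD (mulD s) B22).
    rewrite (eq_form_sum (B' := fun p q => B (eta p *: b2) (eta (s *: q) *: b2))) => [->|p q].
      by rewrite addr0; congr (_ + _); apply: eq_form_sum => p q; rewrite ?xiZ ?etaZ.
    by rewrite etaZ.
  by rewrite xiZ.
congr (_ + _).
  rewrite (h _ B12) (form_sum_sym (biadditive_comp idD (mulD s) B12)).
  by [].
rewrite -[LHS]opprK -(form_sum_sym (biadditive_comp (mulD s) idD B21)).
by rewrite (h _ B21) opprK.
Qed.

End Coordinates.

End Balanced.

Arguments eq_form_sum {R I v w W B B'} _.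

(** * Linear functionals over a subfield *)

Section Restriction.
Variables (F E : fieldType) (iota : {rmorphism F -> E}).

(* The unused let makes iota a parameter of the alias, so that the scaling can
   depend on it. *)
Definition restriction : Type := let _ := iota in E.
HB.instance Definition _ := GRing.Zmodule.copy restriction E.

Definition restriction_scale (a : F) (x : restriction) : restriction := iota a * (x : E).

Fact restriction_scaleA a b x :
  restriction_scale a (restriction_scale b x) = restriction_scale (a * b) x.
Proof. by rewrite /restriction_scale rmorphM mulrA. Qed.

Fact restriction_scale1 : left_id 1 restriction_scale.
Proof. by move=> x; rewrite /restriction_scale rmorph1 mul1r. Qed.

Fact restriction_scaleDr : right_distributive restriction_scale +%R.
Proof. by move=> a x y; rewrite /restriction_scale mulrDr. Qed.

Fact restriction_scaleDl x : {morph restriction_scale^~ x : a b / a + b}.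
Proof. by move=> a b; rewrite /restriction_scale rmorphD mulrDl. Qed.

HB.instance Definition _ := GRing.Zmodule_isLmodule.Build F restriction
  restriction_scaleA restriction_scale1 restriction_scaleDr restriction_scaleDl.

Definition functional (phi : E -> F) : Prop := {morph phi : x y / x + y} /\
  forall a x, phi (iota a * x) = a * phi x.

Lemma functional_ex (x : E) : x != 0 -> exists2 phi, functional phi & phi x = 1.
Proof.
move=> x0; have [phi [h1 h2 h3]] := @separating_functional F restriction x x0.
by exists phi.
Qed.

Lemma functional0 phi : functional phi -> phi 0 = 0.
Proof. by move=> [h _]; apply: (addrI (phi 0)); rewrite -h !addr0. Qed.

Lemma functionalN phi x : functional phi -> phi (- x) = - phi x.
Proof.
move=> hp; apply: (addrI (phi x)); rewrite -hp.1 !subrr; exact: functional0.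
Qed.

Lemma functionalB phi x y : functional phi -> phi (x - y) = phi x - phi y.
Proof. by move=> hp; rewrite hp.1 functionalN. Qed.

Lemma functional_sum phi (I : finType) (f : I -> E) : functional phi ->
  phi (\sum_i f i) = \sum_i phi (f i).
Proof. by move=> hp; apply: (big_morph phi); [exact: hp.1|exact: functional0]. Qed.

Lemma functional_comb phi (I : finType) (a : I -> F) (f : I -> E) : functional phi ->
  phi (\sum_i iota (a i) * f i) = \sum_i a i * phi (f i).
Proof. by move=> hp; rewrite functional_sum //; apply: eq_bigr => i _; rewrite hp.2. Qed.

(** The functionals are defined on all of [E]. A new vector is reduced by the basis found so far; if
    a remainder is left, a functional with value 1 on it is corrected so as to vanish on the old
    basis. *)
Lemma dual_basis (s : seq E) : exists (K : finType) (al : K -> E) (f : K -> E -> F),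
  [/\ forall k, functional (f k), forall k l, f k (al l) = (k == l)%:R &
      forall x, x \in s -> x = \sum_k iota (f k x) * al k].
Proof.
elim: s => [|a s [K [al [f [h1 h2 h3]]]]].
  by exists void, (of_void E), (of_void (E -> F)); split=> // [] [].
pose a' := a - \sum_k iota (f k a) * al k.
have fa' k : f k a' = 0.
  rewrite functionalB // functional_comb // (bigD1 k) //= h2 eqxx mulr1 big1 ?addr0 ?subrr //.
  by move=> l lk; rewrite h2 eq_sym (negbTE lk) mulr0.
have [a0|a0] := eqVneq a' 0.
  exists K, al, f; split=> // x; rewrite inE => /predU1P[->|]; last exact: h3.
  by apply/eqP; rewrite -subr_eq0 -/a' a0.
have [g0 hg0 g01] := functional_ex a0.
pose g x := g0 x - \sum_k g0 (al k) * f k x.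
have hg : functional g.
  split=> [x y|b x]; rewrite /g.
    rewrite hg0.1 (eq_bigr (fun k => g0 (al k) * f k x + g0 (al k) * f k y)).
      by rewrite big_split opprD addrACA.
    by move=> k _; rewrite (h1 k).1 mulrDr.
  rewrite hg0.2 mulrBr mulr_sumr; congr (_ - _); apply: eq_bigr => k _.
  by rewrite (h1 k).2 mulrCA.
have gal l : g (al l) = 0.
  rewrite /g (bigD1 l) //= h2 eqxx mulr1 big1 ?addr0 ?subrr // => k kl.
  by rewrite h2 (negbTE kl) mulr0.
have ga' : g a' = 1 by rewrite /g g01 big1 ?subr0 // => k _; rewrite fa' mulr0.
exists (option K), (fun o => if o is Some k then al k else a'),
  (fun o => if o is Some k then f k else g); split.
- by case.
- by case=> [k|] [l|]; rewrite ?h2 ?fa' ?gal ?ga'.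
move=> x; rewrite inE => hx.
have sumE : \sum_(o : option K) iota ((if o is Some k then f k else g) x) *
    (if o is Some k then al k else a') = iota (g x) * a' + \sum_k iota (f k x) * al k.
  rewrite (bigD1 None) //=; congr (_ + _).
  rewrite (reindex_omap Some id) => [|[k|]] //=.
  by apply: eq_bigl => k; rewrite eqxx.
rewrite sumE; case/predU1P: hx => [->|/h3 xE].
  have -> : g a = 1.
    rewrite -ga' /a' (functionalB _ _ hg) functional_comb // [X in _ - X]big1 ?subr0 //.
    by move=> k _; rewrite gal mulr0.
  by rewrite rmorph1 mul1r /a' subrK.
rewrite {1}xE; have -> : g x = 0.
  by rewrite xE functional_comb // big1 // => k _; rewrite gal mulr0.
by rewrite rmorph0 mul0r add0r.
Qed.

End Restriction.

(** * The periodic direction field *)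

Section BalancedField.
Variables (R : realType) (I : finType) (v w : I -> R * R).
Implicit Types (s t : R) (p q : R * R).
Local Notation balanced := (balanced v w).
Local Notation form_sum := (form_sum v w).

Let scaleD s : {morph (fun p : R * R => s *: p) : x y / x + y}.
Proof. by move=> x y; rewrite scalerDr. Qed.
Let idD : {morph id : x y / x + y :> R * R}. Proof. by []. Qed.

Lemma balanced1 : balanced 1.
Proof. by move=> B BB; apply: eq_form_sum => p q; rewrite !scale1r. Qed.

Lemma balancedB s t : balanced s -> balanced t -> balanced (s - t).
Proof.
move=> hs ht B BB.
rewrite (eq_form_sum (B' := fun p q => B (s *: p) q + - B (t *: p) q)); last first.
  by move=> p q; rewrite scalerBl (biaddBl BB).
rewrite (eq_form_sum (B := fun p q => B p ((s - t) *: q))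
  (B' := fun p q => B p (s *: q) + - B p (t *: q))); last first.
  by move=> p q; rewrite scalerBl (biaddBr BB).
by rewrite !form_sumD !form_sumN hs // ht.
Qed.

Lemma balancedM s t : balanced s -> balanced t -> balanced (s * t).
Proof.
move=> hs ht B BB.
have h1 := hs _ (biadditive_comp (scaleD t) idD BB).
have h2 := ht _ (biadditive_comp idD (scaleD s) BB).
rewrite (eq_form_sum (B' := fun p q => B (t *: (s *: p)) q)); last first.
  by move=> p q; rewrite scalerA mulrC.
by rewrite h1 h2; apply: eq_form_sum => p q; rewrite scalerA.
Qed.

Lemma balancedV s : balanced s -> balanced s^-1.
Proof.
move=> hs; have [s0|s0] := eqVneq s 0.
  by rewrite s0 invr0 -(subrr 1); apply: balancedB; apply: balanced1.
move=> B BB.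
have := hs _ (biadditive_comp (scaleD s^-1) (scaleD s^-1) BB).
rewrite (eq_form_sum (B' := fun p q => B p (s^-1 *: q))) => [->|p q].
  by apply: eq_form_sum => p q; rewrite scalerK.
by rewrite scalerK.
Qed.

(** If the two sums differed, composing [B] with a rational functional that is 1 on the difference
    would give a rational form violating [balanced]. *)
Lemma balanced_numField (W : numFieldType) (B : R * R -> R * R -> W) s :
  balanced s -> biadditive B ->
  form_sum (fun p q => B (s *: p) q) = form_sum (fun p q => B p (s *: q)).
Proof.
move=> hs BB; apply/eqP; rewrite -subr_eq0; apply/negPn/negP => d0.
have [phi hphi] := functional_ex (ratr : {rmorphism rat -> W}) d0.
have sumE (C : R * R -> R * R -> W) : phi (form_sum C) = form_sum (fun p q => phi (C p q)).
  rewrite /form_sum (functional_sum _ hphi); apply: eq_bigr => i _; exact: (functionalB _ _ hphi).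
rewrite (functionalB _ _ hphi) !sumE (hs (fun p q => phi (B p q))) ?subrr => [/eqP|].
  by rewrite eq_sym oner_eq0.
by split=> [q p p'|p q q']; rewrite ?BB.1 ?BB.2 hphi.1.
Qed.

Variable u : R * R.
Hypothesis area : form_sum (fun p q => dot u p * cross u q) != 0.

Let dotD : {morph dot u : x y / x + y}.
Proof. by move=> x y; rewrite /dot /=; ring. Qed.
Let crossD : {morph cross u : x y / x + y}.
Proof. by move=> x y; rewrite /cross /=; ring. Qed.
Let dotZ s p : dot u (s *: p) = s * dot u p.
Proof. by rewrite scale_pairE /dot /=; ring. Qed.
Let crossZ s p : cross u (s *: p) = s * cross u p.
Proof. by rewrite scale_pairE /cross /=; ring. Qed.

Local Notation iota := (ratr : {rmorphism rat -> R}).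

(* Contraction of the J-invariant with a rational functional. *)
Definition contraction (f : R -> rat) : R :=
  form_sum (fun p q => iota (f (dot u p)) * cross u q).

(** Expanding the first coordinates in a finite dual basis writes the nonzero [area] as a
    combination of contractions. *)
Lemma contraction_neq0 : exists2 f, functional iota f & contraction f != 0.
Proof.
pose s := [seq dot u (v i) | i <- enum I] ++ [seq dot u (w i) | i <- enum I].
have [K [al [f [h1 h2 h3]]]] := dual_basis iota s.
have sv i : dot u (v i) = \sum_k iota (f k (dot u (v i))) * al k.
  by apply: h3; rewrite mem_cat; apply/orP; left; apply: map_f (mem_enum _ i).
have sw i : dot u (w i) = \sum_k iota (f k (dot u (w i))) * al k.
  by apply: h3; rewrite mem_cat; apply/orP; right; apply: map_f (mem_enum _ i).
have e : form_sum (fun p q => dot u p * cross u q) = \sum_k al k * contraction (f k).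
  rewrite /contraction /form_sum; under [RHS]eq_bigr do rewrite mulr_sumr.
  rewrite exchange_big; apply: eq_bigr => i _ /=; rewrite {1}sv {1}sw !mulr_suml -sumrB.
  by apply: eq_bigr => k _; ring.
have [k hk|h] := pickP (fun k => contraction (f k) != 0); first by exists (f k).
case/eqP: area; rewrite e big1 // => k _; have /negbFE/eqP -> := h k.
by rewrite mulr0.
Qed.

(** By self-adjointness [s j * contraction f] is a combination of the numbers [cross u (v i)] and
    [cross u (w i)] with rational coefficients. There are twice [#|I|] of these, so one more element
    forces a relation. *)
Lemma balanced_dependent (s : 'I_(#|I| + #|I|).+1 -> R) : (forall j, balanced (s j)) ->
  exists2 c : 'I_(#|I| + #|I|).+1 -> rat, exists j, c j != 0 & \sum_j ratr (c j) * s j = 0.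
Proof.
move=> hs; have [f hf f0] := contraction_neq0.
pose M := row_mx (\matrix_(j < (#|I| + #|I|).+1, k < #|I|) f (s j * dot u (v (enum_val k))))
  (\matrix_(j < (#|I| + #|I|).+1, k < #|I|) f (s j * dot u (w (enum_val k)))).
have [c c0 cM] := dependent_rows M (ltnSn _).
rewrite mul_mx_row -row_mx0 in cM; have [cv cw] := eq_row_mx cM.
have cvE i : \sum_j iota (c 0 j) * iota (f (s j * dot u (v i))) = 0.
  have /matrixP/(_ 0 (enum_rank i)) := cv; rewrite !mxE => /(congr1 iota).
  rewrite rmorph0 rmorph_sum => e; rewrite -[RHS]e; apply: eq_bigr => j _.
  by rewrite mxE enum_rankK rmorphM.
have cwE i : \sum_j iota (c 0 j) * iota (f (s j * dot u (w i))) = 0.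
  have /matrixP/(_ 0 (enum_rank i)) := cw; rewrite !mxE => /(congr1 iota).
  rewrite rmorph0 rmorph_sum => e; rewrite -[RHS]e; apply: eq_bigr => j _.
  by rewrite mxE enum_rankK rmorphM.
exists (c 0).
  by move: c0; case/rV0Pn => j cj; exists j.
apply: (mulIf f0); rewrite mul0r mulr_suml.
transitivity (\sum_j \sum_i (iota (c 0 j) * iota (f (s j * dot u (v i))) * cross u (w i) -
    iota (c 0 j) * iota (f (s j * dot u (w i))) * cross u (v i))).
  apply: eq_bigr => j _; have BB : biadditive (fun p q => iota (f (dot u p)) * cross u q).
    split=> [q p p'|p q q'] /=; first by rewrite dotD hf.1 rmorphD mulrDl.
    by rewrite crossD mulrDr.
  have := balanced_numField (hs j) BB.
  rewrite [RHS](_ : _ = s j * contraction f); last first.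
    rewrite /contraction /form_sum mulr_sumr; apply: eq_bigr => i _.
    by rewrite !crossZ; ring.
  move=> e; rewrite -mulrA -e /form_sum mulr_sumr; apply: eq_bigr => i _.
  by rewrite !dotZ; ring.
rewrite exchange_big big1 //= => i _; rewrite sumrB -!mulr_suml cvE cwE.
by rewrite !mul0r subrr.
Qed.

Lemma balanced_number_field : exists (K : fieldExtType rat) (i : {rmorphism K -> R}),
  range i = [set s | balanced s].
Proof.
apply: (number_field (n := #|I| + #|I|)).
- exact: balanced1.
- exact: balancedB.
- exact: balancedM.
- exact: balanced_dependent.
- exact: balancedV.
Qed.

(* For an embedding sigma of K, the form p, q |-> f(p) (f q)^* turns the
   balancedness of s into (sigma s - (sigma s)^* ) * norm = 0, where norm is a
   sum of squares. *)
Lemma squares_totally_real (K : fieldExtType rat) (i : {rmorphism K -> R})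
    (T : finType) (t0 : T) (l : T -> R) : (forall x, balanced (i x)) ->
  (forall t : T, 0 < l t) ->
  (forall (W : comNzRingType) (B : R -> R -> W), biadditive B ->
    form_sum (fun p q => B (dot u p) (cross u q)) = (\sum_(t : T) B (l t) (l t)) *+ 2) ->
  totally_real R K.
Proof.
move=> bal l0 hl sigma x.
have [g hg g1] := functional_ex i (lt0r_neq0 (l0 t0)).
pose f r : R[i] := sigma (g r).
have fM y r : f (i y * r) = sigma y * f r by rewrite /f hg.2 rmorphM.
pose B (a b : R) : R[i] := f a * (f b)^*.
have fD : {morph f : a b / a + b} by move=> a b; rewrite /f hg.1 rmorphD.
have BB : biadditive B.
  by split=> [b a a'|a b b']; rewrite /B fD ?rmorphD ?mulrDl ?mulrDr.
have BBd : biadditive (fun p q => B (dot u p) (cross u q)).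
  exact: biadditive_comp.
set N := \sum_(t : T) B (l t) (l t).
have N0 : N != 0.
  have : 0 < N.
    rewrite /N (bigD1 t0) //= ltr_pwDl //; last by apply: sumr_ge0 => t _; apply: mul_conjC_ge0.
    by rewrite mul_conjC_gt0 /f g1 rmorph1 oner_eq0.
  by move=> h; rewrite gt_eqF.
have := balanced_numField (bal x) BBd.
rewrite (eq_form_sum (B' := fun p q => sigma x * B (dot u p) (cross u q))); last first.
  by move=> p q; rewrite dotZ /B fM mulrA.
rewrite [RHS](eq_form_sum (B' := fun p q => (sigma x)^* * B (dot u p) (cross u q))); last first.
  by move=> p q; rewrite crossZ /B fM rmorphM mulrCA.
have scal (c : R[i]) : form_sum (fun p q => c * B (dot u p) (cross u q)) = c * (N *+ 2).
  rewrite -(hl _ _ BB) /form_sum mulr_sumr; apply: eq_bigr => j _; by rewrite mulrBr.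
rewrite !scal => /mulIf; rewrite mulrn_eq0 /= => /(_ N0).
case: (sigma x) => a b [] bE; exists a; congr (_ +i* _)%C.
lra.
Qed.

End BalancedField.

(** * Algebraically periodic directions of the surface *)

Section PeriodicField.
Variables (R : realType) (S : gluing R) (T : triangulation S).
Implicit Types b p q : R * R.

Let v (i : tri T) : R * R := tri_vtx i 1 - tri_vtx i 0.
Let w (i : tri T) : R * R := tri_vtx i 2 - tri_vtx i 1.

(** The normalizing factor of [proj] is a nonzero real and is absorbed into the form. *)
Lemma SAFP b : b != 0 -> SAF T b = 0 <-> periodic v w b.
Proof.
move=> b0; set r := Num.sqrt (b.1 ^+ 2 + b.2 ^+ 2).
have r0 : r != 0.
  rewrite /r sqrtr_eq0 -ltNge lt_neqAle addr_ge0 ?sqr_ge0 // andbT eq_sym.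
  by rewrite paddr_eq0 ?sqr_ge0 // !sqrf_eq0 -[_ && _]/(b == 0).
have -> : SAF T b = \sum_i wedge (proj b (v i)) (proj b (w i)).
  rewrite /SAF /J_invariant raddf_sum; apply: eq_bigr => i _; exact: ext2_map_wedge.
have mulD (s : R) : {morph *%R^~ s : x y / x + y} by move=> x y; rewrite mulrDl.
split=> [h B BB|h].
  have := wedge_sum_form (V := rat_module R) (biadditive_comp (mulD r) (mulD r) BB) h.
  move=> e; rewrite -[RHS]e; apply: eq_bigr => i _.
  by rewrite /alternate /proj -/r !divfK.
apply: wedge_sum_eq0 => B BB.
exact: (h _ (biadditive_comp (mulD r^-1) (mulD r^-1) BB)).
Qed.

Lemma periodic_directionP b : periodic_direction T b <-> b != 0 /\ periodic v w b.
Proof. by split=> -[b0 h]; split=> //; apply/SAFP. Qed.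

Lemma periodicZ (c : R) b : periodic v w b -> periodic v w (c *: b).
Proof.
move=> h B BB; have mulD : {morph *%R c : x y / x + y} by move=> x y; rewrite mulrDr.
have := h _ (biadditive_comp mulD mulD BB) => e; rewrite -[RHS]e.
by apply: eq_form_sum => p q; congr B; rewrite /cross scale_pairE /=; ring.
Qed.

Lemma normalized_ex : algebraically_periodic T -> exists b1 b2, normalized T b1 b2.
Proof.
move=> [v1 [v2 [v3 [/periodic_directionP[n1 p1] /periodic_directionP[n2 p2]
  /periodic_directionP[n3 p3] [c12 c13 c23]]]]].
(* Cramer's rule: suitable multiples of [v1] and [v3] have sum [v2], so they serve as axes for which
   [v2] has slope 1. *)
have e : (cross v2 v3 / cross v1 v3) *: v1 + (cross v1 v2 / cross v1 v3) *: v3 = v2.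
  by apply: pairE; rewrite !scale_pairE /=; move: c13; rewrite /cross => ?; field.
exists ((cross v2 v3 / cross v1 v3) *: v1), ((cross v1 v2 / cross v1 v3) *: v3).
split; last 3 first.
- by apply/periodic_directionP; split; [rewrite scaler_eq0 negb_or mulf_neq0 ?invr_eq0|exact: periodicZ].
- by rewrite e; apply/periodic_directionP.
- by apply/periodic_directionP; split; [rewrite scaler_eq0 negb_or mulf_neq0 ?invr_eq0|exact: periodicZ].
have -> : cross ((cross v2 v3 / cross v1 v3) *: v1) ((cross v1 v2 / cross v1 v3) *: v3) =
    cross v2 v3 * cross v1 v2 / cross v1 v3.
  by move: c13; rewrite !scale_pairE /cross /= => ?; field.
by rewrite !mulf_neq0 ?invr_eq0.
Qed.

(** The right-hand side does not mention the basis, so all normalizations have the same slopes and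
    one field serves for all of them. *)
Lemma periodic_slopesE b1 b2 : normalized T b1 b2 ->
  periodic_slopes T b1 b2 = [set s | balanced v w s].
Proof.
move=> [c0 /periodic_directionP[_ p1] /periodic_directionP[_ p12]
  /periodic_directionP[_ p2]].
apply/seteqP; split=> s /= => [/periodic_directionP[_]|].
  by move/(periodic_slope_balanced c0 p1 p2 p12).
move/(periodic_slope_balanced c0 p1 p2 p12) => h; apply/periodic_directionP; split=> //.
apply/eqP => e; case/eqP: c0.
have [e1 e2] := pair_split e; move: e1 e2; rewrite !scale_pairE /cross /= => e1 e2.
have -> : b1.1 = - (s * b2.1) by apply/eqP; rewrite -addr_eq0 e1.
have -> : b1.2 = - (s * b2.2) by apply/eqP; rewrite -addr_eq0 e2.
ring.
Qed.

End PeriodicField.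

Theorem theorem1p9 (R : realType) (S : translation_surface R)
    (T : triangulation S) (Q : square_decomposition S)
    (hS : algebraically_periodic T)
    (hQ : forall k : square Q, periodic_direction T (side k) /\
                               periodic_direction T (rot90 (side k))) :
  exists (K : fieldExtType rat) (i : {rmorphism K -> R}),
    is_periodic_direction_field T i /\ totally_real R K.
Proof.
have [K0 [k0 [u [l [_ l0 hl]]]]] := square_form T Q.
have mulBi : biadditive (fun a b : R => a * b).
  by split=> [b a a'|a b b']; [rewrite mulrDl|rewrite mulrDr].
(* For ordinary multiplication the formula of the squares gives twice a sum of squared lengths, and
   [k0] provides a positive term. *)
have area : form_sum (fun i => tri_vtx i 1 - tri_vtx i 0 : R * R)
    (fun i : tri T => tri_vtx i 2 - tri_vtx i 1) (fun p q => dot u p * cross u q) != 0.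
  rewrite /form_sum (hl _ _ mulBi) mulrn_eq0 /= gt_eqF // (bigD1 k0) //=.
  by rewrite ltr_pwDl ?mulr_gt0 // sumr_ge0 // => k _; rewrite mulr_ge0 // ltW.
have [K [i iE]] := balanced_number_field area.
exists K, i; split.
  by split=> [|b1 b2 /periodic_slopesE ->//]; apply: normalized_ex.
have bal x : [set s | balanced (fun j => tri_vtx j 1 - tri_vtx j 0 : R * R)
    (fun j : tri T => tri_vtx j 2 - tri_vtx j 1) s] (i x) by rewrite -iE; exists x.
exact: (@squares_totally_real R (tri T) _ _ u K i K0 k0 l bal l0 hl).
Qed.
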